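(* Let $d\geq 2$ and consider first passage percolation on $(\mathbb{Z}^d,\mathbb{E}^d)$ with i.i.d. capacities $(t(e))_{e\in\mathbb{E}^d}$ of common distribution function $F$ on $[0,+\infty)$. Let $A$ be a non degenerate hyperrectangle in $\mathbb{R}^d$, let $\vec{v}$ be one of the two unit vectors normal to $A$, and let $h:\mathbb{N}\to\mathbb{R}^+$ satisfy $\lim_{n\to\infty}h(n)=+\infty$. Then: (i) if $F$ has bounded support, then for every $\lambda>\nu(\vec{v})$, $$\liminf_{n\to\infty}\frac{-1}{\mathcal{H}^{d-1}(nA)\min(h(n),n)}\log\mathbb{P}\left[\frac{\tau(nA,h(n))}{\mathcal{H}^{d-1}(nA)}\geq\lambda\right]>0;$$ (ii) if $F$ is the exponential law of parameter $1$, then there exists $n_0=n_0(d,A,h)$ such that for every $\lambda>\nu(\vec{v})$ there exists a constant $D>0$ depending only on $d$ and $\lambda$ such that for all $n\geq n_0$, $$\mathbb{P}\left[\tau(nA,h(n))\geq\lambda\,\mathcal{H}^{d-1}(nA)\right]\geq\exp\left(-D\,\mathcal{H}^{d-1}(nA)\right);$$ (iii) if $\int_{[0,+\infty)}e^{\theta x}\,dF(x)<\infty$ for every $\theta>0$, then for every $\lambda>\nu(\vec{v})$, $$\lim_{n\to\infty}\frac{1}{\mathcal{H}^{d-1}(nA)}\log\mathbb{P}\left[\frac{\tau(nA,h(n))}{\mathcal{H}^{d-1}(nA)}\geq\lambda\right]=-\infty.$$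
   Context: $\mathbb{E}^d$ is the set of pairs of nearest neighbours in $\mathbb{Z}^d$ (for the $L^1$ norm); $t(e)\geq 0$ is the capacity of edge $e$. An edge $\langle x,y\rangle$ belongs to a set $C\subset\mathbb{R}^d$ if the segment joining $x$ and $y$ (possibly excluding endpoints) is included in $C$. For $C\subset\mathbb{R}^d$ and $F_1,F_2\subset C\cap\mathbb{Z}^d$, a stream is an assignment to each edge $e$ in $C$ of an amount $0\leq g(e)\leq t(e)$ and an orientation, such that at every vertex of $C\setminus(F_1\cup F_2)$ inflow equals outflow; the maximal flow $\phi(F_1\to F_2\text{ in }C)$ is the supremum over streams of the net amount of fluid flowing from $F_1$ to $F_2$. Equivalently (max-flow min-cut), $\phi(F_1\to F_2\text{ in }C)=\min\{\sum_{e\in E}t(e): E \text{ a set of edges in } C \text{ such that there is no path from } F_1 \text{ to } F_2 \text{ in } C\setminus E\}$. For a hyperrectangle $A$ (a closed box of dimension $d-1$) with unit normal $\vec{v}$ and $h>0$, $\mathrm{cyl}(A,h)=\{x+t\vec{v}: x\in A,\ t\in[-h,h]\}$. The set $\mathrm{cyl}(A,h)\setminus\mathrm{hyp}(A)$ ($\mathrm{hyp}(A)$ the hyperplane spanned by $A$) has two connected components $\mathcal{C}_1(A,h),\mathcal{C}_2(A,h)$; $A_i^h$ is the set of points of $\mathcal{C}_i(A,h)\cap\mathbb{Z}^d$ having a nearest neighbour in $\mathbb{Z}^d\setminus\mathrm{cyl}(A,h)$. Then $\tau(A,h)=\phi(A_1^h\to A_2^h\text{ in }\mathrm{cyl}(A,h))$.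 $\mathcal{H}^{d-1}$ denotes $(d-1)$-dimensional Hausdorff measure. $\nu(\vec{v})$ is the constant (whose existence is known when $\int x\,dF(x)<\infty$, which holds in all three cases) such that for every non degenerate hyperrectangle $A$ orthogonal to $\vec{v}$ and every $h:\mathbb{N}\to\mathbb{R}^+$ with $h(n)\to\infty$, $\tau(nA,h(n))/\mathcal{H}^{d-1}(nA)\to\nu(\vec{v})$ in $L^1$. *)

(* Defs.v *)
From HB Require Import structures.
From mathcomp Require Import all_boot all_order all_algebra.
From mathcomp Require Import all_classical all_reals all_analysis.
Set Implicit Arguments. Unset Strict Implicit. Unset Printing Implicit Defensive.
Import Order.TTheory GRing.Theory Num.Theory.
Import numFieldNormedType.Exports.
Local Open Scope classical_set_scope.
Local Open Scope ring_scope.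

Section Geometry.
Variables (R : realType) (d : nat).

Definition point := 'rV[int]_d.
Definition vecR := 'rV[R]_d.
Definition zr (x : point) : vecR := map_mx (fun z : int => z%:~R) x.
Definition unitv (i : 'I_d) : point := delta_mx 0 i.
Definition dotR (a b : vecR) : R := (a *m b^T) 0 0.

(* E^d : the edge (x, i) joins x and x + e_i; this is a bijection with the
   set of pairs of nearest neighbours of Z^d *)
Definition edge := (point * 'I_d)%type.
Definition joins (e : edge) (a b : point) : Prop :=
  (a = e.1 /\ b = e.1 + unitv e.2) \/ (b = e.1 /\ a = e.1 + unitv e.2).

Definition nneighbour (x y : point) : Prop :=
  exists i, y = x + unitv i \/ y = x - unitv i.

Definition edge_in (C : set vecR) (e : edge) : Prop :=
  forall s : R, 0 < s < 1 ->
    C (zr e.1 + s *: (zr (e.1 + unitv e.2) - zr e.1)).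

Definition walk_avoiding (C : set vecR) (E : seq edge) (p : seq point) : Prop :=
  forall k, (k.+1 < size p)%N ->
    exists e, edge_in C e /\ e \notin E /\ joins e (nth 0 p k) (nth 0 p k.+1).

Definition connected_in (C : set vecR) (E : seq edge) (F1 F2 : set point) : Prop :=
  exists (x0 : point) (p : seq point),
    F1 x0 /\ F2 (last x0 p) /\ walk_avoiding C E (x0 :: p).

Definition is_cut (C : set vecR) (F1 F2 : set point) (E : seq edge) : Prop :=
  uniq E /\ (forall e, e \in E -> edge_in C e) /\ ~ connected_in C E F1 F2.

(* maximal flow phi(F1 -> F2 in C), through the max-flow min-cut formula *)
Definition maxflow (C : set vecR) (F1 F2 : set point) (t : edge -> R) : R :=
  inf [set (\sum_(e <- E) t e)%R | E in is_cut C F1 F2].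

Definition orthonormal (u : 'I_d.-1 -> vecR) : Prop :=
  forall i j, dotR (u i) (u j) = (i == j)%:R.

Definition hrect (c : vecR) (u : 'I_d.-1 -> vecR) (l : 'I_d.-1 -> R) : set vecR :=
  [set x | exists s : 'I_d.-1 -> R,
      (forall i, 0 <= s i <= l i) /\ x = c + \sum_(i < d.-1) s i *: u i].

Definition nondegenerate_hrect (u : 'I_d.-1 -> vecR) (l : 'I_d.-1 -> R) : Prop :=
  orthonormal u /\ forall i, 0 < l i.

Definition hrect_area (n : nat) (l : 'I_d.-1 -> R) : R :=
  (n%:R ^+ d.-1) * \prod_(i < d.-1) l i.

Definition scale (n : nat) (A : set vecR) : set vecR := [set n%:R *: x | x in A].

Definition unit_normal (u : 'I_d.-1 -> vecR) (v : vecR) : Prop :=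
  dotR v v = 1 /\ forall i, dotR (u i) v = 0.

Definition cyl (A : set vecR) (v : vecR) (h : R) : set vecR :=
  [set x + t *: v | x in A & t in `[- h, h]].
Definition cyl1 (A : set vecR) (v : vecR) (h : R) : set vecR :=
  [set x + t *: v | x in A & t in `]0, h]].
Definition cyl2 (A : set vecR) (v : vecR) (h : R) : set vecR :=
  [set x + t *: v | x in A & t in `[- h, 0[].
Definition boundary_part (Ci cylAh : set vecR) : set point :=
  [set x | Ci (zr x) /\ exists y, nneighbour x y /\ ~ cylAh (zr y)].

Definition tau (A : set vecR) (v : vecR) (h : R) (t : edge -> R) : R :=
  maxflow (cyl A v h) (boundary_part (cyl1 A v h) (cyl A v h))
          (boundary_part (cyl2 A v h) (cyl A v h)) t.

End Geometry.

Section Proba.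
Local Open Scope ereal_scope.
Variables (R : realType) (d : nat) (dO : measure_display) (Omega : measurableType dO).

Definition iid_capacities (P : probability Omega R) (t : edge d -> Omega -> R)
    (F : R -> R) : Prop :=
  (forall e, measurable_fun setT (t e)) /\
  (forall e x, P [set w | (t e w <= x)%R] = (F x)%:E) /\
  (forall x, (x < 0)%R -> F x = 0%R) /\
  (forall (E : seq (edge d)) (B : edge d -> set R), uniq E ->
     (forall e, measurable (B e)) ->
     fine (P [set w | forall e, e \in E -> B e (t e w)]) =
     (\prod_(e <- E) fine (P (t e @^-1` B e)))%R).

Definition elog (x : \bar R) : \bar R :=
  if x == 0 then -oo else (ln (fine x))%:E.

Definition is_flow_constant (P : probability Omega R) (t : edge d -> Omega -> R)
    (v : vecR R d) (nu : R) : Prop :=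
  forall (c : vecR R d) (u : 'I_d.-1 -> vecR R d) (l : 'I_d.-1 -> R)
         (h : nat -> R),
    nondegenerate_hrect u l -> (forall i, dotR (u i) v = 0%R) ->
    (forall n, (0 <= h n)%R) -> h @ \oo --> +oo%R ->
    (fun n => \int[P]_w
       (`| tau (scale n (hrect c u l)) v (h n) (fun e => t e w)
           / hrect_area n l - nu |)%:E) @ \oo --> 0.

End Proba.

Definition exp_cdf (R : realType) (x : R) : R :=
  if (x < 0)%R then 0%R else (1 - expR (- x))%R.

(* Main.v *)
(** For (i) and (iii), stack K disjoint slabs in the cylinder, each paved by
    translates of a fixed cylinder of base p A and height p. Cuts of the tiles of
    one slab, completed by few edges in the gaps and along the lateral faces,
    form a cut of the big cylinder; hence tau >= lambda |nA| forces every slab to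
    carry too much flow (or its few extra edges to be huge). Slabs are
    independent, so Chernoff's bound within a slab costs exp(- eta |nA|) and
    the slabs together exp(- eta K |nA|), with K of order min(h n, n) in (i)
    and K any constant in (iii). For (ii), a number of edges depending only on d
    near the middle of a lateral face meets every cut; let all of them be larger
    than lambda |nA|. *)
Require Import Defs.
From HB Require Import structures.
From mathcomp Require Import all_boot all_order all_algebra.
From mathcomp Require Import all_classical all_reals all_analysis.
From mathcomp Require Import measurable_realfun.
From mathcomp Require Import zify ring lra.
Set Implicit Arguments. Unset Strict Implicit. Unset Printing Implicit Defensive.
Import Order.TTheory GRing.Theory Num.Theory.
Import numFieldNormedType.Exports.
Local Open Scope classical_set_scope.
Local Open Scope ring_scope.
Local Notation point := Defs.point.

(** * Cuts, vertex sets and bounds on the maximal flow *)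

Section Cuts.
Variables (R : realType) (d : nat).
Implicit Types (C : set (vecR R d)) (F : set (point d)) (y : edge d -> R).
Implicit Types (E L Q : seq (edge d)) (S : point d -> bool).

(** The obstacle is that the sources and sinks of the big cylinder also occupy its lateral faces,
    where they are separated at height 0. A cut built in a slab at height z must come down to height
    0 along those faces, at a cost of order z n^(d-2); this is a small fraction of n^(d-1) only
    while z is at most a small multiple of n, which limits the slabs to order min(h n, n). Cuts are
    handled as vertex sets: the side of a vertex can be prescribed region by region, whereas edge
    cuts of neighbouring regions would have to be matched. Tiles are shifted by lattice vectors, so
    each tile flow has the law of the tile at the origin, whose mean is close to [nu] times its area
    by the convergence defining [nu], taken with heights equal to n. For a fixed tile, this mean and
    one exponential moment suffice for Chernoff's bound. Capacities are nonnegative only almost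
    surely while bounds through cuts are pointwise, so the two upper bounds are proved for clipped
    capacities and then transferred. *)

Definition head_pt (e : edge d) : point d := e.1 + unitv e.2.

Lemma sum_subset_le y L1 L2 : (forall e, 0 <= y e) -> uniq L1 ->
  {subset L1 <= L2} -> \sum_(e <- L1) y e <= \sum_(e <- L2) y e.
Proof.
move=> y0 u1 s12.
have h2 : \sum_(e <- undup L2) y e <= \sum_(e <- L2) y e.
  elim: L2 {s12} => //= a s IH; case: ifP => [_|_]; rewrite !big_cons.
    by rewrite (le_trans IH)// lerDr.
  by rewrite lerD2l.
apply: le_trans h2.
have p : perm_eq L1 [seq e <- undup L2 | e \in L1].
  apply: uniq_perm => // [|e]; first exact/filter_uniq/undup_uniq.
  rewrite mem_filter mem_undup; case: (boolP (e \in L1)) => //= h.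
  by rewrite s12.
rewrite (perm_big _ p) big_filter /= [leRHS](bigID (mem L1)) /= lerDl.
exact: sumr_ge0.
Qed.

(** Supplies one cut, so that the infimum in [maxflow] runs over a nonempty set: without the edges
    of [C] only the trivial walk remains, and it cannot join disjoint sets. *)
Lemma all_edges_cut C F1 F2 L : (forall e, edge_in C e -> e \in L) ->
  (forall x, F1 x -> F2 x -> False) ->
  is_cut C F1 F2 [seq e <- undup L | `[< edge_in C e >]].
Proof.
move=> hL dis; split; first exact/filter_uniq/undup_uniq.
split=> [e|[x0 [p [h1 [h2 hw]]]]].
  by rewrite mem_filter => /andP[/asboolP].
case: p h2 hw => [|a p] /= h2 hw; first exact: dis h1 h2.
have [//|e [Ce [/negP nE _]]] := hw 0%N.
by apply: nE; rewrite mem_filter mem_undup hL// andbT; apply/asboolP.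
Qed.

(** A walk from [F1] to [F2] starts in [S] and ends outside it, so one of its edges changes side. *)
Lemma vertex_cut C F1 F2 S L :
  (forall x, F1 x -> S x) -> (forall x, F2 x -> ~~ S x) ->
  (forall e, edge_in C e -> S e.1 != S (head_pt e) -> e \in L) ->
  is_cut C F1 F2
    [seq e <- undup L | `[< edge_in C e >] && (S e.1 != S (head_pt e))].
Proof.
move=> h1 h2 hL; split; first exact/filter_uniq/undup_uniq.
split=> [e|[x0 [p [F1x [F2x hw]]]]].
  by rewrite mem_filter => /andP[/andP[/asboolP]].
have : forall k, (k < size (x0 :: p))%N -> S (nth 0 (x0 :: p) k).
  elim=> [_|k IH hk]; first exact: h1.
  have Sk := IH (ltnW hk).
  have [e [Ce [/negP nE je]]] := hw _ hk.
  apply: contrapT => /negP nS; apply: nE.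
  have cr : S e.1 != S (head_pt e).
    rewrite /head_pt; case: je => -[ea eb]; move: Sk nS; rewrite ea eb => Sk nS.
      by rewrite Sk (negbTE nS).
    by rewrite Sk (negbTE nS).
  by rewrite mem_filter mem_undup hL// cr andbT andbT; apply/asboolP.
move=> /(_ (size p)) /= /(_ (ltnSn _)).
by rewrite nth_last -/(last x0 (x0 :: p)) /= (negbTE (h2 _ F2x)).
Qed.

Lemma maxflow_le_cut C F1 F2 y E : (forall e, 0 <= y e) ->
  is_cut C F1 F2 E -> maxflow C F1 F2 y <= \sum_(e <- E) y e.
Proof.
move=> y0 cE; apply: ge_inf; last by exists E.
by exists 0 => _ [E' _ <-]; exact: sumr_ge0.
Qed.

Lemma maxflow_le_boundary C F1 F2 y S L : (forall e, 0 <= y e) ->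
  (forall x, F1 x -> S x) -> (forall x, F2 x -> ~~ S x) ->
  (forall e, edge_in C e -> S e.1 != S (head_pt e) -> e \in L) ->
  maxflow C F1 F2 y <= \sum_(e <- L) y e.
Proof.
move=> y0 h1 h2 hL; apply: le_trans (maxflow_le_cut y0 (vertex_cut h1 h2 hL)) _.
apply: sum_subset_le => //; first exact/filter_uniq/undup_uniq.
by move=> e; rewrite mem_filter mem_undup => /andP[].
Qed.

Lemma maxflow_ge0 C F1 F2 y : (forall e, 0 <= y e) -> 0 <= maxflow C F1 F2 y.
Proof.
move=> y0; set A := [set (\sum_(e <- E) y e)%R | E in is_cut C F1 F2].
(* If there is no cut, the infimum is that of the empty set, 0 by convention. *)
rewrite /maxflow -/A; have [->|/set0P A0] := eqVneq A set0; first by rewrite inf0.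
by apply: lb_le_inf => // _ [E' _ <-]; exact: sumr_ge0.
Qed.

Definition reach C F1 E (x : point d) : Prop :=
  exists (x0 : point d) (p : seq (point d)),
    [/\ F1 x0, last x0 p = x & walk_avoiding C E (x0 :: p)].

Lemma reach_refl C F1 E x : F1 x -> reach C F1 E x.
Proof. by move=> h; exists x, [::]; split => // -[]. Qed.

Lemma reach_step C F1 E a b e : reach C F1 E a -> edge_in C e -> e \notin E ->
  joins e a b -> reach C F1 E b.
Proof.
move=> [x0 [p [h1 h2 h3]]] Ce nE je; exists x0, (rcons p b); split => //.
  by rewrite last_rcons.
move=> k; rewrite /= size_rcons ltnS leq_eqVlt => /predU1P[[->]|hk].
  exists e; split => //; split => //.
  rewrite -rcons_cons !nth_rcons /= ltnSn eqxx ltnn.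
  by rewrite -[X in joins e X]h2 (last_nth 0) in je *.
have [e' [? [? je']]] := h3 k hk.
exists e'; split => //; split => //.
rewrite -rcons_cons !nth_rcons /= (ltn_trans (ltnSn k) hk).
by move: hk; rewrite ltnS => ->.
Qed.

(** Converse of [maxflow_le_boundary]: take for [S] the vertices reached from [F1] off a nearly
    optimal cut; an edge leaving [S] must lie in that cut. The slack [eta] replaces attainment of
    the infimum. *)
Lemma maxflow_vertex_set C F1 F2 y L (eta : R) : (forall e, 0 <= y e) ->
  (forall e, edge_in C e -> e \in L) ->
  (forall x, F1 x -> F2 x -> False) -> 0 < eta ->
  exists S E, [/\ forall x, F1 x -> S x, forall x, F2 x -> ~~ S x,
    forall e, edge_in C e -> S e.1 != S (head_pt e) -> e \in E,
    uniq E /\ (forall e, e \in E -> edge_in C e) &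
    \sum_(e <- E) y e <= maxflow C F1 F2 y + eta].
Proof.
move=> y0 hL dis eta0.
set A := [set (\sum_(e <- E) y e)%R | E in is_cut C F1 F2].
have hA : has_inf A.
  split; first by eexists; eexists; [exact: all_edges_cut hL dis|].
  by exists 0 => _ [E' _ <-]; exact: sumr_ge0.
have [_ [E [uE [CE nE]] <-] hE] := inf_adherent eta0 hA.
exists (fun x => `[< reach C F1 E x >]), E; split => //; last exact: ltW.
- by move=> x /reach_refl h; exact/asboolP.
- move=> x F2x; apply/negP => /asboolP[x0 [p [h1 h2 h3]]].
  by apply: nE; exists x0, p; rewrite h2.
- move=> e Ce; apply: contraR => nEe; apply/eqP/asbool_equiv_eq; split => h.
    by apply: (reach_step h Ce nEe); left.
  by apply: (reach_step h Ce nEe); right.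
Qed.

(** Every cut contains an edge of [Q], and that edge alone costs [m]. *)
Lemma maxflow_ge C F1 F2 y L Q (m : R) : (forall e, 0 <= y e) ->
  (forall e, edge_in C e -> e \in L) ->
  (forall x, F1 x -> F2 x -> False) ->
  (forall E, (forall e, e \in Q -> e \notin E) -> ~ is_cut C F1 F2 E) ->
  (forall e, e \in Q -> m <= y e) ->
  m <= maxflow C F1 F2 y.
Proof.
move=> y0 hL dis hQ hm; apply: lb_le_inf.
  by eexists; eexists; [exact: all_edges_cut hL dis|].
move=> _ [E cE <-].
have [e eQ eE] : exists2 e, e \in Q & e \in E.
  apply: contrapT => h; apply: (hQ E) => // e eQ; apply/negP => eE.
  by apply: h; exists e.
by rewrite (big_rem e)//= (le_trans (hm _ eQ))// lerDl sumr_ge0.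
Qed.

(** Locality of the flow; this is what makes the flows of edge-disjoint tiles independent. *)
Lemma maxflow_eq C F1 F2 y1 y2 : (forall e, edge_in C e -> y1 e = y2 e) ->
  maxflow C F1 F2 y1 = maxflow C F1 F2 y2.
Proof.
move=> h; rewrite /maxflow; congr inf; apply/seteqP; split => _ [E [u [c n]] <-];
  exists E => //; apply: eq_big_seq => e eE; rewrite h//; exact: c.
Qed.

End Cuts.

(** * Scalar products and lattice vectors *)

Section DotProduct.
Variables (R : realType) (d : nat).
Implicit Types (a b w x : vecR R d).

Lemma dotRE a b : dotR a b = \sum_j a 0 j * b 0 j.
Proof. by rewrite /dotR mxE; apply: eq_bigr => j _; rewrite mxE. Qed.

Lemma dotRC a b : dotR a b = dotR b a.
Proof. by rewrite !dotRE; apply: eq_bigr => j _; rewrite mulrC. Qed.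

Lemma dotRDr w a b : dotR w (a + b) = dotR w a + dotR w b.
Proof.
by rewrite !dotRE -big_split/=; apply: eq_bigr => j _; rewrite mxE mulrDr.
Qed.

Lemma dotRZr w (s : R) a : dotR w (s *: a) = s * dotR w a.
Proof.
by rewrite !dotRE mulr_sumr; apply: eq_bigr => j _; rewrite mxE mulrCA.
Qed.

Lemma dotRNr w a : dotR w (- a) = - dotR w a.
Proof. by rewrite -scaleN1r dotRZr mulN1r. Qed.

Lemma dotRBr w a b : dotR w (a - b) = dotR w a - dotR w b.
Proof. by rewrite dotRDr dotRNr. Qed.

Lemma dotR0r w : dotR w 0 = 0.
Proof. by rewrite -[0](scale0r w) dotRZr mul0r. Qed.

Lemma dotR_sumr w (I : finType) (f : I -> vecR R d) :
  dotR w (\sum_i f i) = \sum_i dotR w (f i).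
Proof. by apply: (big_morph (dotR w)); [exact: dotRDr|exact: dotR0r]. Qed.

Lemma unit_coord_le1 w j : dotR w w = 1 -> `|w 0 j| <= 1.
Proof.
rewrite dotRE (bigD1 j)//= => h; rewrite -(@ler_pXn2r _ 2)// ?nnegrE//.
rewrite expr1n real_normK ?num_real// expr2 -h lerDl sumr_ge0// => i _.
by rewrite -expr2 sqr_ge0.
Qed.

Lemma dotR_le_sup w x (r : R) : dotR w w = 1 -> (forall j, `|x 0 j| <= r) ->
  `|dotR w x| <= d%:R * r.
Proof.
move=> h hr; rewrite dotRE (le_trans (ler_norm_sum _ _ _))//.
have -> : d%:R * r = \sum_(j < d) r by rewrite sumr_const card_ord mulr_natl.
apply: ler_sum => j _; rewrite normrM -[leRHS]mul1r ler_pM//.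
exact: unit_coord_le1.
Qed.

Lemma dotR_unitv w j : dotR w (zr R (unitv j)) = w 0 j.
Proof.
rewrite dotRE (bigD1 j)//= !mxE !eqxx mulr1 big1 ?addr0// => i ij.
by rewrite !mxE (negbTE ij) mulr0.
Qed.

Lemma zrD (x y : point d) : zr R (x + y) = zr R x + zr R y.
Proof. exact: map_mxD. Qed.

Lemma zrN (x : point d) : zr R (- x) = - zr R x.
Proof. exact: map_mxN. Qed.

Lemma zrB (x y : point d) : zr R (x - y) = zr R x - zr R y.
Proof. by rewrite zrD zrN. Qed.

End DotProduct.

(** * Cylinders in an orthonormal frame *)

Section Frame.
Variables (R : realType) (k : nat).
Let d := k.+1.
Variables (u : 'I_k -> vecR R d) (v : vecR R d).
Hypotheses (ou : Defs.orthonormal (d := d) u) (uv : unit_normal (d := d) u v).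
Implicit Types (x c : vecR R d) (L : 'I_k -> R) (h : R).

Let uu i : dotR (u i) (u i) = 1. Proof. by rewrite ou eqxx. Qed.
Let vv : dotR v v = 1. Proof. exact: uv.1. Qed.

(** The square matrix with rows [v] and [u i] has orthonormal rows, hence is orthogonal, and its
    columns give the resolution of the identity. *)
Lemma frame_expand x :
  x = \sum_i dotR (u i) x *: u i + dotR v x *: v.
Proof.
pose M : 'M[R]_(1 + k) := col_mx v (\matrix_i u i).
have MM : M *m M^T = 1%:M.
  rewrite tr_col_mx mul_col_row [RHS](@scalar_mx_block _ 1 k); congr block_mx.
  - by apply/matrixP => i j; rewrite !ord1 -[LHS]/(dotR v v) vv mxE.
  - apply/matrixP => i j; rewrite ord1 mxE [RHS]mxE -[RHS](uv.2 j) dotRC dotRE.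
    by apply: eq_bigr => m _; rewrite !mxE.
  - apply/matrixP => i j; rewrite (ord1 j) mxE [RHS]mxE -[RHS](uv.2 i) dotRE.
    by apply: eq_bigr => m _; rewrite !mxE.
  - apply/matrixP => i j; rewrite mxE [RHS]mxE -(ou i j) dotRE.
    by apply: eq_bigr => m _; rewrite !mxE.
have MTM := mulmx1C MM.
rewrite -{1}[x]mulmx1 -MTM mulmxA tr_col_mx mul_mx_row mul_row_col addrC.
congr (_ + _).
  rewrite mulmx_sum_row; apply: eq_bigr => i _; rewrite rowK; congr (_ *: _).
  by rewrite dotRC dotRE mxE; apply: eq_bigr => m _; rewrite !mxE.
by rewrite [x *m _]mx11_scalar mul_scalar_mx -/(dotR x v) dotRC.
Qed.

Lemma dotR_frame_u (s : 'I_k -> R) (r : R) i :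
  dotR (u i) (\sum_j s j *: u j + r *: v) = s i.
Proof.
rewrite dotRDr dotRZr uv.2 mulr0 addr0 dotR_sumr (bigD1 i)//= dotRZr uu mulr1.
by rewrite big1 ?addr0// => j ji; rewrite dotRZr ou eq_sym (negbTE ji) mulr0.
Qed.

Lemma dotR_frame_v (s : 'I_k -> R) (r : R) :
  dotR v (\sum_j s j *: u j + r *: v) = r.
Proof.
rewrite dotRDr dotRZr vv mulr1 dotR_sumr big1 ?add0r// => j _.
by rewrite dotRZr dotRC uv.2 mulr0.
Qed.

Lemma scale_hrect n c L : (0 < n)%N ->
  scale n (hrect (d := d) c u L) = hrect (d := d) (n%:R *: c) u (fun i => n%:R * L i).
Proof.
move=> n0; apply/seteqP; split => [_ [_ [s [hs ->]] <-]|_ [s [hs ->]]].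
  exists (fun i => n%:R * s i); split.
    by move=> i; have /andP[a b] := hs i; rewrite mulr_ge0//= ler_wpM2l.
  rewrite scalerDr scaler_sumr; congr (_ + _); apply: eq_bigr => i _.
  by rewrite scalerA.
have nr : n%:R != 0 :> R by rewrite pnatr_eq0 -lt0n.
have nr0 : 0 < n%:R :> R by rewrite ltr0n.
exists (c + \sum_i (s i / n%:R) *: u i).
  exists (fun i => s i / n%:R); split => // i.
  have /andP[a b] := hs i.
  by rewrite divr_ge0//= ler_pdivrMr// mulrC.
rewrite scalerDr scaler_sumr; congr (_ + _); apply: eq_bigr => i _.
by rewrite scalerA mulrCA divff// mulr1.
Qed.

Definition incyl c L h x : bool :=
  [forall i, 0 <= dotR (u i) (x - c) <= L i] && (`|dotR v (x - c)| <= h).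

Lemma incylP c L h x : reflect
  ((forall i, 0 <= dotR (u i) (x - c) <= L i) /\ `|dotR v (x - c)| <= h)
  (incyl c L h x).
Proof. by apply: (iffP andP) => -[/forallP ? ?]; split => //; exact/forallP. Qed.

(** Common form of [cyl], [cyl1] and [cyl2], which differ only in the interval of heights. *)
Lemma cylindersP c L (I : set R) x :
  [set a + t *: v | a in hrect (d := d) c u L & t in I] x <->
  (forall i, 0 <= dotR (u i) (x - c) <= L i) /\ I (dotR v (x - c)).
Proof.
split=> [[_ [s [hs ->]]] [r Ir <-]|[hL hI]].
  have -> : c + \sum_(i < k) s i *: u i + r *: v - c
     = \sum_(i < k) s i *: u i + r *: v by rewrite -[c + _ + _]addrA [c + _]addrC addrK.
  by rewrite dotR_frame_v; split => // i; rewrite dotR_frame_u.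
exists (c + \sum_i dotR (u i) (x - c) *: u i); first by eexists; split; [exact: hL|].
by eexists; [exact: hI|]; rewrite -addrA -frame_expand subrKC.
Qed.

Lemma cylP c L h x : cyl (hrect (d := d) c u L) v h x <-> incyl c L h x.
Proof.
apply: (iff_trans (cylindersP _ _ _ _)); rewrite /= in_itv/=; split.
  by rewrite -ler_norml => -[h1 h2]; exact/incylP.
by move=> /incylP[h1 h2]; rewrite -ler_norml.
Qed.

Lemma cyl1P c L h x : cyl1 (hrect (d := d) c u L) v h x <->
  incyl c L h x /\ 0 < dotR v (x - c).
Proof.
apply: (iff_trans (cylindersP _ _ _ _)); rewrite /= in_itv/=; split.
  move=> [h1 /andP[h2 h3]]; split => //; apply/incylP; split => //.
  by rewrite gtr0_norm.
move=> [/incylP[h1 h2] h3]; split => //; rewrite h3/=.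
by rewrite gtr0_norm in h2.
Qed.

Lemma cyl2P c L h x : cyl2 (hrect (d := d) c u L) v h x <->
  incyl c L h x /\ dotR v (x - c) < 0.
Proof.
apply: (iff_trans (cylindersP _ _ _ _)); rewrite /= in_itv/=; split.
  move=> [h1 /andP[h2 h3]]; split => //; apply/incylP; split => //.
  by rewrite ltr0_norm// lerNl.
move=> [/incylP[h1 h2] h3]; split => //; rewrite h3 andbT.
by rewrite ltr0_norm// lerNl in h2.
Qed.

(** Membership of an edge concerns its open segment only. Each constraint defining a closed cylinder
    is affine along the segment, so it passes to the endpoints. *)
Lemma affine_ge0_ends (a b : R) : (forall s, 0 < s < 1 -> 0 <= a + s * b) ->
  0 <= a /\ 0 <= a + b.
Proof.
move=> H; have lim (a' b' : R) :
    (forall s, 0 < s < 1 -> 0 <= a' + s * b') -> 0 <= a'.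
  move=> {}H; rewrite leNgt; apply/negP => a0.
  (* So small that [s * |b'|] is at most half of [- a'], which makes [a' + s * b'] negative. *)
  pose s := - a' / (2 * (- a' + `|b'| + 1)).
  have D : 0 < - a' + `|b'| + 1 by rewrite ltr_wpDl// addr_ge0// lerNr oppr0 ltW.
  have s1 : 0 < s < 1.
    rewrite divr_gt0 ?oppr_gt0 ?mulr_gt0//= ltr_pdivrMr ?mulr_gt0// mul1r.
    have := normr_ge0 b'; lra.
  have := H _ s1; have /andP[s0 s01] := s1.
  have h1 : s * b' <= s * `|b'| by rewrite ler_pM2l// ler_norm.
  have h2 : s * (2 * (- a' + `|b'| + 1)) = - a'.
    by rewrite /s mulfVK// mulf_neq0// gt_eqF.
  have h3 : 0 <= s * (- a' + 1) by apply: mulr_ge0; lra.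
  lra.
split; first exact: lim H.
apply: (lim _ (- b)) => s /andP[s0 s1].
have /H : 0 < 1 - s < 1 by lra.
lra.
Qed.

(** Convexity gives one direction and closedness, through [affine_ge0_ends], the other. *)
Lemma edge_in_cylP c L h (e : edge d) :
  edge_in (cyl (hrect (d := d) c u L) v h) e <->
  incyl c L h (zr R e.1) && incyl c L h (zr R (head_pt e)).
Proof.
rewrite /edge_in -/(head_pt e).
have E s w : dotR w (zr R e.1 + s *: (zr R (head_pt e) - zr R e.1) - c) =
   dotR w (zr R e.1 - c) + s * (dotR w (zr R (head_pt e) - c) - dotR w (zr R e.1 - c)).
  by rewrite !dotRBr dotRDr dotRZr dotRBr; lra.
split => [H|/andP[/incylP[h1 h2] /incylP[h3 h4]] s /andP[s0 s1]]; last first.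
  apply/cylP/incylP; split => [i|]; rewrite E.
    have /andP[p1 p2] := h1 i; have /andP[q1 q2] := h3 i.
    set A := dotR _ _ in p1 p2 *; set B := dotR _ _ in q1 q2 *.
    by apply/andP; split; nra.
  move: h2 h4; rewrite !ler_norml => /andP[p1 p2] /andP[q1 q2].
  set A := dotR _ _ in p1 p2 *; set B := dotR _ _ in q1 q2 *.
  by apply/andP; split; nra.
have H' s : 0 < s < 1 -> _ := fun hs =>
  elimT (incylP _ _ _ _) (iffLR (cylP _ _ _ _) (H s hs)).
have hi i : (0 <= dotR (u i) (zr R e.1 - c) <= L i) &&
    (0 <= dotR (u i) (zr R (head_pt e) - c) <= L i).
  set A := dotR _ _; set B := dotR _ _.
  have [|p1 p2] := @affine_ge0_ends A (B - A).
    by move=> s /H'[/(_ i)]; rewrite E => /andP[].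
  have [|q1 q2] := @affine_ge0_ends (L i - A) (A - B).
    move=> s /H'[/(_ i)]; rewrite E -/A -/B => /andP[_ ? _]; lra.
  by apply/andP; split; lra.
set A := dotR v (zr R e.1 - c); set B := dotR v (zr R (head_pt e) - c).
have [|p1 p2] := @affine_ge0_ends (h + A) (B - A).
  move=> s /H'[_]; rewrite E -/A -/B ler_norml => /andP[? ?]; lra.
have [|q1 q2] := @affine_ge0_ends (h - A) (A - B).
  move=> s /H'[_]; rewrite E -/A -/B ler_norml => /andP[? ?]; lra.
apply/andP; split; apply/incylP; split => [i|]; try by have /andP[] := hi i.
  by rewrite ler_norml -/A; lra.
by rewrite ler_norml -/B; lra.
Qed.

Lemma boundary1P c L h (x : point d) :
  boundary_part (cyl1 (hrect (d := d) c u L) v h) (cyl (hrect (d := d) c u L) v h) x <->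
  [/\ incyl c L h (zr R x), 0 < dotR v (zr R x - c) &
      exists2 y, nneighbour x y & ~~ incyl c L h (zr R y)].
Proof.
split=> [[/cyl1P[h1 h2] [y [h3 h4]]]|[h1 h2 [y h3 h4]]].
  by split => //; exists y => //; apply/negP => /cylP.
split; first exact/cyl1P.
by exists y; split => // /cylP; exact/negP.
Qed.

Lemma boundary2P c L h (x : point d) :
  boundary_part (cyl2 (hrect (d := d) c u L) v h) (cyl (hrect (d := d) c u L) v h) x <->
  [/\ incyl c L h (zr R x), dotR v (zr R x - c) < 0 &
      exists2 y, nneighbour x y & ~~ incyl c L h (zr R y)].
Proof.
split=> [[/cyl2P[h1 h2] [y [h3 h4]]]|[h1 h2 [y h3 h4]]].
  by split => //; exists y => //; apply/negP => /cylP.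
split; first exact/cyl2P.
by exists y; split => // /cylP; exact/negP.
Qed.

Lemma boundary_disjoint c L h (x : point d) :
  boundary_part (cyl1 (hrect (d := d) c u L) v h) (cyl (hrect (d := d) c u L) v h) x ->
  boundary_part (cyl2 (hrect (d := d) c u L) v h) (cyl (hrect (d := d) c u L) v h) x ->
  False.
Proof. by move=> /boundary1P[_ h1 _] /boundary2P[_ h2 _]; lra. Qed.

(** A unit vector has entries at most 1, so frame coordinates vary by at most 1 along an edge; the
    margins 1 and 2 used in the gluing rest on this. *)
Lemma nneighbour_dot w c (x y : point d) : dotR w w = 1 -> nneighbour x y ->
  `|dotR w (zr R y - c) - dotR w (zr R x - c)| <= 1.
Proof.
move=> ww [i xy]; rewrite -dotRBr opprB addrA subrK -zrB.
have [->|->] : y - x = unitv i \/ y - x = - unitv i.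
- by case: xy => ->; [left|right]; rewrite addrC addKr.
- by rewrite dotR_unitv unit_coord_le1.
- by rewrite zrN dotRNr normrN dotR_unitv unit_coord_le1.
Qed.

Lemma nneighbour_head (e : edge d) : nneighbour e.1 (head_pt e).
Proof. by exists e.2; left. Qed.

Lemma nneighbour_sym (x y : point d) : nneighbour x y -> nneighbour y x.
Proof.
by move=> [i [] ->]; exists i; [right|left]; rewrite ?addrK ?subrK.
Qed.

End Frame.

(** * Counting lattice points in rotated boxes *)

Section Counting.
Variables (R : realType) (k : nat).
Let d := k.+1.
Variables (u : 'I_k -> vecR R d) (v : vecR R d).
Hypotheses (ou : Defs.orthonormal (d := d) u) (uv : unit_normal (d := d) u v).
Implicit Types (x c : vecR R d) (lo len : 'I_k -> R).

Let uu i : dotR (u i) (u i) = 1. Proof. by rewrite ou eqxx. Qed.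
Let vv : dotR v v = 1. Proof. exact: uv.1. Qed.

Definition lattice_floor x : point d := map_mx Num.floor x.

Lemma lattice_floor_itv x j : 0 <= x 0 j - zr R (lattice_floor x) 0 j < 1.
Proof.
rewrite !mxE; have := floor_itv (x 0 j); rewrite intrD => /andP[? ?].
by apply/andP; split; lra.
Qed.

Lemma frame_sup_le x (r : R) : (forall i, `|dotR (u i) x| <= r) -> `|dotR v x| <= r ->
  forall j, `|x 0 j| <= d%:R * r.
Proof.
move=> hu hv j; rewrite {1}(frame_expand ou uv x) mxE summxE.
rewrite (le_trans (ler_normD _ _))// /d -natr1 mulrDl mul1r lerD//.
  rewrite (le_trans (ler_norm_sum _ _ _))//.
  have -> : k%:R * r = \sum_(i < k) r by rewrite sumr_const card_ord mulr_natl.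
  apply: ler_sum => i _; rewrite mxE normrM -[leRHS]mulr1 ler_pM//.
  exact: unit_coord_le1.
by rewrite mxE normrM -[leRHS]mulr1 ler_pM//; exact: unit_coord_le1.
Qed.

Let offsets := [seq (\row_j (val (f j))%:Z - const_mx d%:Z : point d)
  | f : {ffun 'I_d -> 'I_(2 * d + 1).+1}].

Let offsetP (z : point d) : (forall j, - d%:Z <= z 0 j <= d%:Z + 1) -> z \in offsets.
Proof.
move=> hz; pose f : {ffun 'I_d -> 'I_(2 * d + 1).+1} :=
  [ffun j => inord (absz (z 0 j + d%:Z))].
apply/mapP; exists f; first by rewrite mem_enum.
apply/rowP => j; rewrite !mxE ffunE.
have := hz j => /andP[h1 h2].
set w := z 0 j in h1 h2 *.
pose a := absz (w + d%:Z)%R.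
have lt : (a < (2 * d + 1).+1)%N by rewrite /a; lia.
rewrite /= (inordK lt) /a; lia.
Qed.

(** The box is paved by unit cells of the frame. A point of a cell is within [d] of its corner in
    each lattice coordinate ([frame_sup_le]), so it differs from the rounded corner by a vector of
    [offsets], with entries from -d to d + 1: hence the 2d + 2 choices per coordinate. *)
Lemma rotated_box_list c lo len (b0 H : R) : (forall i, 0 <= len i) -> 0 <= H ->
  exists s : seq (point d),
    (forall x : point d, (forall i, lo i <= dotR (u i) (zr R x - c) <= lo i + len i) ->
       b0 <= dotR v (zr R x - c) <= b0 + H -> x \in s) /\
    (size s)%:R <= (2 * d + 1).+1%:R ^+ d * (\prod_i (len i + 1)) * (H + 1).
Proof.
move=> l0 H0.
pose N i := (Num.truncn (len i)).+1; pose N' := (Num.truncn H).+1.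
pose M := {dffun forall i : 'I_k, 'I_(N i)}.
pose ctr (m : M) (m' : 'I_N') : point d := lattice_floor
  (c + (\sum_i (lo i + (val (m i))%:R) *: u i + (b0 + m'%:R) *: v)).
exists [seq z + o | z <- [seq ctr m m' | m <- enum {: M}, m' <- enum 'I_N'],
                    o <- offsets]; split; last first.
  rewrite !size_allpairs -!cardE card_ord size_image card_ffun !card_ord.
  rewrite card_dep_ffun.
  have -> : foldr muln 1%N [seq #|'I_(N i)| | i : 'I_k] = (\prod_i N i)%N.
    rewrite foldrE big_map big_enum /=.
    by apply: eq_bigr => i _; rewrite card_ord.
  rewrite !natrM natrX natr_prod mulrC -mulrA ler_wpM2l ?exprn_ge0//.
  apply: ler_pM => //; first by apply: prodr_ge0.
    by apply: ler_prod => i _; rewrite ler0n/= -natr1 lerD2r truncn_le.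
  by rewrite -natr1 lerD2r truncn_le.
move=> x hx hb.
pose m : M := [ffun i => inord (Num.truncn (dotR (u i) (zr R x - c) - lo i))].
pose m' : 'I_N' := inord (Num.truncn (dotR v (zr R x - c) - b0)).
have trunc_inord (y z : R) : 0 <= y <= z ->
    0 <= y - (val (inord (Num.truncn y) : 'I_(Num.truncn z).+1))%:R <= 1.
  move=> /andP[y0 yz]; rewrite /= inordK; last first.
    by rewrite ltnS le_truncn.
  by have /andP[] := truncn_itv y0; rewrite -natr1 => ? ?; apply/andP; split; lra.
apply/allpairsP; exists (ctr m m', x - ctr m m'); split => /=.
- by apply/allpairsP; exists (m, m'); split => //=; rewrite mem_enum.
- pose w := c + (\sum_i (lo i + (val (m i))%:R) *: u i + (b0 + m'%:R) *: v).
  have hw : forall j, `|(zr R x - w) 0 j| <= d%:R * 1.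
    apply: frame_sup_le => [i|].
      rewrite /w opprD addrA dotRBr (dotR_frame_u ou uv) ffunE.
      have := trunc_inord (dotR (u i) (zr R x - c) - lo i) (len i).
      have /andP[? ?] := hx i; rewrite ler_norml.
      set V := (val _)%:R; move=> /(_ _)/andP[|? ?]; last by apply/andP; split; lra.
      by apply/andP; split; lra.
    rewrite /w opprD addrA dotRBr (dotR_frame_v uv).
    have := trunc_inord (dotR v (zr R x - c) - b0) H.
    have /andP[? ?] := hb; rewrite ler_norml.
    set V := (val _)%:R; move=> /(_ _)/andP[|? ?]; last by apply/andP; split; lra.
    by apply/andP; split; lra.
  have -> : ctr m m' = lattice_floor w by [].
  move: hw; generalize w => {}w hw.
  apply: offsetP => j; have := hw j; have := lattice_floor_itv w j.
  rewrite !mxE mulr1 ler_norml => /andP[p1 p2] /andP[q1 q2].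
  rewrite -!(ler_int R) !intrD !intrN -!pmulrn; apply/andP; split; lra.
- by rewrite addrC subrK.
Qed.

End Counting.

(** * Gluing cuts of tiles into a cut of the cylinder *)

Section Gluing.
Variables (R : realType) (k : nat).
Let d := k.+1.
Variables (u : 'I_k -> vecR R d) (v : vecR R d).
Hypotheses (ou : Defs.orthonormal (d := d) u) (uv : unit_normal (d := d) u v).
Implicit Types (c : vecR R d) (L : 'I_k -> R) (h : R) (x w : point d).

Let uu i : dotR (u i) (u i) = 1. Proof. by rewrite ou eqxx. Qed.
Let vv : dotR v v = 1. Proof. exact: uv.1. Qed.

(** Finiteness of the set of edges; the absolute values cover side lengths and heights of any
    sign. *)
Lemma cyl_edges c L h : exists s : seq (edge d),
  forall e, edge_in (cyl (hrect (d := d) c u L) v h) e -> e \in s.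
Proof.
have [s [hs _]] := @rotated_box_list R k u v ou uv c (fun _ => 0)
  (fun i => `|L i|) (- h) `|2 * h| (fun i => normr_ge0 _) (normr_ge0 _).
exists [seq (x, i) | x <- s, i <- enum 'I_d] => -[x i] /(edge_in_cylP ou uv).
move=> /andP[/incylP[h1 h2] _]; apply/allpairsP; exists (x, i); split => //=.
  apply: hs => [j|].
    have /andP[? ?] := h1 j; have := ler_norm (L j) => ?.
    by rewrite add0r; apply/andP; split; lra.
  move: h2; rewrite ler_norml => /andP[? ?]; have := ler_norm (2 * h) => ?.
  by apply/andP; split; lra.
by rewrite mem_enum.
Qed.

Definition cylflow c L h (y : edge d -> R) : R :=
  maxflow (cyl (hrect (d := d) c u L) v h)
    (boundary_part (cyl1 (hrect (d := d) c u L) v h) (cyl (hrect (d := d) c u L) v h))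
    (boundary_part (cyl2 (hrect (d := d) c u L) v h) (cyl (hrect (d := d) c u L) v h)) y.

Definition shift_edge w (e : edge d) : edge d := (e.1 + w, e.2).

Variables (c : vecR R d) (L : 'I_k -> R) (h : R).
Variables (L' : 'I_k -> R) (h' : R) (I : finType) (w : I -> point d) (z : R).

Let al i x := dotR (u i) (zr R x - c).
Let be x := dotR v (zr R x - c).
Let D : R := d%:R.

Definition in_tile j x := incyl u v 0 L' h' (zr R (x - w j)).

(** Where the glued set may change side outside the tiles: in strips along the lateral faces, where
    the cut passes from height [z] to height 0, and in the gaps between tiles around height [z]. The
    margins absorb one lattice step and the rounding of the tile positions. *)
Definition bad_edge (e : edge d) : bool :=
  incyl u v c L h (zr R e.1) &&
  ([exists i, ~~ (2 <= al i e.1 <= L i - 2)] && (-1 <= be e.1 <= z + 1)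
   || (`|be e.1 - z| <= D + 1) && ~~ [exists j, in_tile j e.1 && in_tile j (head_pt e)]).

Hypothesis tile_disj : forall j j' x, in_tile j x -> in_tile j' x -> j = j'.
Hypothesis tile_far : forall j x, in_tile j x ->
  (forall i, 2 <= al i x <= L i - 2) /\ 2 <= be x <= h - 2.
Hypothesis tile_height : forall j, `|dotR v (zr R (w j) - c) - z| <= D.
Hypothesis z_itv : 2 <= z <= h - 2.

(* In the glued set S, an edge leaving a tile starts at a boundary point of the
   tile, where the tile's own set already agrees with the side of the hyperplane
   at height z; near the lateral faces S follows the hyperplane at height 0, as
   the sources and sinks of the big cylinder require. Only the transition between
   the two heights and the gaps between tiles cost extra edges. *)
Lemma glue_tiles (y : edge d -> R) (B : seq (edge d)) :
  (forall e, 0 <= y e) -> (forall e, bad_edge e -> e \in B) ->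
  cylflow c L h y <=
    \sum_j cylflow 0 L' h' (y \o shift_edge (w j)) + \sum_(e <- B) y e.
Proof.
move=> y0 hB; apply/ler_addgt0Pr => eps eps0.
(* A share of [eps] per tile; adding 1 keeps the denominator positive when there is no tile. *)
pose eta := eps / (#|I|%:R + 1).
have cI0 : 0 < #|I|%:R + 1 :> R by rewrite ltr_wpDl.
have eta0 : 0 < eta by rewrite divr_gt0.
have [s0 hs0] := cyl_edges 0 L' h'.
have /choice[S0 /choice[E0 hSE]] j :=
  maxflow_vertex_set (y := y \o shift_edge (w j)) (fun e => y0 _) hs0
    (@boundary_disjoint _ _ u v ou uv 0 L' h') eta0.
(* Margin 1 here against 2 in [bad_edge]: if either endpoint of an edge is [near], its first
   endpoint is within 2 of a lateral face. *)
pose near x := [exists i, ~~ (1 <= al i x <= L i - 1)].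
pose S x := if [pick j | in_tile j x] is Some j then S0 j (x - w j) else
  if near x then 0 < be x else z < be x.
have S_tile j x : in_tile j x -> S x = S0 j (x - w j).
  by rewrite /S => tj; case: pickP => [j' tj'|/(_ j)]; rewrite ?tj// (tile_disj tj tj').
have S_out x : (forall j, ~~ in_tile j x) -> S x = if near x then 0 < be x else z < be x.
  by move=> H; rewrite /S; case: pickP => // j tj; have := H j; rewrite tj.
have zlo : 2 <= z by case/andP: z_itv.
have zhi : z <= h - 2 by case/andP: z_itv.
pose BB := [seq shift_edge (w j) e | j <- enum I, e <- E0 j] ++ B.
apply: (@le_trans _ _ (\sum_(e <- BB) y e)); last first.
  rewrite big_cat /= big_allpairs_dep /= addrAC lerD2r big_enum /=.
  apply: (@le_trans _ _ (\sum_j (cylflow 0 L' h' (y \o shift_edge (w j)) + eta))).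
    by apply: ler_sum => j _; have [] := hSE j.
  rewrite big_split /= lerD2l sumr_const -mulr_natl /eta mulrA ler_pdivrMr//.
  by rewrite mulrC ler_pM2l// lerDl.
have lip x x' (w0 : vecR R d) : dotR w0 w0 = 1 -> nneighbour x x' ->
    `|dotR w0 (zr R x' - c) - dotR w0 (zr R x - c)| <= 1.
  exact: nneighbour_dot.
have interior x x' : (forall i, 1 <= al i x <= L i - 1) -> `|be x| <= h - 1 ->
    nneighbour x x' -> incyl u v c L h (zr R x').
  move=> h1 h2 nn; apply/incylP; split => [i|].
    have /andP[? ?] := h1 i; have := lip _ _ _ (uu i) nn.
    by rewrite ler_norml -/(al i x) => /andP[? ?]; apply/andP; split; lra.
  have := lip _ _ _ vv nn; move: h2; rewrite !ler_norml -/(be x).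
  by move=> /andP[? ?] /andP[? ?]; apply/andP; split; lra.
have tile_interior j x x' : in_tile j x -> nneighbour x x' -> incyl u v c L h (zr R x').
  move=> /tile_far[h1 /andP[? ?]]; apply: interior => [i|].
    by have /andP[? ?] := h1 i; apply/andP; split; lra.
  by rewrite ler_norml; apply/andP; split; lra.
(* A tile vertex with a neighbour outside the tile is a source or a sink of the tile once it is off
   the tile's middle hyperplane, whose height is within [D] of [z]. *)
have S_side j x x' : in_tile j x -> nneighbour x x' -> ~~ in_tile j x' ->
    (z + D < be x -> S x) /\ (be x < z - D -> ~~ S x).
  move=> tx nn tx'; rewrite (S_tile _ _ tx); have [hS1 hS2 _ _ _] := hSE j.
  have bE : dotR v (zr R (x - w j) - 0) = be x - dotR v (zr R (w j) - c).
    by rewrite /be -dotRBr subr0 zrB opprB addrA subrK.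
  have nn' : nneighbour (x - w j) (x' - w j).
    by case: nn => i [] ->; exists i; [left|right]; rewrite addrAC.
  have := tile_height j; rewrite ler_norml => /andP[? ?].
  split => hb; [apply: hS1; apply/(boundary1P ou uv)|apply: hS2; apply/(boundary2P ou uv)];
    rewrite bE; split => //; try lra; by exists (x' - w j).
have not_near_tile j x x' : in_tile j x -> (nneighbour x x' \/ x' = x) -> ~~ near x'.
  move=> /tile_far[h1 _] hnn; apply/existsPn => i; rewrite negbK.
  have /andP[? ?] := h1 i; case: hnn => [nn|->]; last by apply/andP; split; lra.
  have := lip _ _ _ (uu i) nn; rewrite ler_norml -/(al i x) -/(al i x').
  by move=> /andP[? ?]; apply/andP; split; lra.
(* Sources and sinks of the big cylinder avoid the tiles and are next to a lateral face, the top or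
   the bottom. *)
have boundary_out x x' : nneighbour x x' -> ~~ incyl u v c L h (zr R x') ->
    (forall j, ~~ in_tile j x) /\ (near x \/ h - 1 < `|be x|).
  move=> nn nc; split.
    by move=> j; apply: contra nc => tj; exact: tile_interior tj nn.
  have [?|nx] := boolP (near x); [by left|right; rewrite ltNge].
  apply: contra nc => hb; apply: interior hb nn => i.
  by move/existsPn: nx => /(_ i); rewrite negbK.
apply: (maxflow_le_boundary (S := S)) => //.
(* A source that is not [near] is higher than [h - 1], hence than [z]; a [near] one is in [S]
   because its height is positive. *)
- move=> x /(boundary1P ou uv)[h1 h2 [x' nn nc]].
  have [out nr] := boundary_out _ _ nn nc; rewrite S_out//.
  case: ifPn => // nx; case: nr => [nr|]; first by rewrite nr in nx.
  by rewrite gtr0_norm// => ?; lra.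
- move=> x /(boundary2P ou uv)[h1 h2 [x' nn nc]].
  have [out nr] := boundary_out _ _ nn nc; rewrite S_out//.
  by case: ifPn => _; rewrite -leNgt; rewrite -/(be x) in h2; lra.
move=> e /(edge_in_cylP ou uv)/andP[c1 c2] cross; rewrite mem_cat.
have nn := nneighbour_head e; have nn' := nneighbour_sym nn.
(* A crossing edge inside a single tile belongs to the shifted cut of that tile; any other crossing
   edge has to be shown bad. *)
have [/existsP[j /andP[t1 t2]]|nt] := boolP [exists j, in_tile j e.1 && in_tile j (head_pt e)].
  apply/orP; left; apply/allpairsPdep.
  exists j, (e.1 - w j, e.2); split; first by rewrite mem_enum.
    have [_ _ hE _ _] := hSE j; apply: hE.
      apply/(edge_in_cylP ou uv); rewrite /= -[incyl _ _ _ _ _ _]/(in_tile j e.1) t1 /=.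
      by rewrite /head_pt /= addrAC.
    move: cross; rewrite (S_tile _ _ t1) (S_tile _ _ t2) /=.
    by rewrite /head_pt /= addrAC.
  by rewrite /shift_edge /= subrK -surjective_pairing.
apply/orP; right; apply: hB; rewrite /bad_edge c1 /=.
have D0 : 0 <= D by rewrite /D.
have bl := lip _ _ _ vv nn; rewrite -/(be e.1) -/(be (head_pt e)) ler_norml in bl.
have /andP[bl1 bl2] := bl.
have [nr|nnr] := boolP (near e.1 || near (head_pt e)).
  apply/orP; left; apply/andP; split.
    have hnear x' : (x' = e.1 \/ nneighbour e.1 x') -> near x' ->
      [exists i, ~~ (2 <= al i e.1 <= L i - 2)].
      move=> hx /existsP[i hi]; apply/existsP; exists i; apply: contra hi => /andP[? ?].
      case: hx => [->|nx]; first by apply/andP; split; lra.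
      have := lip _ _ _ (uu i) nx; rewrite ler_norml -/(al i e.1) -/(al i x').
      by move=> /andP[? ?]; apply/andP; split; lra.
    by case/orP: nr; apply: hnear; [left|right].
  have out1 : forall j, ~~ in_tile j e.1.
    move=> j; apply/negP => tj; case/orP: nr; apply/negP.
      by apply: (not_near_tile _ _ _ tj); right.
    by apply: (not_near_tile _ _ _ tj); left.
  have out2 : forall j, ~~ in_tile j (head_pt e).
    move=> j; apply/negP => tj; case/orP: nr; apply/negP.
      by apply: (not_near_tile _ _ _ tj); left.
    by apply: (not_near_tile _ _ _ tj); right.
  move: cross; rewrite !S_out//.
  by do 2 case: ifP => _; apply: contraR; rewrite negb_and -!ltNge => hh;
    apply/eqP; lra.
move: nnr; rewrite negb_or => /andP[nr1 nr2].
apply/orP; right; rewrite nt andbT.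
(* Off the lateral strips and outside a common tile, each endpoint follows height [z] up to an error
   [D]; a change of side then forces a height within [D + 1] of [z]. *)
have side x x' : (forall j, ~~ (in_tile j x && in_tile j x')) -> nneighbour x x' ->
    ~~ near x -> (z + D < be x -> S x) /\ (be x < z - D -> ~~ S x).
  move=> ntx nx nrx; have [/existsP[j tj]|/existsPn out] := boolP [exists j, in_tile j x].
    by apply: (S_side _ _ _ tj nx); have := ntx j; rewrite tj.
  by rewrite S_out// (negbTE nrx); split => ?; rewrite -?leNgt; lra.
have nt1 j : ~~ (in_tile j e.1 && in_tile j (head_pt e)) by move/existsPn: nt.
have nt2 j : ~~ (in_tile j (head_pt e) && in_tile j e.1) by rewrite andbC.
have [s1 s2] := side _ _ nt1 nn nr1; have [s3 s4] := side _ _ nt2 nn' nr2.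
apply: contraR cross; rewrite -ltNge ltr_normr => /orP[] hh; apply/negPn/eqP. 
  by rewrite s1 ?s3//; lra.
have /negbTE -> : ~~ S e.1 by apply: s2; lra.
have /negbTE -> : ~~ S (head_pt e) by apply: s4; lra.
by [].
Qed.

End Gluing.

(** * Placing the tiles of a slab *)

Section Arrangement.
Variables (R : realType) (k : nat).
Let d := k.+1.
Variables (u : 'I_k -> vecR R d) (v : vecR R d).
Hypotheses (ou : Defs.orthonormal (d := d) u) (uv : unit_normal (d := d) u v).
Variables (c : vecR R d) (l : 'I_k -> R) (h : R) (n m p g : nat).
Let D : R := d%:R.
Hypotheses (l_gt0 : forall i, 0 < l i) (g_large : forall i, D + 3 <= g%:R * l i / 2)
  (p_large : 2 * D + 2 <= p%:R) (m_small : (m * (p + g) <= n)%N).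

Let uu i : dotR (u i) (u i) = 1. Proof. by rewrite ou eqxx. Qed.
Let vv : dotR v v = 1. Proof. exact: uv.1. Qed.
Let al i (x : point d) := dotR (u i) (zr R x - c).
Let be (x : point d) := dotR v (zr R x - c).
Let D0 : 0 <= D. Proof. exact: ler0n. Qed.

(** The base is divided into cells of sides [(p + g) * l i]; a tile of sides [p * l i] is centred in
    its cell, at distance [g * l i / 2] from each wall. *)
Definition tile_edge_coord (j : {ffun 'I_k -> 'I_m}) i : R :=
  ((j i)%:R * (p + g)%:R + g%:R / 2) * l i.

Definition tile_corner (z : R) j : vecR R d :=
  c + (\sum_i tile_edge_coord j i *: u i + z *: v).

(** Rounding to the lattice makes tile flows equal in law; the price is a displacement of at most
    [D] in each frame coordinate. *)
Definition tile_shift z j : point d := lattice_floor (tile_corner z j).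

Lemma lattice_floor_dot (w0 x : vecR R d) : dotR w0 w0 = 1 ->
  `|dotR w0 (zr R (lattice_floor x)) - dotR w0 x| <= D.
Proof.
move=> ww; rewrite -dotRBr -normrN -dotRNr opprB -[leRHS]mulr1.
apply: dotR_le_sup => // j.
have := lattice_floor_itv x j; rewrite !mxE ler_norml => /andP[? ?].
by apply/andP; split; lra.
Qed.

Lemma tile_shift_height z j : `|dotR v (zr R (tile_shift z j) - c) - z| <= D.
Proof.
have := lattice_floor_dot (tile_corner z j) vv.
have -> : dotR v (tile_corner z j) = dotR v c + z.
  by rewrite /tile_corner dotRDr (dotR_frame_v uv).
by rewrite dotRBr opprD addrA.
Qed.

Lemma tile_shift_coord z j i :
  `|dotR (u i) (zr R (tile_shift z j) - c) - tile_edge_coord j i| <= D.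
Proof.
have := lattice_floor_dot (tile_corner z j) (uu i).
have -> : dotR (u i) (tile_corner z j) = dotR (u i) c + tile_edge_coord j i.
  by rewrite /tile_corner dotRDr (dotR_frame_u ou uv).
by rewrite dotRBr opprD addrA.
Qed.

Local Notation tile z j x :=
  (in_tile u v (fun i => p%:R * l i) p%:R (tile_shift z) j x).

Lemma dotR_recenter (w0 : vecR R d) (x w : point d) :
  dotR w0 (zr R (x - w) - 0) = dotR w0 (zr R x - c) - dotR w0 (zr R w - c).
Proof. by rewrite subr0 zrB !dotRBr; lra. Qed.

Lemma tile_coords z j x : tile z j x ->
  (forall i, tile_edge_coord j i - D <= al i x <= tile_edge_coord j i + p%:R * l i + D)
  /\ z - p%:R - D <= be x <= z + p%:R + D.
Proof.
move=> /incylP[h1 h2]; split => [i|].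
  have := h1 i; rewrite dotR_recenter -/(al i x).
  have := tile_shift_coord z j i; rewrite ler_norml.
  by move=> /andP[? ?] /andP[? ?]; apply/andP; split; lra.
move: h2; rewrite dotR_recenter -/(be x).
have := tile_shift_height z j; rewrite !ler_norml.
by move=> /andP[? ?] /andP[? ?]; apply/andP; split; lra.
Qed.

Lemma coords_tile z j x :
  (forall i, tile_edge_coord j i + D <= al i x <= tile_edge_coord j i + p%:R * l i - D) ->
  `|be x - z| <= p%:R - D -> tile z j x.
Proof.
move=> h1 h2; apply/incylP; split => [i|].
  have := h1 i; rewrite dotR_recenter -/(al i x).
  have := tile_shift_coord z j i; rewrite ler_norml.
  by move=> /andP[? ?] /andP[? ?]; apply/andP; split; lra.
move: h2; rewrite dotR_recenter -/(be x).
have := tile_shift_height z j; rewrite !ler_norml.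
by move=> /andP[? ?] /andP[? ?]; apply/andP; split; lra.
Qed.

(** The half gap is at least [D + 3]: [D] pays for the rounding and 2 for the margin required in
    [tile_inside]. *)
Lemma tile_edge_coord_itv (j : {ffun 'I_k -> 'I_m}) i :
  (j i)%:R * ((p + g)%:R * l i) + D + 3 <= tile_edge_coord j i
  /\ tile_edge_coord j i + p%:R * l i <= (j i).+1%:R * ((p + g)%:R * l i) - (D + 3).
Proof.
have := g_large i; rewrite /tile_edge_coord -[(j i).+1%:R]natr1 natrD => hg.
by split; lra.
Qed.

Lemma tile_inj z j j' x : tile z j x -> tile z j' x -> j = j'.
Proof.
have lt a b i : tile z a x -> tile z b x -> ~ (a i < b i)%N.
  move=> /tile_coords[/(_ i)/andP[a1 a2] _] /tile_coords[/(_ i)/andP[b1 b2] _] ab.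
  have [_ A] := tile_edge_coord_itv a i; have [B _] := tile_edge_coord_itv b i.
  have : (a i).+1%:R * ((p + g)%:R * l i) <= (b i)%:R * ((p + g)%:R * l i).
    by rewrite ler_wpM2r ?ler_nat// mulr_ge0// ltW.
  lra.
move=> h1 h2; apply/ffunP => i; apply/val_inj/eqP; rewrite eqn_leq.
by apply/andP; split; rewrite leqNgt; apply/negP; apply: lt.
Qed.

Lemma tile_heights_disj z z' j j' x :
  tile z j x -> tile z' j' x -> 2 * (p%:R + D) < `|z' - z| -> False.
Proof.
move=> /tile_coords[_ /andP[? ?]] /tile_coords[_ /andP[? ?]].
by rewrite ltr_normr => /orP[] ?; lra.
Qed.

Lemma tile_inside z j x : p%:R + D + 2 <= z -> z + p%:R + D + 2 <= h -> tile z j x ->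
  (forall i, 2 <= al i x <= n%:R * l i - 2) /\ 2 <= be x <= h - 2.
Proof.
move=> z1 z2 /tile_coords[h1 /andP[? ?]]; split; last by apply/andP; split; lra.
move=> i; have /andP[? ?] := h1 i; have [A B] := tile_edge_coord_itv j i.
have A0 : 0 <= (j i)%:R * ((p + g)%:R * l i) by rewrite !mulr_ge0// ltW.
have B1 : (j i).+1%:R * ((p + g)%:R * l i) <= n%:R * l i.
  rewrite mulrA; apply: ler_wpM2r; first exact: ltW.
  rewrite -natrM ler_nat (leq_trans _ m_small)//.
  by rewrite leq_mul2r ltn_ord orbT.
by apply/andP; split; lra.
Qed.

(** By contraposition: away from the grid hyperplanes and from the strip past the last cell, the
    cell indices of [e.1] designate a tile containing both endpoints. *)
Lemma gap_coord z (e : edge d) :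
  incyl u v c (fun i => n%:R * l i) h (zr R e.1) -> `|be e.1 - z| <= D + 1 ->
  ~~ [exists j, tile z j e.1 && tile z j (head_pt e)] ->
  exists i, m%:R * ((p + g)%:R * l i) <= al i e.1 \/
    exists2 q : nat, (q <= m)%N &
      `|al i e.1 - q%:R * ((p + g)%:R * l i)| <= g%:R * l i / 2 + D + 1.
Proof.
move=> /incylP[hin _] hb; apply: contraNP => hno.
have h1 i : al i e.1 < m%:R * ((p + g)%:R * l i).
  by rewrite ltNge; apply/negP => hh; apply: hno; exists i; left.
have h2 i (q : nat) : (q <= m)%N ->
    g%:R * l i / 2 + D + 1 < `|al i e.1 - q%:R * ((p + g)%:R * l i)|.
  by move=> qm; rewrite ltNge; apply/negP => hh; apply: hno; exists i; right; exists q.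
have pg0 i : 0 < (p + g)%:R * l i.
  rewrite mulr_gt0// ltr0n addn_gt0; apply/orP; left; rewrite -(ltr0n R).
  by apply: lt_le_trans p_large; rewrite ltr_wpDl ?mulr_ge0//.
pose q i := Num.truncn (al i e.1 / ((p + g)%:R * l i)).
have qE i : (q i)%:R * ((p + g)%:R * l i) <= al i e.1 < (q i).+1%:R * ((p + g)%:R * l i).
  rewrite -ler_pdivlMr// -ltr_pdivrMr//; apply: truncn_itv.
  by rewrite divr_ge0 ?(ltW (pg0 i))//; have /andP[] := hin i.
have qm i : (q i < m)%N.
  have /andP[q1 q2] := qE i; rewrite -(ltr_nat R) -(ltr_pM2r (pg0 i)).
  exact: le_lt_trans (h1 i).
pose j : {ffun 'I_k -> 'I_m} := [ffun i => Ordinal (qm i)].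
have jE i : tile_edge_coord j i = (q i)%:R * ((p + g)%:R * l i) + g%:R * l i / 2.
  by rewrite /tile_edge_coord ffunE /=; lra.
have a1 i : tile_edge_coord j i + (D + 1) <= al i e.1
    <= tile_edge_coord j i + p%:R * l i - (D + 1).
  have /andP[q1 q2] := qE i; rewrite jE.
  have := h2 i _ (ltnW (qm i)); rewrite ger0_norm ?subr_ge0// => H1.
  have := h2 i _ (qm i); rewrite ltr0_norm ?subr_lt0// => H2.
  have X : (p + g)%:R * l i = p%:R * l i + g%:R * l i by rewrite natrD mulrDl.
  by move: H2; rewrite -[(q i).+1%:R]natr1 => H2; apply/andP; split; lra.
have nn := nneighbour_head e.
apply/existsP; exists j; apply/andP; split; apply: coords_tile.
- by move=> i; have /andP[? ?] := a1 i; apply/andP; split; lra.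
- by have := p_large; have := D0; lra.
- move=> i; have /andP[? ?] := a1 i.
  have := nneighbour_dot c (uu i) nn; rewrite ler_norml -/(al i e.1).
  by rewrite -/(al i (head_pt e)) => /andP[? ?]; apply/andP; split; lra.
- have pl := p_large; have d0 := D0; have := nneighbour_dot c vv nn; move: hb.
  by rewrite !ler_norml -/(be _) -/(be _) => /andP[? ?] /andP[? ?]; apply/andP; split; lra.
Qed.

End Arrangement.

(** * Number of extra edges of a slab *)

Section BadCount.
Variables (R : realType) (k : nat).
Let d := k.+1.
Variables (u : 'I_k -> vecR R d) (v : vecR R d).
Hypotheses (ou : Defs.orthonormal (d := d) u) (uv : unit_normal (d := d) u v).
Variables (c : vecR R d) (l : 'I_k -> R) (h : R) (n m p g : nat) (La : R).
Let D : R := d%:R.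
Hypotheses (l_gt0 : forall i, 0 < l i) (l_le : forall i, l i + 1 <= La)
  (p_large : 2 * D + 2 <= p%:R)
  (m_large : (n < m.+1 * (p + g))%N) (n_gt0 : (0 < n)%N).

Let al i (x : point d) := dotR (u i) (zr R x - c).
Let be (x : point d) := dotR v (zr R x - c).
Let D0 : 0 <= D. Proof. exact: ler0n. Qed.
Let C1 : R := d%:R * (2 * d + 1).+1%:R ^+ d.
Let W : R := (n%:R * La) ^+ k.-1.

Lemma size_flatten_map (T : Type) (E : Type) (s : T -> seq E) (r : seq T) :
  (size (flatten (map s r)))%:R = \sum_(t <- r) (size (s t))%:R :> R.
Proof. by rewrite size_flatten /shape -map_comp sumnE big_map natr_sum. Qed.

(** Edges of a thin layer: direction [i] and the height are confined, and the other [k - 1]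
    directions give the factor [W]. *)
Lemma side_list i (a w b0 H : R) : 0 <= w -> 0 <= H ->
  exists s : seq (edge d),
    (forall e, (forall i', 0 <= al i' e.1 <= n%:R * l i') -> a <= al i e.1 <= a + w ->
       b0 <= be e.1 <= b0 + H -> e \in s) /\
    (size s)%:R <= C1 * (w + 1) * (H + 1) * W.
Proof.
move=> w0 H0.
pose lo i' := if i' == i then a else 0.
pose len i' := if i' == i then w else n%:R * l i'.
have [|s [hs sz]] := @rotated_box_list R k u v ou uv c lo len b0 H _ H0.
  by move=> i'; rewrite /len; case: ifP => // _; rewrite mulr_ge0// ltW.
exists [seq (x, j) | x <- s, j <- enum 'I_d]; split.
  move=> [x j] /= h1 h2 h3; apply/allpairsP; exists (x, j); split => //=; last first.
    by rewrite mem_enum.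
  apply: hs => // i'; rewrite /lo /len; case: eqP => [->|_] //.
  by rewrite add0r; exact: h1.
rewrite size_allpairs -cardE card_ord natrM mulrC /C1 -!mulrA ler_wpM2l//.
apply: le_trans sz _; rewrite -!mulrA ler_wpM2l ?exprn_ge0//.
rewrite (bigD1 i)//= {1}/len eqxx -mulrA ler_wpM2l ?addr_ge0// mulrC.
rewrite ler_wpM2l ?addr_ge0//.
have -> : W = \prod_(i' < k | i' != i) (n%:R * La).
  by rewrite prodr_const cardC1 card_ord.
apply: ler_prod => i' /negbTE ni; rewrite /len ni.
have n1 : 1 <= n%:R :> R by rewrite ler1n.
have h1 := l_gt0 i'; have h2 := l_le i'.
by rewrite addr_ge0 ?mulr_ge0 ?(ltW h1)//=; nra.
Qed.

(** Each base direction contributes layers along its two lateral faces, with heights from -1 to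
    [z + 1], a layer past the last full cell, and one around each of the [m + 1] grid hyperplanes,
    the last two kinds with heights within [D + 1] of [z]. *)
Lemma bad_count z : 2 <= z -> exists B : seq (edge d),
  (forall e, bad_edge u v c (fun i => n%:R * l i) h (fun i => p%:R * l i) p%:R
      (@tile_shift R k u v c l m p g z) z e -> e \in B) /\
  (size B)%:R <= k%:R * C1 * (6 * (2 * D + 3)) * W *
    (z + 3 + (p + g)%:R * La + 1 + m.+1%:R * (g%:R * La + 2 * D + 3)).
Proof.
move=> z2; have d0 := D0.
pose la i := (p + g)%:R * l i.
have la0 i : 0 <= la i by rewrite mulr_ge0// ltW.
pose s i := g%:R * l i / 2 + D + 1.
have gl0 i : 0 <= g%:R * l i by rewrite mulr_ge0// ltW.
have s0 i : 0 <= 2 * s i by rewrite /s; have := gl0 i; lra.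
have H1 : 0 <= z + 2 by lra.
have H2 : 0 <= 2 * (D + 1) by lra.
have /choice[slo hlo] := fun i => @side_list i 0 2 (-1) (z + 2) (ler0n _ _) H1.
have /choice[shi hhi] := fun i => @side_list i (n%:R * l i - 2) 2 (-1) (z + 2) (ler0n _ _) H1.
have /choice[sst hst] := fun i =>
  @side_list i (m%:R * la i) (la i) (z - (D + 1)) (2 * (D + 1)) (la0 i) H2.
have /choice[sga hga] := fun iq : 'I_k * nat =>
  @side_list iq.1 (iq.2%:R * la iq.1 - s iq.1) (2 * s iq.1) (z - (D + 1)) (2 * (D + 1)) (s0 _) H2.
pose Bi i := slo i ++ shi i ++ sst i ++ flatten [seq sga (i, q) | q <- iota 0 m.+1].
exists (flatten [seq Bi i | i <- enum 'I_k]); split.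
  move=> e /andP[c1 hbad]; have [hin hb] := incylP _ _ _ _ _ _ c1.
  have mem i : e \in Bi i -> e \in flatten [seq Bi i | i <- enum 'I_k].
    move=> hi; apply/flattenP; exists (Bi i) => //; apply/mapP; exists i => //.
    by rewrite mem_enum.
  case/orP: hbad => /andP[].
    move=> /existsP[i hi] /andP[b1 b2]; apply: (mem i); rewrite /Bi 2!mem_cat.
    have bb : -1 <= be e.1 <= -1 + (z + 2).
      by rewrite /be; apply/andP; split; lra.
    have /andP[a1 a2] := hin i.
    move: hi; rewrite negb_and -!ltNge => /orP[hi|hi]; apply/orP.
      left; apply: (hlo i).1 => //.
      by rewrite /al add0r a1 ltW.
    right; apply/orP; left; apply: (hhi i).1 => //.
    by rewrite /al subrK a2 ltW.
  move=> hz nt; have hz' : `|be e.1 - z| <= D + 1 by exact: hz.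
  have [i hi'] := gap_coord ou uv l_gt0 p_large c1 hz nt.
  have hi : m%:R * la i <= al i e.1 \/
    exists2 q : nat, (q <= m)%N & `|al i e.1 - q%:R * la i| <= s i by exact: hi'.
  have bb : z - (D + 1) <= be e.1 <= z - (D + 1) + 2 * (D + 1).
    by move: hz'; rewrite ler_norml => /andP[? ?]; apply/andP; split; lra.
  have /andP[a1 a2] := hin i.
  apply: (mem i); rewrite /Bi 3!mem_cat; apply/orP; right; apply/orP; right; apply/orP.
  case: hi => [hi|[q qm hi]]; [left|right].
    apply: (hst i).1 => //; rewrite hi/= (le_trans a2)//.
    have : n%:R * l i <= m.+1%:R * (p + g)%:R * l i.
      by rewrite ler_wpM2r ?(ltW (l_gt0 i))// -natrM ler_nat ltnW.
    by rewrite -natr1 -mulrA -/(la i) mulrDl mul1r.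
  apply/flatten_mapP; exists q; first by rewrite mem_iota add0n ltnS.
  apply: (hga (i, q)).1 => //=.
  move: hi; rewrite ler_norml => /andP[? ?].
  by apply/andP; split; lra.
have C10 : 0 <= C1 by rewrite /C1 mulr_ge0// exprn_ge0.
(* Without base directions both sides vanish; otherwise [l_le] gives the sign of [La]. *)
have [k0|i0] := posnP k.
  have -> : enum 'I_k = [::] by apply: size0nil; rewrite size_enum_ord.
  by have -> : k%:R = 0 :> R; rewrite ?k0// !mul0r.
have La1 : 0 <= La by have := l_le (Ordinal i0); have := l_gt0 (Ordinal i0); lra.
have W0 : 0 <= W by rewrite exprn_ge0// mulr_ge0.
rewrite size_flatten_map big_enum /=.
set X := _ + m.+1%:R * _.
have -> : k%:R * C1 * (6 * (2 * D + 3)) * W * X = \sum_(i < k) (C1 * (6 * (2 * D + 3)) * W * X).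
  by rewrite sumr_const card_ord -[RHS]mulr_natl; ring.
apply: ler_sum => i _.
rewrite 3!size_cat 3!natrD.
have b1 := (hlo i).2; have b2 := (hhi i).2; have b3 := (hst i).2.
have b4 : (size (flatten [seq sga (i, q) | q <- iota 0 m.+1]))%:R <=
    m.+1%:R * (C1 * (2 * s i + 1) * (2 * (D + 1) + 1) * W).
  rewrite size_flatten_map.
  have -> : m.+1%:R * (C1 * (2 * s i + 1) * (2 * (D + 1) + 1) * W) =
     \sum_(q <- iota 0 m.+1) (C1 * (2 * s i + 1) * (2 * (D + 1) + 1) * W).
    by rewrite big_const_seq count_predT size_iota iter_addr_0 mulr_natl.
  by apply: ler_sum => q _; exact: (hga (i, q)).2.
apply: le_trans (lerD b1 (lerD b2 (lerD b3 b4))) _.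
have lLa : l i <= La by have := l_le i; lra.
have h1 : la i <= (p + g)%:R * La by rewrite ler_wpM2l.
have h2 : 2 * s i + 1 <= g%:R * La + 2 * D + 3.
  have : g%:R * l i <= g%:R * La by rewrite ler_wpM2l.
  rewrite /s; lra.
have m0 : 0 <= m.+1%:R :> R by [].
have h3 : m.+1%:R * (2 * s i + 1) <= m.+1%:R * (g%:R * La + 2 * D + 3).
  by rewrite ler_wpM2l.
have h4 : 0 <= m.+1%:R * (2 * s i + 1) by rewrite mulr_ge0// addr_ge0.
have CW : 0 <= C1 * W by rewrite mulr_ge0.
rewrite [leLHS](_ : _ = (C1 * W) * (6 * (z + 3) + (la i + 1) * (2 * D + 3) +
   (m.+1%:R * (2 * s i + 1)) * (2 * D + 3))); last by ring.
rewrite [leRHS](_ : _ = (C1 * W) * ((6 * (2 * D + 3)) * X)); last by ring.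
rewrite ler_wpM2l// /X; move: h1 h3 h4 (la0 i).
set A := la i; set A' := (p + g)%:R * La; set M := m.+1%:R * _; set M' := m.+1%:R * _.
move=> h1 h3 h4 A0; nra.
Qed.

End BadCount.

(** * Stacking slabs in the cylinder *)

Section SlabDecomposition.
Variables (R : realType) (k : nat).
Let d := k.+1.
Variables (u : 'I_k -> vecR R d) (v : vecR R d).
Hypotheses (ou : Defs.orthonormal (d := d) u) (uv : unit_normal (d := d) u v).
Variables (l : 'I_k -> R) (l_gt0 : forall i, 0 < l i) (k_gt0 : (0 < k)%N).
Let D : R := d%:R.

Lemma ltr_truncnS (x : R) n : (Num.truncn x < n)%N -> x < n%:R.
Proof. by move=> h; rewrite (lt_le_trans (truncnS_gt x))// ler_nat. Qed.

(** The extra edges of a slab come from three terms, each held below a third of [delta] times the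
    area: the gaps between tiles, about [n / p] per direction, by [p] large; the descent to height 0
    by [kap] small, since heights stay below [K * T]; the terms independent of [K] and [m] by [n1].
    The gap [g] depends on [d] and [l] alone, so it is fixed before [p]. *)
Lemma slab_decomposition (delta : R) : 0 < delta ->
  exists p0 : nat, forall p, (p0 <= p)%N ->
  exists2 kap : R, 0 < kap & exists n1 : nat, forall n K (h : R) (c : vecR R d),
    (n1 <= n)%N -> K%:R <= kap * n%:R -> K%:R <= kap * h ->
  exists (J : finType) (w : 'I_K -> J -> point d) (B : 'I_K -> seq (edge d)),
    [/\ #|J|%:R * p%:R ^+ k <= n%:R ^+ k :> R,
        forall a j a' j' x,
          in_tile u v (fun i => p%:R * l i) p%:R (w a) j x ->
          in_tile u v (fun i => p%:R * l i) p%:R (w a') j' x -> a = a' /\ j = j',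
        forall a, uniq (B a) /\ (size (B a))%:R <= delta * (n%:R ^+ k * \prod_i l i) &
        forall a (y : edge d -> R), (forall e, 0 <= y e) ->
          cylflow u v c (fun i => n%:R * l i) h y <=
          \sum_j cylflow u v 0 (fun i => p%:R * l i) p%:R (y \o shift_edge (w a j))
          + \sum_(e <- B a) y e].
Proof.
have nat1 (a b : nat) : (a < b)%N -> (2 * a + 2 <= 2 * b)%N by lia.
have nat2 (a b : nat) : (a < b)%N -> (2 * a + 1 + 2 <= 2 * b + 1)%N by lia.
move=> delta0; have D0 : 0 <= D by rewrite /D.
pose La : R := 1 + \sum_i l i.
have l_le i : l i + 1 <= La.
  rewrite /La addrC lerD2l (bigD1 i)//= lerDl sumr_ge0// => j _; exact: ltW.
have La1 : 1 <= La by rewrite /La lerDl sumr_ge0// => j _; exact: ltW.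
pose g := (\max_(i < k) (Num.truncn (2 * (D + 3) / l i)).+1)%N.
have g_large i : D + 3 <= g%:R * l i / 2.
  have : (Num.truncn (2 * (D + 3) / l i) < g)%N by exact: leq_bigmax.
  by move/ltr_truncnS; rewrite ltr_pdivrMr// => ?; lra.
pose C0 : R := k%:R * (d%:R * (2 * d + 1).+1%:R ^+ d) * (6 * (2 * D + 3)).
have C00 : 0 <= C0 by rewrite /C0 !mulr_ge0 ?exprn_ge0// addr_ge0 ?mulr_ge0.
pose A := C0 * La ^+ k.-1 + 1.
have A0 : 0 < A by rewrite ltr_wpDl// mulr_ge0// exprn_ge0//; lra.
pose G := g%:R * La + 2 * D + 3.
have G0 : 0 < G by rewrite ltr_wpDl// addr_ge0 ?mulr_ge0//; lra.
pose del := delta * \prod_i l i.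
have del0 : 0 < del by rewrite mulr_gt0// prodr_gt0.
exists (maxn (2 * d + 2) (Num.truncn (3 * A * G / del)).+1) => p.
rewrite geq_max => /andP[p1 /ltr_truncnS]; rewrite ltr_pdivrMr// => p2.
have p3 : 2 * D + 2 <= p%:R by rewrite /D -natrM -natrD ler_nat.
have p0 : 0 < p%:R :> R by lra.
(* Thickness of a slab: half height [p] of a tile, [D] for the rounding and a margin 2, on both
   sides. *)
pose T := 2 * (p%:R + D + 2).
have T0 : 0 < T by rewrite /T; lra.
pose kap := Num.min 1 (del / (3 * A)) / T.
exists kap; first by rewrite divr_gt0// lt_min ltr01 divr_gt0// mulr_gt0.
exists (Num.truncn (3 * A * ((p + g)%:R * La + 4 + G) / del)).+1 => n K h c.
move=> /ltr_truncnS; rewrite ltr_pdivrMr// => n1 Kn Kh.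
have kapT : kap * T <= 1 /\ kap * T <= del / (3 * A).
  by rewrite /kap mulfVK ?gt_eqF//; split; rewrite ge_min lexx ?orbT.
have KTh : K%:R * T <= h \/ K = 0%N.
  case: K Kn Kh => [|K] Kn Kh; first by right.
  left; have h0 : 0 <= h.
    rewrite leNgt; apply/negP => h0; have : 0 < K.+1%:R :> R by [].
    have kap0 : 0 < kap by rewrite divr_gt0// lt_min ltr01 divr_gt0// mulr_gt0.
    have : kap * h < 0 by rewrite pmulr_rlt0.
    lra.
  apply: (@le_trans _ _ (kap * h * T)); first by rewrite ler_wpM2r// ltW.
  by rewrite mulrAC -[leRHS]mul1r ler_wpM2r//; exact: kapT.1.
have KTn : 3 * A * (K%:R * T) <= del * n%:R.
  apply: (@le_trans _ _ (3 * A * (kap * n%:R * T))).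
    by rewrite ler_wpM2l ?mulr_ge0 ?(ltW A0)// ler_wpM2r// ltW.
  have -> : 3 * A * (kap * n%:R * T) = (kap * T) * (3 * A) * n%:R by ring.
  by apply: ler_wpM2r => //; rewrite -ler_pdivlMr ?mulr_gt0//; exact: kapT.2.
pose m := (n %/ (p + g))%N.
have pg0 : (0 < p + g)%N by rewrite addn_gt0 (leq_trans _ p1)// addn_gt0 orbT.
have m_small : (m * (p + g) <= n)%N by exact: leq_trunc_div.
have m_large : (n < m.+1 * (p + g))%N by exact: ltn_ceil.
have mp : (m * p <= n)%N by rewrite (leq_trans _ m_small)// leq_mul2l leq_addr orbT.
have n_gt0 : (0 < n)%N.
  rewrite -(ltr0n R) -(pmulr_lgt0 _ del0); apply: le_lt_trans n1.
  by rewrite mulr_ge0 ?mulr_ge0 ?(ltW A0)// addr_ge0 ?(ltW G0)// addr_ge0// mulr_ge0//; lra.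
(* Slabs are stacked upwards from height 0, so their middle heights are the odd multiples of
   [T / 2]. *)
pose z (a : 'I_K) : R := (2 * a + 1)%:R * (p%:R + D + 2).
have z_lo a : p%:R + D + 2 <= z a.
  rewrite -[leLHS]mul1r ler_wpM2r//; first by lra.
  by rewrite ler1n addn1.
have z_hi a : z a + p%:R + D + 2 <= K%:R * T.
  have -> : z a + p%:R + D + 2 = (2 * a + 2)%:R * (p%:R + D + 2).
    by rewrite /z !natrD; ring.
  have -> : K%:R * T = (2 * K)%:R * (p%:R + D + 2) by rewrite /T natrM; ring.
  apply: ler_wpM2r; first by lra.
  by rewrite ler_nat; apply: nat1.
have z_h a : z a + p%:R + D + 2 <= h.
  apply: le_trans (z_hi a) _; case: KTh => // K0.
  by exfalso; have := leq_ltn_trans (leq0n a) (ltn_ord a); rewrite K0.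
have z_disj (a b : 'I_K) : a != b -> 2 * (p%:R + D) < `|z b - z a|.
  have hlt (a' b' : 'I_K) : (a' < b')%N -> 2 * (p%:R + D) < z b' - z a'.
    move=> ab; have : (2 * a' + 1 + 2)%:R * (p%:R + D + 2) <= z b'.
      rewrite ler_wpM2r//; [by lra|by rewrite ler_nat; exact: nat2].
    by rewrite natrD mulrDl -/(z a'); lra.
  rewrite neq_ltn ltr_normr => /orP[/hlt ->//|/hlt ?].
  by apply/orP; right; lra.
have z2 a : 2 <= z a by have := z_lo a; lra.
have /choice[B hB] a := @bad_count R k u v ou uv c l h n m p g La l_gt0 l_le
  p3 m_large n_gt0 (z a) (z2 a).
exists {ffun 'I_k -> 'I_m}, (fun a => @tile_shift R k u v c l m p g (z a)),
  (fun a => undup (B a)); split.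
- rewrite card_ffun !card_ord natrX -exprMn -natrM.
  by rewrite lerXn2r ?nnegrE// ler_nat.
- move=> a j a' j' x t1 t2.
  have aa : a = a'.
    apply/eqP/negPn/negP => /z_disj.
    exact: (tile_heights_disj ou uv t1 t2).
  move: t2; rewrite -aa => t2; split => //.
  exact: (tile_inj ou uv l_gt0 g_large t1 t2).
- move=> a; split; first exact: undup_uniq.
  apply: le_trans (le_trans _ (hB a).2) _; first by rewrite ler_nat size_undup.
  rewrite -/D -/C0 -/G exprMn -[in n%:R ^+ k](prednK k_gt0) exprSr.
  (* The gap term: [m * p <= n], and [p] was chosen to beat [3 * A * G / del]. *)
  have X0 : 3 * A * G * m%:R <= del * n%:R.
    apply: (@le_trans _ _ (p%:R * del * m%:R)); first by rewrite ler_wpM2r// ltW.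
    by rewrite mulrAC mulrC ler_wpM2l ?(ltW del0)// mulrC -natrM ler_nat.
  set X := (X in _ * X <= _).
  have XA : A * X <= del * n%:R.
    have h1 : X <= K%:R * T + ((p + g)%:R * La + 4 + G) + m%:R * G.
      by rewrite /X -[m.+1%:R]natr1; have := z_hi a; lra.
    have h2 : A * X <= A * (K%:R * T + ((p + g)%:R * La + 4 + G) + m%:R * G).
      by rewrite ler_wpM2l// ltW.
    lra.
  have X1 : 0 <= X.
    rewrite /X !addr_ge0 ?mulr_ge0 ?(ltW G0)//; [|lra].
    by have := z2 a; lra.
  rewrite [leRHS](_ : _ = n%:R ^+ k.-1 * (del * n%:R)); last by rewrite /del; ring.
  rewrite [leLHS](_ : _ = n%:R ^+ k.-1 * (C0 * La ^+ k.-1 * X)); last by ring.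
  rewrite ler_wpM2l ?exprn_ge0//; apply: le_trans XA.
  by rewrite ler_wpM2r// /A lerDl.
- move=> a y y0; apply: (@glue_tiles R k u v ou uv c) => //.
  + move=> j j' x; exact: tile_inj.
  + move=> j x; apply: tile_inside => //.
  + exact: tile_shift_height.
  + by apply/andP; split => //; have := z_h a; lra.
  + by move=> e he; rewrite mem_undup; exact: (hB a).1.
Qed.

End SlabDecomposition.

(** * The space of capacity configurations *)

Section ConfigurationSpace.
Variables (R : realType) (I : eqType).

(** A named copy of [I -> R], so that a whole family of capacities is one random element; its
    sigma-algebra is generated by conditions on finitely many coordinates. *)
Definition config : Type := I -> R.
HB.instance Definition _ := gen_eqMixin config.
HB.instance Definition _ := gen_choiceMixin config.
HB.instance Definition _ := isPointed.Build config (fun _ => 0).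

Definition config_box (E : seq I) (B : I -> set R) : set config :=
  [set y | forall e, e \in E -> B e (y e)].

Definition config_boxes : set (set config) :=
  [set A | exists E B, (forall e, measurable (B e)) /\ A = config_box E B].

Definition configT := g_sigma_algebraType config_boxes.

Lemma config_boxesI : setI_closed config_boxes.
Proof.
move=> _ _ [E [B [mB ->]]] [E' [B' [mB' ->]]].
exists (E ++ E'), (fun e => (if e \in E then B e else setT) `&`
                            (if e \in E' then B' e else setT)); split.
  by move=> e; apply: measurableI; case: ifP.
apply/seteqP; split => y.
  move=> [h1 h2] e; rewrite mem_cat => _.
  by split; case: ifP => // h; [exact: h1|exact: h2].
move=> h; split => e he; have := h e; rewrite mem_cat he ?orbT => /(_ isT)[].
  by [].
by [].
Qed.

Lemma measurable_config_box E (B : I -> set R) : (forall e, measurable (B e)) ->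
  measurable (config_box E B : set configT).
Proof. by move=> mB; apply: sub_sigma_algebra; exists E, B. Qed.

Lemma measurable_coord (e : I) : measurable_fun setT (fun y : configT => y e).
Proof.
move=> _ B mB; rewrite setTI.
rewrite [X in measurable X](_ : _ = config_box [:: e] (fun _ => B)).
  exact: measurable_config_box.
apply/seteqP; split => y /=; first by move=> h e'; rewrite inE => /eqP ->.
by apply; rewrite inE.
Qed.

Lemma measurable_to_config dO (Omega : measurableType dO) (t : I -> Omega -> R) :
  (forall e, measurable_fun setT (t e)) ->
  measurable_fun setT (fun w => (fun e => t e w) : configT).
Proof.
move=> mt; apply: (@measurability _ _ Omega configT setT _ config_boxes) => //.
move=> _ [_ [E [B [mB ->]]] <-]; rewrite setTI.
elim: E => [|e E IH].
  by rewrite [X in measurable X](_ : _ = setT)//; apply/seteqP; split.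
rewrite [X in measurable X](_ : _ = (t e @^-1` B e) `&`
   ((fun w => (fun e => t e w) : configT) @^-1` config_box E B)).
  by apply: measurableI => //; rewrite -[X in measurable X]setTI; exact: mt.
apply/seteqP; split => w /=.
  move=> h; split; first by apply: h; rewrite mem_head.
  by move=> e' he'; apply: h; rewrite inE he' orbT.
by move=> [h1 h2] e'; rewrite inE => /predU1P[->//|]; exact: h2.
Qed.

End ConfigurationSpace.

(** * Independent identically distributed families *)

Section IidLaw.
Variables (R : realType) (I : eqType).

(** The joint law is recorded through [rho] alone, so families on different spaces, or with
    relabelled or resampled coordinates, are compared by sharing [rho]. *)
Definition iid_law dO (Omega : measurableType dO) (P : probability Omega R)
    (t : I -> Omega -> R) (rho : set R -> R) : Prop :=
  (forall e, measurable_fun setT (t e)) /\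
  forall (E : seq I) (B : I -> set R), uniq E -> (forall e, measurable (B e)) ->
    P [set w | forall e, e \in E -> B e (t e w)] = (\prod_(e <- E) rho (B e))%:E.

Lemma iid_law_map dO (Omega : measurableType dO) (P : probability Omega R)
    (t : I -> Omega -> R) rho (phi : R -> R) :
  measurable_fun setT phi -> iid_law P t rho ->
  iid_law P (fun e w => phi (t e w)) (fun B => rho (phi @^-1` B)).
Proof.
move=> mphi [mt ht]; split; first by move=> e; exact: measurableT_comp.
move=> E B uE mB; rewrite -(ht E (fun e => phi @^-1` B e))// => e.
by rewrite -[X in measurable X]setTI; exact: mphi.
Qed.

(** An injective relabelling keeps lists of indices free of repetitions. It serves for lattice
    translations, giving stationarity, and for exchanging two edges. *)
Lemma iid_law_perm dO (Omega : measurableType dO) (P : probability Omega R)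
    (t : I -> Omega -> R) rho (s s' : I -> I) : cancel s s' ->
  iid_law P t rho -> iid_law P (fun e => t (s e)) rho.
Proof.
move=> ss [mt ht]; split=> // E B uE mB.
transitivity (P [set w | forall e, e \in map s E -> B (s' e) (t e w)]).
  congr (P _); apply/seteqP; split => w /= h e.
    by move=> /mapP[e' e'E ->]; rewrite ss; exact: h.
  by move=> eE; have := h (s e); rewrite ss; apply; exact: map_f.
rewrite (ht (map s E) (fun e => B (s' e)))//; last by rewrite map_inj_uniq//; exact: can_inj ss.
by congr EFin; rewrite big_map; apply: eq_bigr => e _; rewrite ss.
Qed.

(** The two image measures on configurations agree on boxes, a generating family stable under
    intersection, hence coincide. *)
Lemma iid_law_integral dO dO' (Omega : measurableType dO) (Omega' : measurableType dO')
    (P : probability Omega R) (P' : probability Omega' R)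
    (t : I -> Omega -> R) (t' : I -> Omega' -> R) rho (f : configT R I -> \bar R) :
  iid_law P t rho -> iid_law P' t' rho ->
  measurable_fun [set: configT R I] f -> (forall y, (0 <= f y)%E) ->
  (\int[P]_w f (fun e => t e w) = \int[P']_w f (fun e => t' e w))%E.
Proof.
move=> [mt ht] [mt' ht'] mf f0.
pose T w : configT R I := fun e => t e w; pose T' w : configT R I := fun e => t' e w.
have mT : measurable_fun setT T by exact: measurable_to_config.
have mT' : measurable_fun setT T' by exact: measurable_to_config.
have := @ge0_integral_pushforward _ _ _ _ R T mT P setT f measurableT mf (fun y _ => f0 y).
have := @ge0_integral_pushforward _ _ _ _ R T' mT' P' setT f measurableT mf (fun y _ => f0 y).
rewrite !preimage_setT /= => <- <-; apply: eq_measure_integral => A mA _.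
apply: (@measure_unique _ R (configT R I) (@config_boxes R I) (fun _ => setT)) => //.
- exact: config_boxesI.
- by move=> _; exists [::], (fun _ => setT); split => //; apply/seteqP; split.
- by rewrite bigcup_const//; exists 0%N.
- move=> _ [E [B [mB ->]]] /=; rewrite /pushforward.
  (* A box may list an index twice, whereas the product formula is for distinct indices. *)
  have BE y : config_box E B y <-> config_box (undup E) B y.
    by split => h e he; apply: h; rewrite mem_undup in he *.
  transitivity (P [set w | forall e, e \in undup E -> B e (t e w)]).
    by congr (P _); apply/seteqP; split => w /BE.
  rewrite ht ?undup_uniq// -(ht' _ _ (undup_uniq _))//.
  by congr (P' _); apply/seteqP; split => w /BE.
- by move=> _; rewrite /= /pushforward preimage_setT probability_setT ltry.
Qed.

(** Each coordinate is read from exactly one of the two copies, so a finite box becomes a rectangle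
    of the product space. *)
Lemma iid_law_split dO (Omega : measurableType dO) (P : probability Omega R)
    (t : I -> Omega -> R) rho (Q : pred I) : iid_law P t rho ->
  iid_law (P \x P)%E (fun e (w : Omega * Omega) => if Q e then t e w.1 else t e w.2) rho.
Proof.
move=> [mt ht]; split.
  move=> e; case: (Q e).
    exact: (measurableT_comp (mt e) measurable_fst).
  exact: (measurableT_comp (mt e) measurable_snd).
move=> E B uE mB.
pose A (Q' : pred I) := [set w | forall e, e \in [seq e <- E | Q' e] -> B e (t e w)].
have mA Q' : measurable (A Q').
  have -> : A Q' = (fun w => (fun e => t e w) : configT R I) @^-1`
      config_box ([seq e <- E | Q' e]) B by [].
  rewrite -[X in measurable X]setTI; apply: measurable_to_config => //.
  exact: measurable_config_box.
transitivity ((P \x P)%E (A Q `*` A (predC Q))).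
  congr (_ _); apply/seteqP; split => -[w w'] /=.
    move=> h; split => e; rewrite mem_filter => /andP[Qe eE].
      by have := h e eE; rewrite Qe.
    by have := h e eE; rewrite (negbTE Qe).
  move=> [h1 h2] e eE; case: ifPn => Qe; [apply: h1|apply: h2].
    by rewrite mem_filter Qe.
  by rewrite mem_filter /= Qe.
have PA Q' : P (A Q') = (\prod_(e <- E | Q' e) rho (B e))%:E.
  by rewrite -big_filter; apply: ht => //; exact: filter_uniq.
transitivity (P (A Q) * P (A (predC Q)))%E; first exact: product_measure1E.
rewrite !PA -EFinM; congr EFin.
by rewrite [RHS](bigID Q).
Qed.

(* The law does not change if the coordinates off Q are resampled from an
   independent copy; Fubini then factorizes the integral. *)
Lemma iid_law_independent dO (Omega : measurableType dO) (P : probability Omega R)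
    (t : I -> Omega -> R) rho (Q : pred I) (f g : configT R I -> R) :
  iid_law P t rho -> measurable_fun [set: configT R I] f ->
  measurable_fun [set: configT R I] g ->
  (forall y, 0 <= f y) -> (forall y, 0 <= g y) ->
  (forall y y', (forall e, Q e -> y e = y' e) -> f y = f y') ->
  (forall y y', (forall e, ~~ Q e -> y e = y' e) -> g y = g y') ->
  (\int[P]_w (f (fun e => t e w) * g (fun e => t e w))%:E =
   (\int[P]_w (f (fun e => t e w))%:E) * \int[P]_w (g (fun e => t e w))%:E)%E.
Proof.
move=> ht mf mg f0 g0 fQ gQ.
have ht2 := iid_law_split Q ht.
have mfg : measurable_fun [set: configT R I] (fun y => (f y * g y)%:E).
  by apply/measurable_EFinP; exact: measurable_funM.
rewrite (iid_law_integral ht ht2 mfg); last by move=> y; rewrite lee_fin mulr_ge0.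
pose F (w : Omega * Omega) : \bar R :=
  (f (fun e => t e w.1) * g (fun e => t e w.2))%:E.
have mF : measurable_fun setT F.
  apply/measurable_EFinP; apply: measurable_funM.
    apply: (measurableT_comp (f := f)) => //.
    by apply: measurable_to_config => e; exact: (measurableT_comp (ht.1 e) measurable_fst).
  apply: (measurableT_comp (f := g)) => //.
  by apply: measurable_to_config => e; exact: (measurableT_comp (ht.1 e) measurable_snd).
transitivity (\int[(P \x P)%E]_w F w)%E.
  apply: eq_integral => w _; rewrite /F; congr ((_ * _)%:E).
    by apply: fQ => e ->.
  by apply: gQ => e /negbTE ->.
rewrite fubini_tonelli1//; last by move=> w; rewrite lee_fin mulr_ge0.
rewrite /fubini_F /F /=.
have mfw : measurable_fun setT (fun w => (f (fun e => t e w))%:E).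
  apply/measurable_EFinP; apply: (measurableT_comp (f := f)) => //.
  by apply: measurable_to_config; exact: ht.1.
have mgw : measurable_fun setT (fun w => (g (fun e => t e w))%:E).
  apply/measurable_EFinP; apply: (measurableT_comp (f := g)) => //.
  by apply: measurable_to_config; exact: ht.1.
transitivity (\int[P]_w ((f (fun e => t e w))%:E * \int[P]_w' (g (fun e => t e w'))%:E))%E.
  apply: eq_integral => w _.
  under eq_integral do rewrite EFinM.
  by apply: ge0_integralZl => [||w' _|]; rewrite ?lee_fin.
rewrite muleC -ge0_integralZl//.
- by apply: eq_integral => w _; rewrite muleC.
- by move=> w _; rewrite lee_fin.
- by apply: integral_ge0 => w _; rewrite lee_fin.
Qed.

(** Induction on [r]: the head depends on the coordinates in [Q j] and, the [Q] being disjoint, the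
    tail only on coordinates off [Q j]. *)
Lemma iid_law_integral_prod_le dO (Omega : measurableType dO) (P : probability Omega R)
    (t : I -> Omega -> R) rho (J : eqType) (r : seq J) (Q : J -> pred I)
    (f : J -> configT R I -> R) (M : J -> R) :
  iid_law P t rho -> uniq r ->
  (forall j, measurable_fun [set: configT R I] (f j)) ->
  (forall j y, 0 <= f j y) ->
  (forall j y y', (forall e, Q j e -> y e = y' e) -> f j y = f j y') ->
  (forall j j' e, Q j e -> Q j' e -> j = j') ->
  (forall j, 0 <= M j) ->
  (forall j, (\int[P]_w (f j (fun e => t e w))%:E <= (M j)%:E)%E) ->
  (\int[P]_w (\prod_(j <- r) f j (fun e => t e w))%:E <= (\prod_(j <- r) M j)%:E)%E.
Proof.
move=> ht ur mf f0 fQ Qd M0 hM; elim: r ur => [_|j r IH /= /andP[jr ur]].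
  under eq_integral do rewrite big_nil.
  by rewrite big_nil integral_cst// mul1e [leLHS](@probability_setT _ _ _ P).
under eq_integral do rewrite big_cons.
rewrite big_cons.
rewrite (@iid_law_independent _ _ P t rho (Q j) (f j) (fun y => \prod_(j <- r) f j y))//.
- rewrite EFinM; apply: lee_pmul => //; last exact: IH.
    by apply: integral_ge0 => w _; rewrite lee_fin.
  by apply: integral_ge0 => w _; rewrite lee_fin prodr_ge0.
- by apply: measurable_prod => i _; exact: mf.
- by move=> y; rewrite prodr_ge0.
- exact: fQ.
- move=> y y' h; apply: eq_big_seq => i ir; apply: fQ => e Qe; apply: h.
  by apply: contraL ir => Qj; rewrite (Qd _ _ _ Qe Qj).
Qed.

End IidLaw.

Lemma measurable_sublevel (R : realType) dO (Omega : measurableType dO)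
    (f : Omega -> R) (x : R) :
  measurable_fun setT f -> measurable [set w | f w <= x].
Proof.
move=> /(_ measurableT _ (measurable_itv `]-oo, x])).
by rewrite setTI set_interval.set_itvE.
Qed.

(** * Measurability of the flow and almost sure bounds on capacities *)

Section Capacities.
Variables (R : realType) (d : nat).

(** The flow is below [r] exactly when one of countably many cuts has capacity below [r]. *)
Lemma measurable_maxflow (C : set (vecR R d)) (F1 F2 : set (point d)) (L : seq (edge d)) :
  (forall e, edge_in C e -> e \in L) -> (forall x, F1 x -> F2 x -> False) ->
  measurable_fun [set: configT R (edge d)]
    (fun y : configT R (edge d) => maxflow C F1 F2 y).
Proof.
move=> hL dis mD; apply: (measurability _ (RGenInftyO.measurableE R)) => //.
move=> _ [_ [r ->] <-]; rewrite setTI.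
pose cut E := if pselect (is_cut C F1 F2 E) then
  [set y : configT R (edge d) | \sum_(e <- E) y e < r] else set0.
rewrite [X in measurable X](_ : _ = \bigcup_E cut E).
  apply: countable_bigcupT_measurable => [|E]; first exact: countableP.
  rewrite /cut; case: pselect => [cE|nE]; last exact: measurable0.
  have : measurable_fun [set: configT R (edge d)] (fun y => \sum_(e <- E) y e).
    by apply: measurable_sum => e; exact: measurable_coord.
  move=> /(_ measurableT _ (measurable_itv `]-oo, r[)).
  by rewrite setTI set_interval.set_itvE.
apply/seteqP; split => y /=; rewrite in_itv/=.
  move=> hr; pose A := [set (\sum_(e <- E) y e) | E in is_cut C F1 F2].
  have hA : has_inf A.
    split; first by eexists; eexists; [exact: all_edges_cut hL dis|].
    (* A configuration may take negative values, so cut capacities are bounded below by minus the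
       total absolute value. *)
    exists (- \sum_(e <- L) `|y e|) => _ [E cE <-]; rewrite lerNl -sumrN.
    apply: (@le_trans _ _ (\sum_(e <- E) `|y e|)).
      by apply: ler_sum => e _; rewrite lerNl lerNnormlW.
    by apply: sum_subset_le => //; [exact: cE.1|move=> e /cE.2.1/hL].
  have [|_ [E cE <-] hE] := @inf_adherent _ A (r - inf A) _ hA.
    by rewrite subr_gt0.
  exists E => //; rewrite /cut; case: pselect => //= _.
  by rewrite subrKC in hE.
move=> [E _]; rewrite /cut; case: pselect => //= cE hE.
apply: le_lt_trans hE; apply: ge_inf; last by exists E.
exists (- \sum_(e <- L) `|y e|) => _ [E' cE' <-]; rewrite lerNl -sumrN.
apply: (@le_trans _ _ (\sum_(e <- E') `|y e|)).
  by apply: ler_sum => e _; rewrite lerNl lerNnormlW.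
by apply: sum_subset_le => //; [exact: cE'.1|move=> e /cE'.2.1/hL].
Qed.

Variables (dO : measure_display) (Omega : measurableType dO).
Variables (P : probability Omega R) (t : edge d -> Omega -> R) (F : R -> R).
Hypothesis iidt : iid_capacities P t F.

(** All capacities have distribution function [F], and the half-lines []x, +oo[] form a generating
    family stable under intersection. *)
Lemma capacity_law (e e' : edge d) (B : set R) : measurable B ->
  P (t e @^-1` B) = P (t e' @^-1` B).
Proof.
move=> mB; have [mt [ht _]] := iidt.
pose X e : {RV P >-> R} := mfun_Sub (mem_set (mt e)).
apply: (@measure_unique _ R _ (@RGenOInfty.G R) (fun n => `]- n%:R, +oo[%classic)
  _ _ _ _ (distribution P (X e)) (distribution P (X e'))) => //.
- exact: RGenOInfty.measurableE.
- move=> _ _ [x ->] [y ->]; exists (Num.max x y).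
  by apply/seteqP; split => z /=; rewrite !in_itv/= !andbT gt_max => /andP.
- by move=> n; eexists.
- apply/seteqP; split => // x _; exists (Num.truncn `|x|).+1 => //=.
  rewrite in_itv/= andbT ltrNl; apply: le_lt_trans (truncnS_gt _).
  by rewrite -normrN ler_norm.
- move=> _ [x ->]; rewrite /distribution /pushforward /=.
  have tail f : P (t f @^-1` `]x, +oo[) = (1 - (F x)%:E)%E.
    rewrite -(ht f x) -probability_setC; last first.
      exact: measurable_sublevel.
    congr (P _); apply/seteqP; split => w /=; rewrite in_itv/= andbT ltNge.
      by move=> /negP.
    by move=> /negP.
  by transitivity (1 - (F x)%:E)%E; [|symmetry]; exact: tail.
- by move=> n; rewrite (le_lt_trans (probability_le1 _ _))// ?ltry//; exact: measurable_itv.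
Qed.

Lemma capacities_iid_law (e0 : edge d) :
  iid_law P t (fun B => fine (P (t e0 @^-1` B))).
Proof.
have [mt [_ [_ ht]]] := iidt.
split=> // E B uE mB; rewrite -[LHS]fineK.
  by rewrite ht//; congr EFin; apply: eq_bigr => e _; rewrite (capacity_law e e0).
rewrite fin_num_measure//.
have := measurable_to_config mt measurableT (measurable_config_box (I := edge d) E mB).
by rewrite setTI.
Qed.

Lemma negligible_exists_edge (A : edge d -> set Omega) :
  (forall e, P.-negligible (A e)) -> P.-negligible [set w | exists e, A e w].
Proof.
move=> hA; rewrite [X in negligible _ X](_ : _ = \bigcup_n
   (if (unpickle n : option (edge d)) is Some e then A e else set0)).
  apply: negligible_bigcup => n; case: unpickle => [e|]; first exact: hA.
  exact: negligible_set0.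
apply/seteqP; split => w /=.
  by move=> [e Ae]; exists (pickle e) => //; rewrite pickleK.
by move=> [n _]; case: unpickle => // e Ae; exists e.
Qed.

Lemma capacities_ge0_ae : P.-negligible [set w | exists e, t e w < 0].
Proof.
have [mt [ht [F0 _]]] := iidt; apply: negligible_exists_edge => e.
rewrite [X in negligible _ X](_ : _ = \bigcup_n [set w | t e w <= - n.+1%:R^-1]).
  apply: negligible_bigcup => n; exists [set w | t e w <= - n.+1%:R^-1]; split => //.
    exact: measurable_sublevel.
  by transitivity (F (- n.+1%:R^-1))%:E; [exact: ht|rewrite F0// oppr_lt0 invr_gt0].
apply/seteqP; split => w /=.
  move=> h; exists (Num.truncn (- t e w)^-1) => //=; rewrite lerNr.
  by rewrite invf_ple ?posrE ?oppr_gt0// ltW// truncnS_gt.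
by move=> [n _] /= /le_lt_trans; apply; rewrite oppr_lt0 invr_gt0.
Qed.

Lemma capacities_bounded_ae (M : R) : F M = 1 ->
  P.-negligible [set w | exists e, M < t e w].
Proof.
have [mt [ht _]] := iidt; move=> FM; apply: negligible_exists_edge => e.
have mM : measurable [set w | t e w <= M] by exact: measurable_sublevel.
exists (~` [set w | t e w <= M]); split.
- exact: measurableC.
- rewrite [LHS]probability_setC// (_ : P _ = 1%E) ?subee//.
  by rewrite -FM; exact: ht.
- by move=> w /=; rewrite ltNge => /negP.
Qed.

Lemma le_probability_ae (A A' N : set Omega) : measurable A -> measurable A' ->
  P.-negligible N -> A `\` A' `<=` N -> (P A <= P A')%E.
Proof.
move=> mA mA' hN AN.
have PD : P (A `\` A') = 0%E.
  by apply: measure_negligible; [exact: measurableD|exact: negligibleS hN].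
apply: (@le_trans _ _ (P (A' `|` (A `\` A')))).
  apply: le_measure; rewrite ?inE//; first exact/measurableU/measurableD.
  by move=> w Aw; have [?|?] := pselect (A' w); [left|right].
apply: (@le_trans _ _ (P A' + P (A `\` A'))%E); last by rewrite PD adde0.
by apply: measureU2 => //; exact: measurableD.
Qed.

End Capacities.

(** * Exponential moments and Markov's inequality *)

Section ExponentialMoments.
Variable R : realType.

(** Insert [expR x <= 1 + x * expR x], a form of [1 - x <= expR (- x)], into itself. *)
Lemma expR_le_quadratic (x : R) : 0 <= x -> expR x <= 1 + x + x ^+ 2 * expR x.
Proof.
move=> x0; have e0 := expR_gt0 x.
have h1 : expR x <= 1 + x * expR x.
  have : (1 - x) * expR x <= expR (- x) * expR x.
    by apply: ler_wpM2r; [exact: ltW|exact: expR_ge1Dx].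
  rewrite -expRD addNr expR0; lra.
have : x * expR x <= x * (1 + x * expR x) by rewrite ler_wpM2l.
rewrite expr2; lra.
Qed.

Lemma sqr_le_expR (x : R) : 0 <= x -> x ^+ 2 <= 4 * expR x.
Proof.
move=> x0; have h : 1 + x / 2 <= expR (x / 2) by exact: expR_ge1Dx.
have -> : expR x = expR (x / 2) ^+ 2 by rewrite -expRM_natl mulrC divfK.
have : (1 + x / 2) ^+ 2 <= expR (x / 2) ^+ 2 by rewrite lerXn2r ?nnegrE//; lra.
nra.
Qed.

Variables (dO : measure_display) (Omega : measurableType dO) (P : probability Omega R).

Lemma integral_EFin_le (f g : Omega -> R) :
  measurable_fun setT f -> measurable_fun setT g ->
  (forall w, 0 <= f w) -> (forall w, f w <= g w) ->
  (\int[P]_w (f w)%:E <= \int[P]_w (g w)%:E)%E.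
Proof.
move=> /measurable_EFinP mf /measurable_EFinP mg f0 fg.
by apply: ge0_le_integral => // w _; rewrite lee_fin.
Qed.

Lemma integral_EFin_lin_le (f g : Omega -> R) (c c' a b : R) :
  measurable_fun setT f -> measurable_fun setT g ->
  (forall w, 0 <= f w) -> (forall w, 0 <= g w) -> 0 <= c -> 0 <= c' ->
  (\int[P]_w (f w)%:E <= a%:E)%E -> (\int[P]_w (g w)%:E <= b%:E)%E ->
  (\int[P]_w (c * f w + c' * g w)%:E <= (c * a + c' * b)%:E)%E.
Proof.
move=> /measurable_EFinP mf /measurable_EFinP mg f0 g0 c0 c'0 fa gb.
have fE0 w : setT w -> (0 <= (f w)%:E)%E by rewrite lee_fin.
have gE0 w : setT w -> (0 <= (g w)%:E)%E by rewrite lee_fin.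
under eq_integral do rewrite EFinD !EFinM.
rewrite (ge0_integralD P measurableT
  (f1 := fun w => (c%:E * (f w)%:E)%E) (f2 := fun w => (c'%:E * (g w)%:E)%E)).
- rewrite (ge0_integralZl_EFin P measurableT fE0 mf c0).
  rewrite (ge0_integralZl_EFin P measurableT gE0 mg c'0).
  by rewrite EFinD !EFinM leeD// lee_wpmul2l.
- by move=> w _; rewrite -EFinM lee_fin mulr_ge0.
- by apply: emeasurable_funM => //; exact: measurable_cst.
- by move=> w _; rewrite -EFinM lee_fin mulr_ge0.
- by apply: emeasurable_funM => //; exact: measurable_cst.
Qed.

Lemma markov_bound (A : set Omega) (Z : Omega -> R) (a M : R) : measurable A ->
  measurable_fun setT Z -> (forall w, 0 <= Z w) -> 0 < a ->
  (forall w, A w -> a <= Z w) -> (\int[P]_w (Z w)%:E <= M%:E)%E ->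
  (P A <= (M / a)%:E)%E.
Proof.
move=> mA mZ Z0 a0 aZ hM.
have mZE : measurable_fun setT (EFin \o Z) by exact/measurable_EFinP.
rewrite EFinM muleC lee_pdivlMl// -integral_cst//.
apply: le_trans hM; apply: (@le_trans _ _ (\int[P]_(w in A) (Z w)%:E)%E).
  apply: ge0_le_integral => //.
  - by move=> w _; rewrite lee_fin ltW.
  - by apply: measurable_funS mZE.
by apply: (ge0_subset_integral P mA measurableT mZE) => // w _; rewrite lee_fin.
Qed.

Variables (I : eqType) (t : I -> Omega -> R) (rho : set R -> R).
Hypothesis ht : iid_law P t rho.

Lemma integral_exp_sum_le (th M : R) (L : seq I) : uniq L ->
  (forall e, (\int[P]_w (expR (th * t e w))%:E <= M%:E)%E) -> 0 <= M ->
  (\int[P]_w (expR (th * \sum_(e <- L) t e w))%:E <= (M ^+ size L)%:E)%E.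
Proof.
move=> uL hM M0; under eq_integral do rewrite mulr_sumr expR_sum.
rewrite (_ : M ^+ size L = \prod_(e <- L) M); last first.
  by rewrite big_const_seq count_predT iter_mulr_1.
apply: (@iid_law_integral_prod_le _ _ _ _ P t rho I L (fun e => pred1 e)
  (fun e y => expR (th * y e)) (fun=> M) ht) => //.
- move=> e; apply: measurableT_comp; first exact: measurable_expR.
  by apply: measurable_funM => //; exact: measurable_coord.
- by move=> e y y' h; rewrite h//=.
- by move=> e e' f /= /eqP <- /eqP.
Qed.

(** Second-order expansion: for [th <= 1] the remainder is at most [4 * th ^+ 2] times the
    exponential of twice [X], which the sum over [L] dominates. Since [C] does not depend on [th], a
    small [th] brings the exponent per unit of [th] as close to [m] as desired. *)
Lemma exp_moment_bound (X : configT R I -> R) (L : seq I) (m M2 : R) :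
  measurable_fun [set: configT R I] X -> uniq L ->
  (forall w, 0 <= X (fun e => t e w) <= \sum_(e <- L) t e w) -> 0 <= M2 ->
  (forall e, (\int[P]_w (expR (2 * t e w))%:E <= M2%:E)%E) ->
  (\int[P]_w (X (fun e => t e w))%:E <= m%:E)%E ->
  exists2 C : R, 0 <= C & forall th, 0 <= th <= 1 ->
    (\int[P]_w (expR (th * X (fun e => t e w)))%:E <= (expR (th * (m + th * C)))%:E)%E.
Proof.
move=> mX uL hX M20 hM2 hm; exists (4 * M2 ^+ size L).
  by rewrite mulr_ge0// exprn_ge0.
move=> th /andP[th0 th1]; pose Y w := X (fun e => t e w).
have Y0 w : 0 <= Y w by have /andP[] := hX w.
have mY : measurable_fun setT Y.
  apply: (measurableT_comp (f := X)) => //.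
  by apply: measurable_to_config; exact: ht.1.
have mexp (b : R) : measurable_fun setT (fun w => expR (b * Y w)).
  apply: measurableT_comp; first exact: measurable_expR.
  exact: measurable_funM.
have pt w : expR (th * Y w) <= 1 + th * Y w + th ^+ 2 * 4 * expR (2 * Y w).
  apply: le_trans (expR_le_quadratic _) _; first exact: mulr_ge0.
  have b : Y w ^+ 2 * expR (th * Y w) <= (4 * expR (Y w)) * expR (Y w).
    apply: ler_pM; rewrite ?sqr_ge0 ?expR_ge0//; first exact: sqr_le_expR.
    by rewrite ler_expR -[leRHS]mul1r ler_wpM2r.
  have -> : expR (2 * Y w) = expR (Y w) * expR (Y w).
    by rewrite -expRD mulr_natl mulr2n.
  have c0 : 0 <= th ^+ 2 by exact: sqr_ge0.
  have := ler_wpM2l c0 b; rewrite exprMn; lra.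
have E2 : (\int[P]_w (expR (2 * Y w))%:E <= (M2 ^+ size L)%:E)%E.
  apply: le_trans (integral_exp_sum_le uL hM2 M20).
  apply: integral_EFin_le => // [|w]; last first.
    by rewrite ler_expR ler_wpM2l//; have /andP[] := hX w.
  apply: measurableT_comp; first exact: measurable_expR.
  by apply: measurable_funM => //; apply: measurable_sum => e; exact: ht.1.
have mq : measurable_fun setT (fun w => 1 + th * Y w).
  by apply: measurable_funD => //; exact: measurable_funM.
have E1 : (\int[P]_w 1%:E <= 1%:E)%E.
  by rewrite integral_cst// mul1e [leLHS](@probability_setT _ _ _ P).
have EY : (\int[P]_w (1 * 1 + th * Y w)%:E <= (1 * 1 + th * m)%:E)%E.
  by apply: (integral_EFin_lin_le (f := fun=> 1)) => //; exact: measurable_cst.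
have q0 : 0 <= th ^+ 2 * 4 by rewrite mulr_ge0 ?sqr_ge0.
have mq' : measurable_fun setT (fun w => 1 * 1 + th * Y w).
  by apply: measurable_funD => //; exact: measurable_funM.
have := @integral_EFin_lin_le (fun w => 1 * 1 + th * Y w) (fun w => expR (2 * Y w))
  1 (th ^+ 2 * 4) _ _ mq' (mexp 2) (fun w => addr_ge0 (mulr_ge0 ler01 ler01) (mulr_ge0 th0 (Y0 w)))
  (fun w => expR_ge0 _) ler01 q0 EY E2.
move=> H; apply: le_trans (_ : (_ <= _)%E) _; last first.
  apply: le_trans H _; rewrite lee_fin; apply: le_trans (expR_ge1Dx _); lra.
apply: integral_EFin_le => // [|w].
  apply: measurable_funD; first exact: measurable_funM.
  exact: measurable_funM.
by rewrite mul1r mul1r; exact: pt.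
Qed.

End ExponentialMoments.

(** * Chernoff's bound for disjoint tiles *)

Section TilesTail.
Variables (R : realType) (k : nat).
Let d := k.+1.
Variables (u : 'I_k -> vecR R d) (v : vecR R d).
Hypotheses (ou : Defs.orthonormal (d := d) u) (uv : unit_normal (d := d) u v).

Lemma measurable_cylflow (c : vecR R d) (L : 'I_k -> R) (h : R) :
  measurable_fun [set: configT R (edge d)]
    (fun y : configT R (edge d) => cylflow u v c L h y).
Proof.
have [s hs] := cyl_edges ou uv c L h.
by apply: (measurable_maxflow hs) => x; exact: boundary_disjoint.
Qed.

Lemma cylflow_ge0 (c : vecR R d) (L : 'I_k -> R) (h : R) y :
  (forall e, 0 <= y e) -> 0 <= cylflow u v c L h y.
Proof. exact: maxflow_ge0. Qed.

Lemma cylflow_le_sum (c : vecR R d) (L : 'I_k -> R) (h : R) :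
  exists2 s : seq (edge d), uniq s &
    forall y, (forall e, 0 <= y e) -> cylflow u v c L h y <= \sum_(e <- s) y e.
Proof.
have [s hs] := cyl_edges ou uv c L h; exists (undup s); first exact: undup_uniq.
move=> y y0; apply: le_trans (maxflow_le_cut y0 (all_edges_cut hs _)) _.
  by move=> x; exact: boundary_disjoint.
by apply: sum_subset_le => // [|e]; [exact/filter_uniq/undup_uniq|rewrite mem_filter => /andP[]].
Qed.

Variables (dO : measure_display) (Omega : measurableType dO) (P : probability Omega R).
Variables (t : edge d -> Omega -> R) (rho : set R -> R) (ht : iid_law P t rho).
Variables (L' : 'I_k -> R) (h' : R).

Let X (y : edge d -> R) := cylflow u v 0 L' h' y.

Lemma shift_edgeK (w : point d) : cancel (shift_edge w) (shift_edge (- w)).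
Proof. by case=> x i; rewrite /shift_edge /= addrK. Qed.

(** The tile flows read disjoint sets of edges and are translates of one another, so the exponential
    moment of their sum is at most a power of that of one tile. On [A] the sum over all slabs is at
    least [K * s]; adding the slabs before applying Markov's inequality multiplies the rate by
    [K]. *)
Lemma tiles_tail (J : finType) (K : nat) (w : 'I_K -> J -> point d) (A : set Omega)
    (th b s : R) :
  (forall a j a' j' x, in_tile u v L' h' (w a) j x -> in_tile u v L' h' (w a') j' x ->
     a = a' /\ j = j') ->
  0 <= th -> (\int[P]_o (expR (th * X (fun e => t e o)))%:E <= (expR b)%:E)%E ->
  measurable A ->
  (forall o, A o -> forall a, s <= \sum_j X (fun e => t (shift_edge (w a j) e) o)) ->
  (P A <= (expR (K%:R * (#|J|%:R * b - th * s)))%:E)%E.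
Proof.
move=> disj th0 hb mA hA.
pose f (aj : 'I_K * J) (y : configT R (edge d)) : R :=
  expR (th * X (fun e => y (shift_edge (w aj.1 aj.2) e))).
have mf aj : measurable_fun [set: configT R (edge d)] (f aj).
  apply: measurableT_comp; first exact: measurable_expR.
  apply: measurable_funM; first exact: measurable_cst.
  apply: (measurableT_comp (measurable_cylflow 0 L' h')).
  by apply: measurable_to_config => e; exact: measurable_coord.
(* The edges read by the flow of a tile; an edge read by two tiles would have its first endpoint in
   both. *)
pose Q (aj : 'I_K * J) (e : edge d) : bool :=
  `[< edge_in (cyl (hrect (d := d) 0 u L') v h') (shift_edge (- w aj.1 aj.2) e) >].
have fQ aj y y' : (forall e, Q aj e -> y e = y' e) -> f aj y = f aj y'.
  move=> hy; rewrite /f; congr (expR (th * _)); apply: maxflow_eq => e he.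
  by apply: hy; apply/asboolP; rewrite shift_edgeK.
have Qd aj aj' e : Q aj e -> Q aj' e -> aj = aj'.
  move=> /asboolP/(edge_in_cylP ou uv)/andP[h1 _] /asboolP/(edge_in_cylP ou uv)/andP[h2 _].
  by case: aj aj' h1 h2 => [a j] [a' j'] /= h1 h2; have [-> ->] := disj _ _ _ _ _ h1 h2.
have fM aj : (\int[P]_o (f aj (fun e => t e o))%:E <= (expR b)%:E)%E.
  apply: le_trans hb; rewrite /f.
  have hts := iid_law_perm (shift_edgeK (w aj.1 aj.2)) ht.
  rewrite (@iid_law_integral R _ _ _ _ _ P P _ t rho (fun y => (expR (th * X y))%:E) hts ht)//.
  apply/measurable_EFinP; apply: measurableT_comp; first exact: measurable_expR.
  by apply: measurable_funM; [exact: measurable_cst|exact: measurable_cylflow].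
pose r := enum {: 'I_K * J}.
have hprod := iid_law_integral_prod_le ht (enum_uniq {: 'I_K * J}) mf
  (fun aj y => expR_ge0 _) fQ Qd (fun=> expR_ge0 b) fM.
pose Z o := \prod_(aj <- r) f aj (fun e => t e o).
have mZ : measurable_fun setT Z.
  apply: measurable_prod => aj _; apply: (measurableT_comp (mf aj)).
  by apply: measurable_to_config; exact: ht.1.
have ZE o : Z o = expR (th * \sum_a \sum_j X (fun e => t (shift_edge (w a j) e) o)).
  by rewrite /Z /f -expR_sum -mulr_sumr /r big_enum /= pair_bigA.
have Zlb o : A o -> expR (th * (K%:R * s)) <= Z o.
  move=> Ao; rewrite ZE ler_expR ler_wpM2l//.
  have -> : K%:R * s = \sum_(a < K) s by rewrite sumr_const card_ord mulr_natl.
  by apply: ler_sum => a _; exact: hA.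
have Z0 o : 0 <= Z o by rewrite ZE expR_ge0.
apply: le_trans (markov_bound mA mZ Z0 (expR_gt0 _) Zlb hprod) _.
rewrite lee_fin -expR_sum -expRN -expRD ler_expR big_enum /= sumr_const.
by rewrite card_prod card_ord -[_ *+ _]mulr_natl natrM; lra.
Qed.

End TilesTail.

Lemma probability_bigsetU_le (R : realType) dO (Omega : measurableType dO)
    (P : probability Omega R) (I : Type) (r : seq I) (E : I -> set Omega) :
  (forall i, measurable (E i)) ->
  (P (\big[setU/set0]_(i <- r) E i) <= \sum_(i <- r) P (E i))%E.
Proof.
move=> mE; elim: r => [|i r IH]; first by rewrite !big_nil measure0.
rewrite !big_cons; apply: (@le_trans _ _ (P (E i) + P (\big[setU/set0]_(j <- r) E j))%E).
  by apply: measureU2 => //; exact: bigsetU_measurable.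
exact: leeD2l.
Qed.

(** * Upper tail of the flow *)

Section UpperTail.
Variables (R : realType) (k : nat).
Let d := k.+1.
Variables (u : 'I_k -> vecR R d) (v : vecR R d).
Hypotheses (ou : Defs.orthonormal (d := d) u) (uv : unit_normal (d := d) u v).
Variables (l : 'I_k -> R) (l_gt0 : forall i, 0 < l i) (k_gt0 : (0 < k)%N).
Variables (dO : measure_display) (Omega : measurableType dO) (P : probability Omega R).
Variables (t : edge d -> Omega -> R) (rho : set R -> R) (ht : iid_law P t rho).
Hypotheses (t0 : forall e o, 0 <= t e o)
  (moments : forall th : R, 0 < th -> exists2 M : R, 1 <= M &
    forall e, (\int[P]_o (expR (th * t e o))%:E <= M%:E)%E).

Let area (n : nat) : R := n%:R ^+ k * \prod_i l i.
Let flow c n h o := cylflow u v c (fun i => n%:R * l i) h (fun e => t e o).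

Variable mu : R.
Hypotheses (mu_ge0 : 0 <= mu)
  (tile_flow : forall (eps : R) (p0 : nat), 0 < eps -> exists2 p : nat, (p0 <= p)%N &
    (\int[P]_o (flow 0 p p%:R o)%:E <= (area p * (mu + eps))%:E)%E).

Let area_gt0 n : (0 < n)%N -> 0 < area n.
Proof. by move=> n0; rewrite mulr_gt0 ?exprn_gt0 ?ltr0n// prodr_gt0. Qed.

Lemma measurable_flow c n h : measurable_fun setT (flow c n h).
Proof.
apply: (measurableT_comp (measurable_cylflow ou uv c (fun i => n%:R * l i) h)).
by apply: measurable_to_config; exact: ht.1.
Qed.

(** Of the excess [3 * eps], one [eps] covers the mean of a tile, one the quadratic term [th * C],
    and the last gives the rate [th * eps]. The tile size [p] is chosen after [delta] and [th] after
    [p], all before [n], [K] and [h]. *)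
Lemma slab_flows_tail (eps delta : R) : 0 < eps -> 0 < delta ->
  exists (kap eta : R) (n1 : nat), [/\ 0 < kap, 0 < eta &
  forall n K (h : R) (c : vecR R d),
    (n1 <= n)%N -> K%:R <= kap * n%:R -> K%:R <= kap * h ->
  exists (B : 'I_K -> seq (edge d)) (S : 'I_K -> Omega -> R),
    [/\ forall a, uniq (B a) /\ (size (B a))%:R <= delta * area n,
        forall a o, flow c n h o <= S a o + \sum_(e <- B a) t e o &
        forall A, measurable A ->
          (forall o, A o -> forall a, (mu + 3 * eps) * area n <= S a o) ->
          (P A <= (expR (- (K%:R * (eta * area n))))%:E)%E]].
Proof.
move=> eps0 delta0.
have [p0 hp0] := slab_decomposition ou uv l_gt0 k_gt0 delta0.
have [p hp hm] := tile_flow (maxn p0 1) eps0.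
move: hp; rewrite geq_max => /andP[pp0 p_gt0].
have [kap kap0 [n1 hn1]] := hp0 p pp0.
have ap0 := area_gt0 p_gt0.
have [s us hs] := cylflow_le_sum ou uv 0 (fun i => p%:R * l i) p%:R.
have [M2 M21 hM2] := moments (ltr0n R 2).
have [|C C0 hC] := @exp_moment_bound R _ _ P _ t rho ht
    (fun y => cylflow u v 0 (fun i => p%:R * l i) p%:R y) s _ M2
    (measurable_cylflow ou uv 0 _ _) us _ (le_trans ler01 M21) hM2 hm.
  by move=> o; rewrite cylflow_ge0//= hs.
pose th := Num.min 1 (eps * area p / (C + 1)).
have C1 : 0 < C + 1 by rewrite ltr_wpDl.
have th0 : 0 < th by rewrite lt_min ltr01 divr_gt0// mulr_gt0.
have th1 : 0 <= th <= 1 by rewrite ltW//= ge_min lexx.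
have thC : th * C <= eps * area p.
  have : th <= eps * area p / (C + 1) by rewrite ge_min lexx orbT.
  by rewrite ler_pdivlMr// => ?; have := th0; lra.
exists kap, (th * eps), n1; split => //; first exact: mulr_gt0.
move=> n K h c nn1 Kn Kh.
have [J [w [B [hJ disj hB hflow]]]] := hn1 n K h c nn1 Kn Kh.
exists B, (fun a o => \sum_j cylflow u v 0 (fun i => p%:R * l i) p%:R
   (fun e => t (shift_edge (w a j) e) o)); split => //.
  by move=> a o; apply: hflow.
move=> A mA hA.
apply: le_trans (tiles_tail ou uv ht disj (ltW th0) (hC _ th1) mA hA) _.
have JA : #|J|%:R * area p <= area n by rewrite /area mulrA ler_pM2r ?prodr_gt0.
rewrite lee_fin ler_expR -[leRHS]mulrN ler_wpM2l//.
have h1 : #|J|%:R * (area p * (mu + eps) + th * C) <= area n * (mu + 2 * eps).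
  apply: (@le_trans _ _ (#|J|%:R * area p * (mu + 2 * eps))).
    have mu0 := mu_ge0; by rewrite -mulrA ler_wpM2l//; lra.
  by have mu0 := mu_ge0; rewrite ler_wpM2r//; lra.
have h2 := ler_wpM2l (ltW th0) h1; lra.
Qed.

(** Here [delta = eps / M] keeps the extra edges below [eps * area n] surely, so a flow of at least
    [(mu + 4 * eps) * area n] overloads every slab. *)
Lemma flow_tail_bounded (M lam : R) : 0 < M -> (forall e o, t e o <= M) -> mu < lam ->
  exists (kap eta : R) (n1 : nat), [/\ 0 < kap, 0 < eta &
  forall n K (h : R) (c : vecR R d),
    (n1 <= n)%N -> K%:R <= kap * n%:R -> K%:R <= kap * h -> (0 < K)%N ->
    (P [set o | (lam * area n <= flow c n h o)%R] <=
      (expR (- (K%:R * (eta * area n))))%:E)%E].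
Proof.
move=> M0 tM mulam; pose eps := (lam - mu) / 4.
have eps0 : 0 < eps by rewrite divr_gt0// subr_gt0.
have [kap [eta [n1 [kap0 eta0 H]]]] := slab_flows_tail eps0 (divr_gt0 eps0 M0).
exists kap, eta, n1; split => // n K h c nn1 Kn Kh K0.
have [B [S [hB hf hP]]] := H n K h c nn1 Kn Kh.
apply: hP.
  have := measurable_flow c n h measurableT (measurable_itv `[lam * area n, +oo[).
  by rewrite setTI set_interval.set_itvE.
move=> o /= Ao a.
have hs : \sum_(e <- B a) t e o <= eps * area n.
  apply: (@le_trans _ _ (\sum_(e <- B a) M)); first by apply: ler_sum.
  rewrite big_const_seq count_predT iter_addr_0 -mulr_natr.
  have -> : eps * area n = M * (eps / M * area n).
    by rewrite mulrA [M * _]mulrC divfK ?gt_eqF.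
  by rewrite ler_wpM2l ?(ltW M0)//; exact: (hB a).2.
have := hf a o; move: Ao; rewrite /eps in hs *; lra.
Qed.

(** The extra edges of a slab may now be heavy, and large exponential moments make this as rare as
    the target rate [La] demands. Off these [K] events every slab is overloaded. [K] is fixed after
    [eta], which depends on [delta] and so on [La]. *)
Lemma flow_tail_moments (lam La : R) : 0 < La -> mu < lam ->
  exists (K : nat) (h1 : R) (n1 : nat), forall n (h : R) (c : vecR R d),
    (n1 <= n)%N -> h1 <= h ->
    (P [set o | (lam * area n <= flow c n h o)%R] <=
      (K%:R * expR (- (La * area n)))%:E)%E.
Proof.
move=> La0 mulam; pose eps := (lam - mu) / 4.
have eps0 : 0 < eps by rewrite divr_gt0// subr_gt0.
(* [th * eps = 2 * La]: one [La] compensates the moment bound [M ^+ size (B a)], thanks to [delta],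
   and the other remains as the rate. *)
pose th := 2 * La / eps.
have th0 : 0 < th by rewrite divr_gt0// mulr_gt0.
have [M M1 hM] := moments th0.
have lnM : 0 <= ln M by rewrite ln_ge0.
pose delta := La / (ln M + 1).
have delta0 : 0 < delta by rewrite divr_gt0// ltr_wpDl.
have [kap [eta [n1 [kap0 eta0 H]]]] := slab_flows_tail eps0 delta0.
(* Enough slabs for [K * eta] to exceed [La]. *)
pose K := (Num.truncn (La / eta)).+1.
exists K.+1, (K%:R / kap), (maxn n1 (Num.truncn (K%:R / kap)).+1) => n h c.
rewrite geq_max => /andP[nn1 nK] hh.
have Kn : K%:R <= kap * n%:R.
  rewrite mulrC -ler_pdivrMr// ltW//; apply: lt_le_trans (truncnS_gt _) _.
  by rewrite ler_nat.
have Kh : K%:R <= kap * h by rewrite mulrC -ler_pdivrMr.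
have an0 : 0 < area n.
  by apply: area_gt0; apply: leq_ltn_trans nK.
have [B [S [hB hf hP]]] := H n K h c nn1 Kn Kh.
pose A := [set o | lam * area n <= flow c n h o].
have mA : measurable A.
  have := measurable_flow c n h measurableT (measurable_itv `[lam * area n, +oo[).
  by rewrite setTI set_interval.set_itvE.
pose Y a o := \sum_(e <- B a) t e o.
have mY a : measurable_fun setT (Y a) by apply: measurable_sum => e; exact: ht.1.
pose E (a : 'I_K) := [set o | eps * area n <= Y a o].
have mE a : measurable (E a).
  have := mY a measurableT _ (measurable_itv `[eps * area n, +oo[).
  by rewrite setTI set_interval.set_itvE.
have PE a : (P (E a) <= (expR (- (La * area n)))%:E)%E.
  have M0 : 0 < M by exact: lt_le_trans M1.
  apply: le_trans (@markov_bound R _ _ P (E a) (fun o => expR (th * Y a o))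
    (expR (th * (eps * area n))) (M ^+ size (B a)) (mE a) _ _ _ _ _) _.
  - apply: measurableT_comp; first exact: measurable_expR.
    by apply: measurable_funM.
  - by move=> o; exact: expR_ge0.
  - exact: expR_gt0.
  - by move=> o Eo; rewrite ler_expR ler_wpM2l// ltW.
  - exact: (integral_exp_sum_le ht (hB a).1 hM (ltW M0)).
  rewrite lee_fin -expRN -[M]lnK ?posrE// -expRM_natl -expRD ler_expR.
  have h1 : (size (B a))%:R * ln M <= La * area n.
    apply: (@le_trans _ _ (delta * area n * ln M)).
      by rewrite ler_wpM2r//; exact: (hB a).2.
    rewrite mulrAC ler_wpM2r ?(ltW an0)// /delta mulrAC ler_pdivrMr ?ltr_wpDl//.
    by rewrite ler_wpM2l ?(ltW La0)// lerDl.
  have -> : th * (eps * area n) = 2 * La * area n.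
    by rewrite /th mulrA divfK// gt_eqF.
  lra.
pose U := \big[setU/set0]_(a < K) E a.
have mU : measurable U by apply: bigsetU_measurable.
have PU : (P U <= (K%:R * expR (- (La * area n)))%:E)%E.
  apply: le_trans (probability_bigsetU_le P (index_enum 'I_K) mE) _.
  rewrite (_ : (K%:R * _)%:E = (\sum_(a < K) (expR (- (La * area n)))%:E)%E).
    exact: lee_sum.
  by rewrite sumEFin sumr_const card_ord mulr_natl.
have PAU : (P (A `\` U) <= (expR (- (La * area n)))%:E)%E.
  apply: le_trans (hP _ (measurableD mA mU) _) _.
    move=> o [Ao nU] a.
    have nE : Y a o < eps * area n.
      rewrite ltNge; apply/negP => Eo; apply: nU.
      by rewrite /U -bigcup_seq; exists a => //=; exact: mem_index_enum.
    have := hf a o; rewrite -/(Y a o) => hfa.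
    by move: Ao nE hfa; rewrite /A /= /eps; lra.
  rewrite lee_fin ler_expR lerN2 mulrA ler_wpM2r ?(ltW an0)//.
  by rewrite -ler_pdivrMr// ltW// truncnS_gt.
apply: (@le_trans _ _ (P ((A `\` U) `|` U))).
  apply: le_measure; rewrite ?inE//; first exact/measurableU/mU/measurableD.
  by move=> o Ao; have [?|?] := pselect (U o); [right|left].
apply: (@le_trans _ _ (P (A `\` U) + P U)%E).
  by apply: measureU2 => //; exact: measurableD.
apply: le_trans (leeD PAU PU) _.
by rewrite -EFinD lee_fin -[K.+1%:R]natr1; lra.
Qed.

End UpperTail.

(** * Lattice walks inside a region *)

Section LatticeWalks.
Variables (d : nat) (S good : point d -> Prop).
Hypothesis closed_step : forall a b, S a -> good a -> good b -> nneighbour a b -> S b.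

Lemma line_closed (s y : point d) n : (forall a, nneighbour a (a + s)) ->
  (forall i, (i <= n)%N -> good (y + s *+ i)) -> S y <-> S (y + s *+ n).
Proof.
move=> hs; elim: n => [|n IH] hg; first by rewrite mulr0n addr0.
have hgn := hg n (leqnSn n); have hgS := hg n.+1 (leqnn _).
have nn : nneighbour (y + s *+ n) (y + s *+ n.+1) by rewrite mulrSr addrA.
have nn' : nneighbour (y + s *+ n.+1) (y + s *+ n).
  by case: nn => i [] ->; exists i; [right|left]; rewrite ?addrK ?subrK.
have {}IH := IH (fun i hi => hg i (leqW hi)).
split=> [/IH Sn|Sn]; first exact: closed_step Sn hgn hgS nn.
by apply/IH; exact: closed_step Sn hgS hgn nn'.
Qed.

(** Move one coordinate of [a] towards [b]: the box spanned by the two points shrinks, so its points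
    stay good, and their l1 distance drops. *)
Lemma box_closed (a b : point d) :
  (forall z : point d, (forall j, Num.min (a 0 j) (b 0 j) <= z 0 j <= Num.max (a 0 j) (b 0 j)) ->
     good z) -> S a -> S b.
Proof.
have [N] := ubnP (\sum_j absz (a 0%R j - b 0%R j)%R)%N; elim: N a => // N IH a hN hg Sa.
have [->//|ab] := eqVneq b a.
have [j abj] : exists j, a 0 j != b 0 j.
  apply: contrapT => h; move/eqP: ab; apply; apply/rowP => j.
  by apply/esym/eqP/negPn/negP => hj; apply: h; exists j.
pose a' : point d := if a 0 j < b 0 j then a + unitv j else a - unitv j.
have a'E i : a' 0 i = if i == j then (if a 0 j < b 0 j then a 0 j + 1 else a 0 j - 1) else a 0 i.
  rewrite /a'; case: ifP => _; rewrite !mxE eqxx /=; case: eqP => [->|_] //=.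
    by rewrite addr0.
  by rewrite subr0.
have hab i : Num.min (a 0 i) (b 0 i) <= Num.min (a' 0 i) (b 0 i) /\
             Num.max (a' 0 i) (b 0 i) <= Num.max (a 0 i) (b 0 i).
  rewrite a'E; case: eqP => // ->; move: abj; set x := a 0 j; set y := b 0 j => xy.
  by case: ifP => hxy; rewrite le_min ge_max !ge_min !le_max !lexx !orbT !andbT; lia.
apply: (IH a').
- move: hN; rewrite ltnS; apply: leq_trans.
  rewrite (bigD1 j)//= [in leqRHS](bigD1 j)//= -addSn leq_add//.
    rewrite a'E eqxx; move: abj; set x := a 0 j; set y := b 0 j => xy.
    by case: ifP => hxy; lia.
  by apply: eq_leq; apply: eq_bigr => i ij; rewrite a'E (negbTE ij).
- move=> z hz; apply: hg => i; have [h1 h2] := hab i; have /andP[h3 h4] := hz i.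
  by rewrite (le_trans h1 h3) (le_trans h4 h2).
- apply: closed_step Sa _ _ _.
  + by apply: hg => i; rewrite ge_min le_max lexx.
  + apply: hg => i; rewrite a'E; case: eqP => [->|_]; last by rewrite ge_min le_max lexx.
    move: abj; set x := a 0 j; set y := b 0 j => xy.
    by case: ifP => hxy; rewrite ge_min le_max; lia.
  + by exists j; rewrite /a'; case: ifP; [left|right].
Qed.

End LatticeWalks.

Lemma lattice_ball (d : nat) (y : point d) (W : nat) : exists s : seq (point d),
  size s = ((2 * W).+1 ^ d)%N /\
  forall z : point d, (forall j, `|(z - y) 0 j| <= W%:Z) -> z \in s.
Proof.
exists [seq y + (\row_j (val (f j))%:Z - const_mx W%:Z) | f : {ffun 'I_d -> 'I_(2 * W).+1}].
split; first by rewrite size_image card_ffun !card_ord.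
move=> z hz; pose f : {ffun 'I_d -> 'I_(2 * W).+1} :=
  [ffun j => inord (absz ((z - y) 0 j + W%:Z))].
apply/mapP; exists f; first by rewrite mem_enum.
apply/rowP => j; rewrite !mxE ffunE; have := hz j; rewrite !mxE.
set a := z 0 j; set b := y 0 j => hab.
have lt : (absz (a - b + W%:Z)%R < (2 * W).+1)%N by lia.
by rewrite /= (inordK lt); lia.
Qed.

(** * A block of edges that meets every cut *)

Section BlockedEdges.
Variable k : nat.
Let d := k.+1.
(* From each of two points at heights about +-axis_height next to the centre of
   a lateral face, a lattice line leaves the cylinder at a point of the source
   (sink); followed inwards for inward_steps steps, the two lines reach points
   joined by a box lying inside the cylinder. All these edges are within
   block_radius of the starting point. *)
Definition axis_height : nat := (d * d + d + 2)%N.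
Definition inward_steps : nat := (d * d * (2 * axis_height + 2))%N.
Definition block_radius : nat := (inward_steps + 2 * axis_height + 1)%N.
Definition block_size : nat := ((2 * block_radius).+1 ^ d * d)%N.

Variables (R : realType) (u : 'I_k -> vecR R d) (v : vecR R d).
Hypotheses (ou : Defs.orthonormal (d := d) u) (uv : unit_normal (d := d) u v).
Variables (l : 'I_k -> R) (l_gt0 : forall i, 0 < l i) (i0 : 'I_k).

Let uu i : dotR (u i) (u i) = 1. Proof. by rewrite ou eqxx. Qed.
Let vv : dotR v v = 1. Proof. exact: uv.1. Qed.
Let D : R := d%:R.
Let r := axis_height.
Let m := inward_steps.
Let W := block_radius.

Lemma lattice_floor_sub (x y : vecR R d) j (M : nat) : `|x 0 j - y 0 j| <= M%:R ->
  `|(lattice_floor x - lattice_floor y) 0 j| <= (M + 1)%:Z.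
Proof.
have := lattice_floor_itv x j; have := lattice_floor_itv y j.
move: (lattice_floor x) (lattice_floor y) => P Q; rewrite !mxE.
have eM : (M + 1)%:Z%:~R = M%:R + 1 :> R by rewrite -pmulrn natrD.
rewrite -(ler_int R) intr_norm eM intrD intrN.
set p := (P 0 j)%:~R; set q := (Q 0 j)%:~R.
by rewrite !ler_norml => /andP[? ?] /andP[? ?] /andP[? ?]; apply/andP; split; lra.
Qed.

(** Entries are at most 1 in absolute value, so their squares are no larger than they are; if all
    were below 1/d, the squares could not add up to 1. *)
Lemma large_coordinate (w : vecR R d) : dotR w w = 1 -> exists j, D^-1 <= `|w 0 j|.
Proof.
move=> ww; apply: contrapT => h.
have D0 : 0 < D by [].
have lt j : w 0 j * w 0 j < D^-1.
  have hj : `|w 0 j| < D^-1 by rewrite ltNge; apply/negP => hj; apply: h; exists j.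
  have := unit_coord_le1 j ww; have n0 := normr_ge0 (w 0 j).
  rewrite -expr2 -real_normK ?num_real// expr2 => h1.
  by apply: le_lt_trans hj; rewrite -[leRHS]mulr1 ler_wpM2l.
move: ww; rewrite dotRE => /eqP; rewrite lt_eqF//.
have -> : 1 = \sum_(j < d) D^-1.
  by rewrite sumr_const card_ord -[RHS]mulr_natl divff// gt_eqF.
by apply: ltr_sum => //; apply/hasP; exists ord0; rewrite ?mem_index_enum.
Qed.

(** A lattice step has to replace [u i0]: a signed coordinate vector still gains 1/d away from the
    face. *)
Lemma inward_step : exists s : point d,
  [/\ forall a, nneighbour a (a + s), forall a, nneighbour a (a - s),
      D^-1 <= dotR (u i0) (zr R s) & forall j, `|s 0 j| <= 1].
Proof.
have [j hj] := large_coordinate (uu i0).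
have bnd (b : bool) i : `|(if b then unitv j else - unitv j : point d) 0 i| <= 1.
  by case: b; rewrite !mxE ?normrN; case: eqP => _; case: eqP.
have nnp b (a : point d) : nneighbour a (a + (if b then unitv j else - unitv j)).
  by exists j; case: b; [left|right].
have [p|n] := leP 0 (u i0 0 j).
  exists (unitv j); split; [exact: (nnp true)| | |exact: (bnd true)].
    by move=> a; exact: (nnp false).
  by rewrite dotR_unitv -(ger0_norm p).
exists (- unitv j); split; [exact: (nnp false)| | |exact: (bnd false)].
  by move=> a; rewrite opprK; exact: (nnp true).
by rewrite zrN dotRNr dotR_unitv -(ltr0_norm n).
Qed.

(** If a cut avoided [Q], the vertices reached from the sources would be closed under good steps of
    the block, and a path of such steps joins a source to a sink. The size of the block involves [d]
    only, so the constant of the exponential case does not depend on the box. *)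
Lemma cuts_meet_block : exists (n0 : nat) (h0 : R), forall n h (c : vecR R d),
  (n0 <= n)%N -> h0 <= h -> exists Q : seq (edge d),
    [/\ uniq Q, (size Q <= block_size)%N &
     forall E, (forall e, e \in Q -> e \notin E) ->
      ~ is_cut (cyl (hrect (d := d) c u (fun i => n%:R * l i)) v h)
         (boundary_part (cyl1 (hrect (d := d) c u (fun i => n%:R * l i)) v h)
           (cyl (hrect (d := d) c u (fun i => n%:R * l i)) v h))
         (boundary_part (cyl2 (hrect (d := d) c u (fun i => n%:R * l i)) v h)
           (cyl (hrect (d := d) c u (fun i => n%:R * l i)) v h)) E].
Proof.
have ia1 (a : nat) (j : int) : j <= a%:Z -> j + (absz (a%:Z - j)%R)%:Z = a%:Z by lia.
have ia2 (q a i : nat) (j : int) : - q%:Z <= j -> (q + 1 <= a)%N -> j <= a%:Z ->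
  (i <= absz (a%:Z - j)%R)%N -> `|j + i%:Z| <= a%:Z by lia.
have ia3 (a b : nat) (x y z : int) : `|x| <= a%:Z -> `|y - z| <= (2 * b + 1)%:Z ->
  `|y + x - z| <= (a + 2 * b + 1)%:Z by lia.
have ia4 (q : nat) (j : int) : - q%:Z <= j -> j <= (q + 1)%:Z -> `|j| <= (q + 1)%:Z by lia.
have ia5 (M : nat) (a b q z : int) : Num.min (a + q) (b + q) <= z <= Num.max (a + q) (b + q) ->
  `|b - a| <= M%:Z -> `|z - (a + q)| <= M%:Z.
  by rewrite ge_min le_max => /andP[/orP[] ? /orP[] ?]; lia.
have ia6 (e f : nat) (a q z : int) : `|z - (a + q)| <= (2 * f + 1)%:Z -> `|q| <= e%:Z ->
  `|z - a| <= (e + 2 * f + 1)%:Z by lia.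
have D1 : 1 <= D by rewrite ler1n.
pose T : R := D * W%:R + D.
have T0 : 0 <= T by rewrite addr_ge0 ?mulr_ge0//; lra.
exists (\max_i (Num.truncn (2 * T / l i)).+1)%N, (r%:R + T) => n h c hn hh.
have nl i : 2 * T <= n%:R * l i.
  rewrite -ler_pdivrMr// ltW//; apply: lt_le_trans (truncnS_gt _) _.
  by rewrite ler_nat (leq_trans _ hn)//; exact: leq_bigmax.
have [s [nns nns' kap_ge s1]] := inward_step.
pose kap := dotR (u i0) (zr R s).
have kap0 : 0 < kap by apply: lt_le_trans kap_ge; rewrite invr_gt0; lra.
(* The point of height [e] on the face where coordinate [i0] vanishes, centred in the other base
   directions. *)
pose b0 (e : R) := c + (\sum_i (if i == i0 then 0 else n%:R * l i / 2) *: u i + e *: v).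
pose yp := lattice_floor (b0 r%:R); pose ym := lattice_floor (b0 (- r%:R)).
pose al i (x : point d) := dotR (u i) (zr R x - c).
pose be (x : point d) := dotR v (zr R x - c).
have ypm (e : R) i : `|al i (lattice_floor (b0 e)) - (if i == i0 then 0 else n%:R * l i / 2)| <= D.
  have := lattice_floor_dot (b0 e) (uu i).
  by rewrite /b0 dotRDr (dotR_frame_u ou uv) /al dotRBr opprD addrA.
have ypb (e : R) : `|be (lattice_floor (b0 e)) - e| <= D.
  have := lattice_floor_dot (b0 e) vv.
  by rewrite /b0 dotRDr (dotR_frame_v uv) /be dotRBr opprD addrA.
pose near (z : point d) := forall j, `|(z - yp) 0 j| <= W%:Z.
have dist (z z' : point d) (M : nat) (w : vecR R d) : dotR w w = 1 ->
    (forall j, `|(z - z') 0 j| <= M%:Z) ->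
    `|dotR w (zr R z - c) - dotR w (zr R z' - c)| <= D * M%:R.
  move=> ww hz; rewrite -dotRBr opprB addrA subrK -zrB; apply: dotR_le_sup => // j.
  by rewrite !mxE -intr_norm -[M%:R]/(M%:Z%:~R) ler_int; have := hz j; rewrite !mxE.
(* In the block the other constraints of the cylinder are automatic, [n] and [h] being large; only
   the side of the face [i0] remains. *)
pose good (z : point d) := near z /\ 0 <= al i0 z.
have near_cyl z : near z -> 0 <= al i0 z -> incyl u v c (fun i => n%:R * l i) h (zr R z).
  move=> nz az; have bz := dist z yp W v vv nz; have azi i := dist z yp W _ (uu i) nz.
  apply/incylP; split => [i|]; [rewrite -/(al i z)|rewrite -/(be z)].
    have := ypm r%:R i; have := azi i; rewrite -/(al i z) -/(al i yp) !ler_norml.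
    have := nl i; rewrite /T; case: eqP => [->|_] ? /andP[? ?] /andP[? ?].
      by rewrite az /=; have := T0; rewrite /T; lra.
    by apply/andP; split; lra.
  have := ypb r%:R; move: bz hh; rewrite /T -/(be z) -/(be yp) !ler_norml.
  by have r0 : 0 <= r%:R :> R by []; move=> /andP[? ?] ? /andP[? ?]; apply/andP; split; lra.
have [ball [sball hball]] := lattice_ball yp W.
exists (undup [seq (x, i) | x <- ball, i <- enum 'I_d]); split.
- exact: undup_uniq.
- apply: leq_trans (size_undup _) _.
  by rewrite size_allpairs sball -cardE card_ord.
move=> E hE [uE [CE nC]].
(* [axis_height] exceeds by 1 the change of height [D * D + D + 1] allowed up to the exit point, so
   the source stays above height 0 and the sink below. *)
have rE : r%:R = D * D + D + 2 by rewrite /r /axis_height !natrD natrM.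
have mE : m%:R = D * D * (2 * r%:R + 2) by rewrite /m /inward_steps !natrM natrD natrM.
have dm : (d * d + 1 <= m)%N.
  rewrite /m /inward_steps (@leq_trans (d * d * 2))%N//; last by rewrite leq_mul2l; lia.
  by rewrite muln2 -addnn leq_add2l.
have vs1 : `|dotR v (zr R s)| <= 1.
  have := nneighbour_dot c vv (nns 0); rewrite -dotRBr opprB addrA subrK -zrB.
  by rewrite add0r subr0.
have zrZ (j : int) (x : point d) : zr R (j *: x) = j%:~R *: zr R x.
  by apply/rowP => i; rewrite !mxE intrM.
have al_line (y : point d) (j : int) : al i0 (y + j *: s) = al i0 y + j%:~R * kap.
  by rewrite /al zrD zrZ addrAC [LHS]dotRDr dotRZr.
have exit (e : R) (y : point d) : y = lattice_floor (b0 e) ->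
    (forall j, `|(y - yp) 0 j| <= (2 * r + 1)%:Z) ->
    exists (x : point d) (J : nat), [/\ x + s *+ J = y + s *+ m,
      forall i, (i <= J)%N -> good (x + s *+ i),
      ~~ incyl u v c (fun i => n%:R * l i) h (zr R (x - s)) &
      `|be x - e| <= D * D + D + 1].
  move=> yE yyp; have ya : `|al i0 y| <= D by have := ypm e i0; rewrite eqxx subr0 yE.
  have yb : `|be y - e| <= D by rewrite yE.
  (* Index, possibly negative, of the first point of the line on the inner side of the face. As [y]
     is within [D] of the face and a step gains at least [D^-1], it is between [- d * d] and
     [d * d + 1]. *)
  pose j0 := Num.ceil (- al i0 y / kap).
  have ratio : `|- al i0 y / kap| <= D * D.
    rewrite normrM normrN normfV (gtr0_norm kap0) ler_pdivrMr//.
    apply: le_trans ya _; rewrite -mulrA -[leLHS]mulr1 ler_wpM2l//.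
    by rewrite -ler_pdivrMl ?mulr1// ltr0n.
  have /andP[j01 j02] := ceil_itv (- al i0 y / kap).
  have j0lo : - (d * d)%:Z <= j0.
    rewrite -(ler_int R) intrN -pmulrn natrM (le_trans _ j02)//.
    by move: ratio; rewrite ler_norml => /andP[].
  have j0hi : j0 <= (d * d + 1)%:Z.
    rewrite -(ler_int R) -pmulrn natrD natrM.
    move: ratio j01; rewrite ler_norml intrB => /andP[_ h1] h2.
    by rewrite -/D; rewrite -/j0 in h2; lra.
  have j0m : j0 <= m%:Z by rewrite (le_trans j0hi)// lez_nat.
  exists (y + j0 *: s), (absz (m%:Z - j0)).
  have lineE (i : nat) : y + j0 *: s + s *+ i = y + (j0 + i%:Z) *: s.
    by rewrite scalerDl -[i%:Z]natz scaler_nat addrA.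
  split.
  - by rewrite lineE -[s *+ m]scaler_nat natz; congr (_ + _ *: _); exact: ia1.
  - move=> i hi; rewrite lineE; split.
      move=> j; have := yyp j; have := s1 j; rewrite !mxE.
      set sj := s 0 j; set yj := y 0 j; set ypj := yp 0 j => h1 h2.
      have hj : `|j0 + i%:Z| <= m%:Z by exact: (ia2 _ _ _ _ j0lo dm j0m hi).
      have : `|(j0 + i%:Z) * sj| <= m%:Z.
        by rewrite normrM -[m%:Z]mulr1 ler_pM.
      by move=> h3; exact: (ia3 _ _ _ _ _ h3 h2).
    rewrite al_line intrD mulrDl addrA.
    have : - al i0 y <= j0%:~R * kap by rewrite -ler_pdivrMr.
    have : 0 <= i%:Z%:~R * kap by rewrite mulr_ge0 ?(ltW kap0)// ler0z.
    lra.
  - have : al i0 (y + j0 *: s - s) < 0.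
      have -> : y + j0 *: s - s = y + (j0 - 1) *: s by rewrite scalerBl scale1r addrA.
      rewrite al_line; have : (j0 - 1)%:~R * kap < - al i0 y by rewrite -ltr_pdivlMr.
      lra.
    by move=> neg; apply/negP => /incylP[/(_ i0)/andP[pos _] _]; move: neg; rewrite /al; lra.
  - have -> : be (y + j0 *: s) = be y + j0%:~R * dotR v (zr R s).
      by rewrite /be zrD zrZ addrAC [LHS]dotRDr dotRZr.
    have : `|j0%:~R * dotR v (zr R s)| <= D * D + 1.
      rewrite normrM -[leRHS]mulr1 ler_pM//.
      rewrite -intr_norm; apply: (@le_trans _ _ ((d * d + 1)%:Z%:~R)).
        by rewrite ler_int; exact: (ia4 _ _ j0lo j0hi).
      by rewrite -pmulrn natrD natrM.
    by move: yb; rewrite !ler_norml => /andP[? ?] /andP[? ?]; apply/andP; split; lra.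
have ypp j : `|(yp - yp) 0 j| <= (2 * r + 1)%:Z by rewrite subrr mxE normr0.
have ymp j : `|(ym - yp) 0 j| <= (2 * r + 1)%:Z.
  have bd : b0 (- r%:R) 0 j - b0 r%:R 0 j = - (2 * r%:R) * v 0 j.
    by rewrite /b0; set S := \sum_i _; rewrite !mxE; ring.
  apply: lattice_floor_sub; rewrite bd normrM -[leRHS]mulr1; apply: ler_pM => //.
    by rewrite normrN natrM ger0_norm ?mulr_ge0.
  exact: unit_coord_le1.
have [xp [Jp [xpE gp outp bp]]] := exit _ _ (erefl yp) ypp.
have [xm [Jm [xmE gm outm bm]]] := exit _ _ (erefl ym) ymp.
have good_cyl x : good x -> incyl u v c (fun i => n%:R * l i) h (zr R x).
  by move=> [? ?]; exact: near_cyl.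
have F1xp : boundary_part (cyl1 (hrect (d := d) c u (fun i => n%:R * l i)) v h)
    (cyl (hrect (d := d) c u (fun i => n%:R * l i)) v h) xp.
  apply/(boundary1P ou uv); split.
  - by apply: good_cyl; have := gp 0%N (leq0n _); rewrite mulr0n addr0.
  - by move: bp; rewrite rE -/(be xp) ler_norml => /andP[? ?]; lra.
  - by exists (xp - s).
have F2xm : boundary_part (cyl2 (hrect (d := d) c u (fun i => n%:R * l i)) v h)
    (cyl (hrect (d := d) c u (fun i => n%:R * l i)) v h) xm.
  apply/(boundary2P ou uv); split.
  - by apply: good_cyl; have := gm 0%N (leq0n _); rewrite mulr0n addr0.
  - by move: bm; rewrite rE -/(be xm) ler_norml => /andP[? ?]; lra.
  - by exists (xm - s).
pose S := reach (cyl (hrect (d := d) c u (fun i => n%:R * l i)) v h)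
  (boundary_part (cyl1 (hrect (d := d) c u (fun i => n%:R * l i)) v h)
    (cyl (hrect (d := d) c u (fun i => n%:R * l i)) v h)) E.
have notE x i : near x -> (x, i) \notin E.
  move=> nx; apply: hE; rewrite mem_undup; apply/allpairsP; exists (x, i).
  by split => //=; [exact: hball|rewrite mem_enum].
have step a b : S a -> good a -> good b -> nneighbour a b -> S b.
  move=> Sa ga gb [i [bE|bE]].
    apply: (reach_step Sa (e := (a, i))); [|exact: notE ga.1|by left].
    by apply/(edge_in_cylP ou uv); rewrite /head_pt /= -bE !good_cyl.
  have aE : a = b + unitv i by rewrite bE subrK.
  apply: (reach_step Sa (e := (b, i))); [|exact: notE gb.1|by right].
  by apply/(edge_in_cylP ou uv); rewrite /head_pt /= -aE !good_cyl.
have Sqp : S (yp + s *+ m).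
  by rewrite -xpE; apply/(line_closed step nns gp); exact: reach_refl.
have addE (p q : point d) j : (p + q) 0 j = p 0 j + q 0 j by rewrite mxE.
have subE (p q : point d) j : (p - q) 0 j = p 0 j - q 0 j by rewrite !mxE.
have Sqm : S (ym + s *+ m).
  apply: (box_closed step _ Sqp) => z hz.
  have zW j : `|(z - (yp + s *+ m)) 0 j| <= (2 * r + 1)%:Z.
    rewrite subE addE; apply: (ia5 _ _ (ym 0 j)); last by rewrite -subE.
    by have := hz j; rewrite !addE.
  split.
    move=> j; rewrite subE; have := zW j; rewrite subE addE => /ia6; apply.
    have -> : (s *+ m) 0 j = m%:Z * s 0 j by rewrite -scaler_nat mxE natz.
    by rewrite normrM -[leRHS]mulr1; apply: ler_pM.
  have := dist z (yp + s *+ m) (2 * r + 1)%N _ (uu i0) zW.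
  have := ypm r%:R i0; rewrite eqxx subr0 -/yp.
  rewrite -/(al i0 z) -/(al i0 (yp + s *+ m)) -[s *+ m]scaler_nat natz al_line -pmulrn.
  (* The depth gained by [m] steps: [D * (2 * r + 1)] covers the extent of the box and [D] the
     rounding of [yp]. *)
  have : D * (2 * r%:R + 2) <= m%:R * kap.
    have D0 : 0 < D by rewrite ltr0n.
    have -> : D * (2 * r%:R + 2) = m%:R * D^-1.
      by rewrite mE -[D * D * _]mulrA [D * (D * _)]mulrC mulfK ?gt_eqF.
    by rewrite ler_wpM2l.
  rewrite !ler_norml natrD natrM => ? /andP[? ?] /andP[? ?]; lra.
have Sxm : S xm by apply/(line_closed step nns gm); rewrite xmE.
by apply: nC; have [x0 [p [h1 h2 h3]]] := Sxm; exists x0, p; rewrite h2.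
Qed.

End BlockedEdges.

(** * Scaled cylinders and the exponential lower bound *)

Section FlowOfScaledCylinder.
Variables (R : realType) (k : nat).
Let d := k.+1.
Variables (u : 'I_k -> vecR R d) (v : vecR R d).
Hypotheses (ou : Defs.orthonormal (d := d) u) (uv : unit_normal (d := d) u v).

Lemma tau_cylflow n (c : vecR R d) (l : 'I_k -> R) (h : R) (y : edge d -> R) :
  (0 < n)%N -> tau (scale n (hrect (d := d) c u l)) v h y =
    cylflow u v (n%:R *: c) (fun i => n%:R * l i) h y.
Proof. by move=> n0; rewrite /tau scale_hrect. Qed.

Variables (dO : measure_display) (Omega : measurableType dO) (P : probability Omega R).
Variable t : edge d -> Omega -> R.

Lemma measurable_flow_ge (c : vecR R d) (L : 'I_k -> R) (h x : R) :
  (forall e, measurable_fun setT (t e)) ->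
  measurable [set w | x <= cylflow u v c L h (fun e => t e w)].
Proof.
move=> mt; have mf : measurable_fun setT (fun w => cylflow u v c L h (fun e => t e w)).
  apply: (measurableT_comp (measurable_cylflow ou uv c L h)).
  exact: measurable_to_config.
have := mf measurableT _ (measurable_itv `[x, +oo[).
by rewrite setTI set_interval.set_itvE.
Qed.

End FlowOfScaledCylinder.

(** By independence all edges of [Q] exceed [x] with probability [expR (- x) ^+ size Q], and then
    every cut costs at least [x]. The thresholds are chosen before the probability space because
    they depend on the geometry alone. *)
Lemma flow_ge_exponential (R : realType) (k : nat) (u : 'I_k -> vecR R k.+1)
    (v : vecR R k.+1) (l : 'I_k -> R) (i0 : 'I_k) :
  Defs.orthonormal (d := k.+1) u -> unit_normal (d := k.+1) u v -> (forall i, 0 < l i) ->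
  exists (n0 : nat) (h0 : R), forall dO (Omega : measurableType dO)
    (P : probability Omega R) (t : edge k.+1 -> Omega -> R),
    iid_capacities P t (@exp_cdf R) -> forall n h (c : vecR R k.+1) (x : R),
    (n0 <= n)%N -> h0 <= h -> 0 <= x ->
    ((expR (- ((block_size k)%:R * x)))%:E <=
      P [set w | (x <= cylflow u v c (fun i => n%:R * l i) h (fun e => t e w))%R])%E.
Proof.
move=> ou uv l0.
have [n0 [h0 H]] := cuts_meet_block ou uv l0 i0; exists n0, h0.
move=> dO Omega P t iidt n h c x hn hh x0; have [mt [cdft [_ indep]]] := iidt.
have [Q [uQ sQ hQ]] := H n h c hn hh.
pose A' := [set w | forall e, e \in Q -> `]x, +oo[%classic (t e w)].
have mA' : measurable A'.
  have := measurable_to_config mt measurableT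
    (measurable_config_box Q (fun _ => measurable_itv `]x, +oo[)).
  by rewrite setTI.
have tail e : fine (P (t e @^-1` `]x, +oo[)) = expR (- x).
  have mle : measurable [set w | t e w <= x] by exact: measurable_sublevel.
  have -> : t e @^-1` `]x, +oo[ = ~` [set w | t e w <= x].
    apply/seteqP; split => w /=; rewrite in_itv/= andbT ltNge; first by move=> /negP.
    by move=> /negP.
  rewrite probability_setC// cdft /exp_cdf ltNge x0 /=; lra.
have PA' : P A' = (expR (- x) ^+ size Q)%:E.
  rewrite -[LHS]fineK; last by rewrite fin_num_measure.
  rewrite (indep Q (fun=> `]x, +oo[%classic))//; congr EFin.
  under eq_bigr do rewrite tail.
  by rewrite big_const_seq count_predT iter_mulr_1.
apply: (@le_trans _ _ (P A')).
  rewrite PA' lee_fin -expRM_natl ler_expR mulrN lerN2 ler_wpM2r// ler_nat//.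
apply: (le_probability_ae mA' _ (capacities_ge0_ae iidt)).
  exact: measurable_flow_ge.
move=> w [A'w nAw] /=; apply: contrapT => h1; apply: nAw => /=.
have [s hs] := cyl_edges ou uv c (fun i => n%:R * l i) h.
apply: (maxflow_ge (Q := Q)) hs _ hQ _.
- by move=> e; rewrite leNgt; apply/negP => te; apply: h1; exists e.
- by move=> z; exact: boundary_disjoint.
- by move=> e /A'w; rewrite /= in_itv/= andbT => /ltW.
Qed.


(** * Limits and logarithms of probabilities *)

Section LimitsAndLogs.
Variable R : realType.

Lemma elog_le (p : \bar R) (x : R) : (0 <= p)%E -> (p <= (expR x)%:E)%E ->
  (elog p <= x%:E)%E.
Proof.
move=> p0 px; rewrite /elog; case: eqP => [_|/eqP pn0]; first by rewrite leNye.
have pfin : p \is a fin_num by rewrite fin_numE; apply/andP; split; apply/eqP => pE;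
  move: p0 px; rewrite pE ?leye_eq ?leeNy_eq.
have pE : p = (fine p)%:E by rewrite fineK.
have fp0 : 0 < fine p by rewrite lt_neqAle -lee_fin -pE p0 andbT eq_sym -eqe -pE.
rewrite lee_fin -[x]expRK ler_ln ?posrE ?expR_gt0//.
by rewrite -lee_fin -pE.
Qed.

Lemma limn_einf_ge (f : nat -> \bar R) (b : \bar R) (N : nat) :
  (forall n, (N <= n)%N -> (b <= f n)%E) -> (b <= limn_einf f)%E.
Proof.
move=> H; have hN : (b <= einfs f N)%E.
  by apply: le_ereal_inf_tmp => _ [m /= nm <-]; exact: H.
apply: le_trans hN _; rewrite limn_einf_lim.
have -> : limn (einfs f) = ereal_sup (range (einfs f)).
  exact: cvg_lim (@cvg_einfs_sup R f).
by apply: ereal_sup_ubound; exists N.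
Qed.

Lemma cvg_pinfty_eventually (h : nat -> R) (A : R) : h @ \oo --> +oo ->
  exists N, forall n, (N <= n)%N -> A <= h n.
Proof.
by move=> /cvgryPge/(_ A)[N _ hN]; exists N => n Nn; exact: hN.
Qed.

End LimitsAndLogs.

(** * Passing to clipped capacities *)

Section Clipping.
Variables (R : realType) (k : nat).
Let d := k.+1.
Variables (u : 'I_k -> vecR R d) (v : vecR R d).
Hypotheses (ou : Defs.orthonormal (d := d) u) (uv : unit_normal (d := d) u v).
Variables (l : 'I_k -> R) (l_gt0 : forall i, 0 < l i).
Variables (dO : measure_display) (Omega : measurableType dO) (P : probability Omega R).
Variables (t t' : edge d -> Omega -> R).
Hypotheses (mt : forall e, measurable_fun setT (t e))
  (mt' : forall e, measurable_fun setT (t' e)) (t'0 : forall e w, 0 <= t' e w)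
  (tt' : P.-negligible [set w | exists e, t e w != t' e w]).

Let agree w : ~ (exists e, t e w != t' e w) -> (fun e => t e w) = (fun e => t' e w).
Proof.
move=> h; apply/funext => e; apply/eqP/negPn/negP => hn; apply: h; by exists e.
Qed.

Let area (n : nat) : R := n%:R ^+ k * \prod_i l i.

Lemma flow_ge_clip (c : vecR R d) (L : 'I_k -> R) (h x : R) :
  (P [set w | (x <= cylflow u v c L h (fun e => t e w))%R] <=
   P [set w | (x <= cylflow u v c L h (fun e => t' e w))%R])%E.
Proof.
apply: (le_probability_ae _ _ tt'); [exact: measurable_flow_ge|exact: measurable_flow_ge|].
move=> w [/= h1 h2]; apply: contrapT => /agree h3; apply: h2.
by rewrite -h3.
Qed.

(** The convergence defining [nu] is used for the box at the origin with heights equal to [n]; being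
    in L1, it bounds the mean flow of a tile. Were [nu] negative, the deviation would always be at
    least [- nu]. *)
Lemma flow_constant_tiles (nu : R) : is_flow_constant P t v nu ->
  0 <= nu /\ forall (eps : R) (p0 : nat), 0 < eps -> exists2 p : nat, (p0 <= p)%N &
    (\int[P]_w (cylflow u v 0 (fun i => p%:R * l i) p%:R (fun e => t' e w))%:E
       <= (area p * (nu + eps))%:E)%E.
Proof.
move=> hnu.
pose X (p : nat) w := cylflow u v 0 (fun i => p%:R * l i) p%:R (fun e => t' e w).
have mX p : measurable_fun setT (X p).
  apply: (measurableT_comp (measurable_cylflow ou uv 0 (fun i => p%:R * l i) p%:R)).
  exact: measurable_to_config.
have X0 p w : 0 <= X p w by exact: cylflow_ge0.
have mdev p : measurable_fun setT (fun w => `|X p w / area p - nu|).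
  apply: measurableT_comp; first exact: normr_measurable.
  by apply: measurable_funB => //; exact: measurable_funM.
have hint : forall eps : R, 0 < eps -> exists N, forall p, (N <= p)%N -> (0 < p)%N ->
    (\int[P]_w (`|X p w / area p - nu|)%:E <= eps%:E)%E.
  move=> eps eps0.
  have := hnu 0 u l (fun n => n%:R) (conj ou l_gt0) uv.2 (fun n => ler0n _ _) cvgr_idn.
  move=> /(_ [set x | (x < eps%:E)%E])[].
    by apply: open_nbhs_nbhs; split; [exact: open_ereal_lt_ereal|rewrite /= lte_fin].
  move=> N _ hN; exists N => p Np p_gt0; apply: le_trans (ltW (hN p Np)).
  rewrite le_eqVlt; apply/orP; left; apply/eqP.
  have areaE : hrect_area (d := d) p l = area p by [].
  under [RHS]eq_integral do rewrite tau_cylflow// scaler0 areaE.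
  apply: ge0_ae_eq_integral => //.
  - exact/measurable_EFinP.
  - apply/measurable_EFinP; apply: measurableT_comp; first exact: normr_measurable.
    apply: measurable_funB => //; apply: measurable_funM => //.
    apply: (measurableT_comp (measurable_cylflow ou uv 0 (fun i => p%:R * l i) p%:R)).
    exact: measurable_to_config.
  - by apply: negligibleS tt' => w /= h; apply: contrapT => /agree h3; apply: h => _;
      rewrite /X h3.
have area0 p : (0 < p)%N -> 0 < area p.
  by move=> p0; rewrite mulr_gt0 ?exprn_gt0 ?ltr0n// prodr_gt0.
have nu0 : 0 <= nu.
  rewrite leNgt; apply/negP => nun.
  have [|N hN] := hint (- nu / 2); first by rewrite divr_gt0// oppr_gt0.
  have := hN N.+1 (leqnSn N) isT.
  have : (\int[P]_w (- nu)%:E <= \int[P]_w (`|X N.+1 w / area N.+1 - nu|)%:E)%E.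
    apply: integral_EFin_le => // w; first by rewrite oppr_ge0 ltW.
    apply: le_trans (ler_norm _); rewrite lerDr.
    by rewrite divr_ge0// ltW// area0.
  rewrite integral_cst// [X in (_ * X)%E](@probability_setT _ _ _ P) mule1 => h1 h2.
  by have := le_trans h1 h2; rewrite lee_fin; lra.
split=> // eps p0 eps0; have [N hN] := hint eps eps0.
exists (maxn p0 (maxn N 1)); first exact: leq_maxl.
set p := maxn p0 _.
have Np : (N <= p)%N by rewrite /p !leq_max leqnn orbT.
have p1 : (0 < p)%N by rewrite /p !leq_max !orbT.
have a0 := area0 p p1.
have one : (\int[P]_w 1%:E <= 1%:E)%E.
  by rewrite integral_cst// mul1e [leLHS](@probability_setT _ _ _ P).
have := @integral_EFin_lin_le R _ _ P (fun w => `|X p w / area p - nu|) (fun=> 1)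
  (area p) (area p * nu) eps 1 (mdev p) (measurable_cst _) (fun w => normr_ge0 _)
  (fun w => ler01) (ltW a0) (mulr_ge0 (ltW a0) nu0) (hN p Np p1) one.
rewrite mulr1 -mulrDr [eps + nu]addrC; apply: le_trans.
apply: integral_EFin_le; [exact: mX| |exact: X0|move=> w].
  by apply: measurable_funD; apply: measurable_funM.
have := ler_norm (X p w / area p - nu) => h1.
have := ler_wpM2l (ltW a0) h1; rewrite mulrBr mulrCA divff ?gt_eqF// mulr1 -/(X p w).
lra.
Qed.

End Clipping.

(** * The two upper bounds *)

Section Parts.
Variables (R : realType) (k : nat) (k_gt0 : (0 < k)%N).
Let d := k.+1.
Variables (u : 'I_k -> vecR R d) (v : vecR R d).
Hypotheses (ou : Defs.orthonormal (d := d) u) (uv : unit_normal (d := d) u v).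
Variables (l : 'I_k -> R) (l_gt0 : forall i, 0 < l i).
Variables (c : vecR R d) (h : nat -> R) (hcvg : h @ \oo --> +oo).
Variables (dO : measure_display) (Omega : measurableType dO) (P : probability Omega R).
Variables (t : edge d -> Omega -> R) (F : R -> R) (iidt : iid_capacities P t F).
Variables (nu : R) (hnu : is_flow_constant P t v nu).

Let area (n : nat) : R := n%:R ^+ k * \prod_i l i.

Lemma hrect_area_gt0 n : (0 < n)%N -> 0 < area n.
Proof. by move=> n0; rewrite mulr_gt0 ?exprn_gt0 ?ltr0n// prodr_gt0. Qed.

Lemma tail_eventE n (lam : R) : (0 < n)%N ->
  [set w | lam <= tau (scale n (hrect (d := d) c u l)) v (h n) (fun e => t e w)
                  / hrect_area (d := d) n l] =
  [set w | lam * area n <= cylflow u v (n%:R *: c) (fun i => n%:R * l i) (h n)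
                             (fun e => t e w)].
Proof.
move=> n0; have a0 := hrect_area_gt0 n0.
by apply/seteqP; split => w /=; rewrite tau_cylflow// ler_pdivlMr.
Qed.

Let e0 : edge d := (0, ord0).

Lemma bounded_rate (M lam : R) : F M = 1 -> nu < lam ->
  (0 < limn_einf (fun n : nat =>
         (- (hrect_area (d := d) n l * Num.min (h n) n%:R)^-1)%R%:E *
         elog (P [set w | (lam <=
            tau (scale n (hrect (d := d) c u l)) v (h n) (fun e => t e w)
              / hrect_area (d := d) n l)%R])))%E.
Proof.
move=> FM nulam.
(* A positive level above [M], so that clipping changes capacities only on a null event. *)
pose M' := Num.max M 0 + 1.
have M'0 : 0 < M' by rewrite ltr_wpDl// le_max lexx orbT.
have MM' : M <= M' by rewrite /M' ler_wpDr// le_max lexx.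
pose phi x : R := Num.min (Num.max 0 x) M'.
have mphi : measurable_fun setT phi.
  by apply: measurable_minr => //; apply: measurable_maxr.
pose t' e w := phi (t e w).
have ht' : iid_law P t' _ := iid_law_map mphi (capacities_iid_law iidt e0).
have t'0 e w : 0 <= t' e w by rewrite le_min le_max lexx/= ltW.
have t'M e w : t' e w <= M' by rewrite ge_min lexx orbT.
have tt' : P.-negligible [set w | exists e, t e w != t' e w].
  apply: (negligibleS _ (negligibleU (capacities_ge0_ae iidt) (capacities_bounded_ae iidt FM))).
  move=> w /= [e he]; have [?|te0] := ltP (t e w) 0; first by left; exists e.
  right; exists e; rewrite ltNge; apply/negP => teM; move/eqP: he; apply.
  by rewrite /t' /phi (max_r te0) min_l// (le_trans teM).
have [nu0 tiles] := flow_constant_tiles ou uv l_gt0 iidt.1 ht'.1 t'0 tt' hnu.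
have moments : forall th : R, 0 < th -> exists2 B : R, 1 <= B &
    forall e, (\int[P]_o (expR (th * t' e o))%:E <= B%:E)%E.
  move=> th th0; exists (expR (th * M')).
    by rewrite -expR0 ler_expR mulr_ge0// ltW.
  move=> e; apply: (@le_trans _ _ (\int[P]_o (expR (th * M'))%:E)%E).
    apply: integral_EFin_le => //.
    - apply: measurableT_comp; first exact: measurable_expR.
      by apply: measurable_funM => //; exact: ht'.1.
    - by move=> w; rewrite ler_expR ler_pM2l.
  by rewrite integral_cst// [X in (_ * X)%E](@probability_setT _ _ _ P) mule1.
have [kap [eta [n1 [kap0 eta0 H]]]] := flow_tail_bounded ou uv l_gt0 k_gt0
  ht' t'0 moments nu0 tiles M'0 t'M nulam.
have [N hN] := cvg_pinfty_eventually (2 / kap) hcvg.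
(* For such [n], [kap * mn >= 2], so its integer part [K] is at least half of it; hence the rate
   [kap * eta / 2]. *)
pose N2 := maxn (maxn n1 N) (Num.truncn (2 / kap)).+1.
apply: (@lt_le_trans _ _ (kap * eta / 2)%:E); first by rewrite lte_fin !mulr_gt0.
apply: (@limn_einf_ge _ _ _ N2) => n; rewrite !geq_max => /andP[/andP[nn1 nN] n2].
have n_gt0 : (0 < n)%N by exact: leq_ltn_trans n2.
rewrite tail_eventE//; have a0 := hrect_area_gt0 n_gt0.
set Pn := P _; set mn := Num.min _ _.
have mn2 : 2 / kap <= mn.
  rewrite le_min hN//= ltW//; apply: lt_le_trans (truncnS_gt _) _.
  by rewrite ler_nat.
have mn0 : 0 < mn by apply: lt_le_trans mn2; rewrite divr_gt0.
have kmn : 2 <= kap * mn by rewrite mulrC -ler_pdivrMr.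
pose K := Num.truncn (kap * mn).
have /andP[K1 K2] : K%:R <= kap * mn < K.+1%:R by apply: truncn_itv; lra.
have K0 : (0 < K)%N by rewrite truncn_gt0; lra.
have Kn : K%:R <= kap * n%:R.
  by apply: le_trans K1 _; rewrite ler_pM2l// ge_min lexx orbT.
have Kh : K%:R <= kap * h n by apply: le_trans K1 _; rewrite ler_pM2l// ge_min lexx.
have Pb : (Pn <= (expR (- (K%:R * (eta * area n))))%:E)%E.
  apply: le_trans (H n K (h n) (n%:R *: c) nn1 Kn Kh K0).
  exact: (flow_ge_clip ou uv iidt.1 ht'.1 tt').
have el := elog_le (measure_ge0 _ _) Pb.
have am0 : 0 < hrect_area (d := d) n l * mn by exact: mulr_gt0.
rewrite EFinN mulNe leeNr.
apply: le_trans (lee_wpmul2l _ el) _; first by rewrite lee_fin invr_ge0 ltW.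
rewrite -EFinM -EFinN lee_fin mulrN lerN2 [leRHS]mulrC ler_pdivlMr//.
rewrite -[hrect_area (d := d) n l]/(area n).
have : kap * mn / 2 <= K%:R by move: K2; rewrite -[K.+1%:R]natr1; lra.
have ea : 0 < eta * area n by exact: mulr_gt0.
move=> /(ler_wpM2r (ltW ea)); lra.
Qed.

Lemma moments_rate (lam : R) :
  (forall (theta : R) e, 0 < theta -> (\int[P]_w (expR (theta * t e w))%R%:E < +oo)%E) ->
  nu < lam ->
  (fun n : nat => (((hrect_area (d := d) n l)^-1)%:E *
         elog (P [set w | (lam <=
            tau (scale n (hrect (d := d) c u l)) v (h n) (fun e => t e w)
              / hrect_area (d := d) n l)%R]))%E) @ \oo --> -oo%E.
Proof.
move=> mom nulam.
pose phi x : R := Num.max 0 x.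
have mphi : measurable_fun setT phi by apply: measurable_maxr.
pose t' e w := phi (t e w).
have ht' : iid_law P t' _ := iid_law_map mphi (capacities_iid_law iidt e0).
have t'0 e w : 0 <= t' e w by rewrite le_max lexx.
have tt' : P.-negligible [set w | exists e, t e w != t' e w].
  apply: (negligibleS _ (capacities_ge0_ae iidt)).
  move=> w /= [e he]; exists e; rewrite ltNge; apply/negP => te; move/eqP: he; apply.
  by rewrite /t' /phi (max_r te).
have [nu0 tiles] := flow_constant_tiles ou uv l_gt0 iidt.1 ht'.1 t'0 tt' hnu.
have one : (\int[P]_w 1%:E <= 1%:E)%E.
  by rewrite integral_cst// mul1e [leLHS](@probability_setT _ _ _ P).
have moments : forall th : R, 0 < th -> exists2 B : R, 1 <= B &
    forall e, (\int[P]_o (expR (th * t' e o))%:E <= B%:E)%E.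
  move=> th th0.
  have mexp : measurable_fun [set: configT R (edge d)] (fun y => (expR (th * y e0))%:E).
    apply/measurable_EFinP; apply: measurableT_comp; first exact: measurable_expR.
    by apply: measurable_funM => //; exact: measurable_coord.
  (* The moment bound has to be uniform over edges; exchanging [e0] and [e] preserves the joint
     law. *)
  have same e : (\int[P]_o (expR (th * t' e o))%:E = \int[P]_o (expR (th * t' e0 o))%:E)%E.
    pose sw (f : edge d) := if f == e0 then e else if f == e then e0 else f.
    have swK : cancel sw sw.
      move=> f; rewrite /sw; have [->|f0] := eqVneq f e0.
        by rewrite eqxx; case: eqVneq.
      have [->|fe] := eqVneq f e; first by rewrite eqxx.
      by rewrite (negbTE f0) (negbTE fe).
    have := iid_law_integral (iid_law_perm swK ht') ht' mexp (fun y => expR_ge0 _).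
    by rewrite /sw eqxx.
  have fin0 : (\int[P]_o (expR (th * t' e0 o))%:E < +oo)%E.
    have m0 := mom th e0 th0.
    apply: (@le_lt_trans _ _ (\int[P]_o (1 * 1 + 1 * expR (th * t e0 o))%:E)%E).
      apply: integral_EFin_le.
      - apply: measurableT_comp; first exact: measurable_expR.
        by apply: measurable_funM => //; exact: ht'.1.
      - apply: measurable_funD => //; apply: measurable_funM => //.
        apply: measurableT_comp; first exact: measurable_expR.
        by apply: measurable_funM => //; exact: iidt.1.
      - by move=> w; exact: expR_ge0.
      - move=> w; rewrite !mul1r /t' /phi; case: (leP 0 (t e0 w)) => _.
          by rewrite lerDr.
        by rewrite mulr0 expR0 lerDl expR_ge0.
    have fint : (\int[P]_o (expR (th * t e0 o))%:E)%E \is a fin_num.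
      by rewrite ge0_fin_numE// integral_ge0// => w _; rewrite lee_fin expR_ge0.
    apply: le_lt_trans (integral_EFin_lin_le (f := fun=> 1)
      (b := fine (\int[P]_o (expR (th * t e0 o))%:E)%E) _ _ _ _ _ _ one _) _.
    - exact: measurable_cst.
    - apply: measurableT_comp; first exact: measurable_expR.
      by apply: measurable_funM => //; exact: iidt.1.
    - by [].
    - by move=> w; exact: expR_ge0.
    - by [].
    - by [].
    - by rewrite fineK.
    - by rewrite ltry.
  have fint : (\int[P]_o (expR (th * t' e0 o))%:E)%E \is a fin_num.
    by rewrite ge0_fin_numE// integral_ge0// => w _; rewrite lee_fin expR_ge0.
  exists (Num.max 1 (fine (\int[P]_o (expR (th * t' e0 o))%:E)%E)); first by rewrite le_max lexx.
  move=> e; rewrite same -[leLHS]fineK// lee_fin le_max lexx orbT//.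
apply/cvgeNyPle => A.
(* The additional 1 absorbs the prefactor [K.+1], whose logarithm is below [area n] for large
   [n]. *)
pose La := `|A| + 1.
have La0 : 0 < La by rewrite ltr_wpDl.
have [K [h1 [n1 H]]] := flow_tail_moments ou uv l_gt0 k_gt0
  ht' t'0 moments nu0 tiles La0 nulam.
have [N hN] := cvg_pinfty_eventually h1 hcvg.
have Pl : 0 < \prod_i l i by apply: prodr_gt0.
pose N3 := (Num.truncn (ln K.+1%:R / \prod_i l i)).+1.
exists (maxn (maxn n1 N) N3) => // n /=.
rewrite !geq_max => /andP[/andP[nn1 nN] n3].
have n_gt0 : (0 < n)%N by exact: leq_ltn_trans n3.
rewrite tail_eventE//; have a0 := hrect_area_gt0 n_gt0.
set Pn := P _.
have Pb : (Pn <= (expR (ln K.+1%:R - La * area n))%:E)%E.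
  apply: le_trans (flow_ge_clip ou uv iidt.1 ht'.1 tt' _ _ _ _) _.
  apply: le_trans (H n (h n) (n%:R *: c) nn1 (hN n nN)) _.
  by rewrite lee_fin expRD lnK ?posrE// ler_wpM2r ?expR_ge0// ler_nat.
have el := elog_le (measure_ge0 _ _) Pb.
apply: le_trans (lee_wpmul2l _ el) _; first by rewrite lee_fin invr_ge0 ltW.
rewrite -EFinM lee_fin mulrC ler_pdivrMr// -[hrect_area (d := d) n l]/(area n).
have lnK : ln K.+1%:R <= area n.
  have : ln K.+1%:R / \prod_i l i <= n%:R.
    by rewrite ltW//; apply: lt_le_trans (truncnS_gt _) _; rewrite ler_nat.
  rewrite ler_pdivrMr// => /le_trans; apply; rewrite /area ler_pM2r//.
  by rewrite -[leLHS]expr1 ler_weXn2l// ler1n.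
have : A * area n >= - `|A| * area n.
  by rewrite ler_pM2r// lerNl -normrN ler_norm.
rewrite /La; lra.
Qed.

End Parts.

Theorem theorem3 (R : realType) (d : nat) (hd : (2 <= d)%N) :
  (* (i) bounded support *)
  (forall (dO : measure_display) (Omega : measurableType dO)
          (P : probability Omega R) (t : edge d -> Omega -> R) (F : R -> R)
          (c : vecR R d) (u : 'I_d.-1 -> vecR R d) (l : 'I_d.-1 -> R)
          (v : vecR R d) (h : nat -> R) (nu : R),
      iid_capacities P t F ->
      (exists M : R, F M = 1) ->
      nondegenerate_hrect u l -> unit_normal u v ->
      (forall n, 0 <= h n) -> h @ \oo --> +oo ->
      is_flow_constant P t v nu ->
      forall lambda : R, nu < lambda ->
      (0 < limn_einf (fun n : nat =>
         (- (hrect_area n l * Num.min (h n) n%:R)^-1)%R%:E *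
         elog (P [set w | (lambda <=
            tau (scale n (hrect c u l)) v (h n) (fun e => t e w)
              / hrect_area n l)%R])))%E)
  /\
  (* (ii) exponential law of parameter 1 *)
  (exists D : R -> R, (forall lambda, 0 < D lambda) /\
   forall (c : vecR R d) (u : 'I_d.-1 -> vecR R d) (l : 'I_d.-1 -> R)
          (v : vecR R d) (h : nat -> R),
     nondegenerate_hrect u l -> unit_normal u v ->
     (forall n, 0 <= h n) -> h @ \oo --> +oo ->
     exists n0 : nat,
     forall (dO : measure_display) (Omega : measurableType dO)
            (P : probability Omega R) (t : edge d -> Omega -> R) (nu : R),
       iid_capacities P t (@exp_cdf R) ->
       is_flow_constant P t v nu ->
       forall lambda : R, nu < lambda ->
       forall n : nat, (n0 <= n)%N ->
       (P [set w | (lambda * hrect_area n l <=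
            tau (scale n (hrect c u l)) v (h n) (fun e => t e w))%R]
        >= (expR (- (D lambda * hrect_area n l)))%R%:E)%E)
  /\
  (* (iii) exponential moments of all orders *)
  (forall (dO : measure_display) (Omega : measurableType dO)
          (P : probability Omega R) (t : edge d -> Omega -> R) (F : R -> R)
          (c : vecR R d) (u : 'I_d.-1 -> vecR R d) (l : 'I_d.-1 -> R)
          (v : vecR R d) (h : nat -> R) (nu : R),
      iid_capacities P t F ->
      (forall (theta : R) e, 0 < theta ->
         (\int[P]_w (expR (theta * t e w))%R%:E < +oo)%E) ->
      nondegenerate_hrect u l -> unit_normal u v ->
      (forall n, 0 <= h n) -> h @ \oo --> +oo ->
      is_flow_constant P t v nu ->
      forall lambda : R, nu < lambda ->
      (fun n : nat => (
         ((hrect_area n l)^-1)%:E *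
         elog (P [set w | (lambda <=
            tau (scale n (hrect c u l)) v (h n) (fun e => t e w)
              / hrect_area n l)%R]))%E) @ \oo --> -oo%E).
Proof.
case: d hd => [//|k] hd; have k_gt0 : (0 < k)%N by [].
split; [|split].
- move=> dO Omega P t F c u l v h nu iidt [M FM] [ou l0] uv h0 hcvg hnu lam nulam.
  exact: bounded_rate FM nulam.
(* The constant must be positive at every real argument, hence the maximum with 0 and the added 1;
   [block_size] depends on the dimension only. *)
- exists (fun lam => (block_size k)%:R * Num.max lam 0 + 1); split.
    by move=> lam; rewrite ltr_wpDl// mulr_ge0// le_max lexx orbT.
  move=> c u l v h [ou l0] uv h0 hcvg.
  have [n0 [h1 H]] := flow_ge_exponential (Ordinal k_gt0) ou uv l0.
  have [N hN] := cvg_pinfty_eventually h1 hcvg.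
  exists (maxn (maxn n0 N) 1) => dO Omega P t nu iidt _ lam _ n.
  rewrite !geq_max => /andP[/andP[nn0 nN] n_gt0].
  have a0 : 0 < hrect_area (d := k.+1) n l by exact: hrect_area_gt0.
  set a := hrect_area n l in a0 *.
  have x0 : 0 <= Num.max lam 0 * a by rewrite mulr_ge0 ?(ltW a0)// le_max lexx orbT.
  apply: (@le_trans _ _ (P [set w | (Num.max lam 0 * a <= cylflow u v (n%:R *: c)
      (fun i => n%:R * l i) (h n) (fun e => t e w))%R])).
    apply: le_trans (H _ _ _ _ iidt _ _ _ _ nn0 (hN n nN) x0).
    by rewrite lee_fin ler_expR lerN2 mulrA ler_wpM2r ?(ltW a0)// lerDl.
  have mt := iidt.1.
  apply: le_measure; rewrite ?inE; [exact: measurable_flow_ge| |].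
    rewrite [X in measurable X](_ : _ = [set w | lam * a <= cylflow u v (n%:R *: c)
      (fun i => n%:R * l i) (h n) (fun e => t e w)]); first exact: measurable_flow_ge.
    by apply/seteqP; split => w /=; rewrite tau_cylflow.
  move=> w /= hw; rewrite tau_cylflow//; apply: le_trans hw.
  by rewrite ler_wpM2r ?(ltW a0)// le_max lexx.
- move=> dO Omega P t F c u l v h nu iidt mom [ou l0] uv h0 hcvg hnu lam nulam.
  exact (moments_rate k_gt0 ou uv l0 c hcvg iidt hnu mom nulam).
Qed.
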